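(* Let $V_h\subset H^2(\mathcal T)$ be a finite-dimensional subspace, let $\|\cdot\|_h$ be a norm on $H^2(\mathcal T)$, let $A_h,b_h,c_h:(V_h+M(\mathcal T))\times(V_h+M(\mathcal T))\to\mathbb R$ be bilinear forms with $A_h=a_{pw}+b_h+c_h$, and let $I_h:M(\mathcal T)\to V_h$ be linear. Suppose there are constants $\alpha,M,\Lambda_h,\Lambda_{dc},M_b,\Lambda_c\in(0,\infty)$ and $\Lambda_M,\Lambda_M',M_M\in[0,\infty)$ such that, for all $v_h,w_h\in V_h$, all $v_M,w_M\in M(\mathcal T)$, and all $v,w\in V$: 1. $\alpha\|v_h\|_h^2\le A_h(v_h,v_h)$ and $A_h(v_h,w_h)\le M\|v_h\|_h\|w_h\|_h$; 2. $|\!|\!|\cdot|\!|\!|_{pw}\le\|\cdot\|_h$ in $H^2(\mathcal T)$ and $|\!|\!|\cdot|\!|\!|_{pw}=\|\cdot\|_h$ in $V+M(\mathcal T)$; 3. $\|v_h-I_Mv_h\|_h\le\Lambda_M\|v_h-v\|_h$, $\ \|v_h-I_Mv_h\|_h\le\Lambda_M'\|v_h\|_h$, and $|\!|\!|I_Mv_h|\!|\!|_{pw}\le M_M\|v_h\|_h$; 4. $\|v_M-I_hv_M\|_h\le\Lambda_h|\!|\!|v_M-v|\!|\!|_{pw}$; 5. $a_{pw}(v_M,w_h-I_Mw_h)+b_h(v_M,w_h-I_Mw_h)\le\Lambda_{dc}|\!|\!|v_M-v|\!|\!|_{pw}\|w_h-w\|_h$; 6. $b_h(v_M,w_M)=0$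 and $b_h(v_h+v_M,w_h+w_M)\le M_b\|v_h+v_M\|_h\|w_h+w_M\|_h$; 7. $c_h(v_h,w_h)\le\Lambda_c\|v-v_h\|_h\|w-w_h\|_h$. Given $F\in V^*=H^{-2}(\Omega)$, let $u\in V$ solve $a(u,v)=F(v)$ for all $v\in V$ and let $u_h\in V_h$ solve $A_h(u_h,v_h)=F(JI_Mv_h)$ for all $v_h\in V_h$. Then $$\text{(a)}\quad\|u-u_h\|_h\le C_{qo}\,|\!|\!|u-I_Mu|\!|\!|_{pw},\qquad\text{(b)}\quad|\!|\!|u-JI_Mu_h|\!|\!|\le(1+\Lambda_M)(1+\Lambda_J)\|u-u_h\|_h$$ hold with the constant $$C_{qo}:=1+\Lambda_h+\alpha^{-1}\big(\Lambda_0M_M+\Lambda_h(1+M_b)+\Lambda_{dc}+\Lambda_c(1+\Lambda_h)\big).$$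
   Context: Let $\Omega\subset\mathbb R^2$ be a bounded Lipschitz domain with polygonal boundary, $V:=H^2_0(\Omega)$, $a(v,w):=\int_\Omega D^2v:D^2w\,dx$ and $|\!|\!|v|\!|\!|:=a(v,v)^{1/2}$ on $V$. Let $\mathcal T$ be a shape-regular triangulation of $\Omega$ into compact triangles (two distinct triangles are disjoint or share exactly a common vertex or a common edge). $\mathcal V,\mathcal V(\Omega)$ (resp. $\mathcal E,\mathcal E(\Omega)$) are the sets of all and interior vertices (resp. edges); $\mathcal T(z)$ is the set of triangles containing the vertex $z$. Each edge $E$ has a fixed unit normal $\nu_E$; $\langle\cdot\rangle_E$ is the arithmetic mean of the two traces on an interior edge $E$. $H^2(\mathcal T):=\{v\in L^2(\Omega): v|_T\in H^2(T)\ \forall T\in\mathcal T\}$; $P_k(\mathcal T)$ denotes piecewise polynomials of degree $\le k$; $a_{pw}(v,w):=\sum_{T\in\mathcal T}\int_TD^2v:D^2w\,dx$ and $|\!|\!|v|\!|\!|_{pw}:=a_{pw}(v,v)^{1/2}$ for $v,w\in H^2(\mathcal T)$. Morley space: $M(\mathcal T)$ is the set of $v\in P_2(\mathcal T)$ that are continuous at interior vertices and vanish at boundary vertices, and whose normal derivatives $\partial v/\partial\nu_E$ are continuous at midpoints of interior edges and vanish at midpoints of boundary edges. Generalized Morley interpolation $I_M:H^2(\mathcal T)\to M(\mathcal T)$: $v_M:=I_Mv_{pw}$ is determined by $v_M(z)=|\mathcal T(z)|^{-1}\sum_{T\in\mathcal T(z)}(v_{pw}|_T)(z)$ for $z\in\mathcal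 V(\Omega)$ and $\int_E\frac{\partial v_M}{\partial\nu_E}ds=\int_E\langle\frac{\partial v_{pw}}{\partial\nu_E}\rangle_Eds$ for $E\in\mathcal E(\Omega)$; degrees of freedom on the boundary are zero. Companion operator: $HCT(\mathcal T):=\{v\in H^2_0(\Omega): v|_T\in P_3(\mathcal K(T))\ \forall T\in\mathcal T\}$, where $\mathcal K(T)$ is the subdivision of $T$ into the three triangles $\mathrm{conv}\{E,\mathrm{mid}(T)\}$, $E$ an edge of $T$. $J:M(\mathcal T)\to(HCT(\mathcal T)+P_8(\mathcal T))\cap H^2_0(\Omega)$ is a fixed linear map (known to exist) such that, with a constant $\Lambda_J$ depending only on the shape regularity of $\mathcal T$, every $v_M\in M(\mathcal T)$ satisfies: $Jv_M(z)=v_M(z)$ for $z\in\mathcal V$; $\nabla(Jv_M)(z)=|\mathcal T(z)|^{-1}\sum_{T\in\mathcal T(z)}(\nabla v_M|_T)(z)$ for $z\in\mathcal V(\Omega)$; $\int_E\partial Jv_M/\partial\nu_E\,ds=\int_E\partial v_M/\partial\nu_E\,ds$ for $E\in\mathcal E$; $|\!|\!|v_M-Jv_M|\!|\!|_{pw}\le\Lambda_J\min_{v\in V}|\!|\!|v_M-v|\!|\!|_{pw}$; and $v_M-Jv_M\perp P_2(\mathcal T)$ in $L^2(\Omega)$. In particular $I_MJ=\mathrm{id}$ on $M(\mathcal T)$. Moreover $\Lambda_0:=\sup_{0\ne v_M\in M(\mathcal T)}|\!|\!|v_M-Jv_M|\!|\!|_{pw}/|\!|\!|v_M|\!|\!|_{pw}$.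 *)

(* Defs.v *)
From HB Require Import structures.
From mathcomp Require Import all_boot all_order all_algebra.
From mathcomp Require Import ring_quotient.
From mathcomp Require Import all_classical all_reals all_analysis.

Set Implicit Arguments.
Unset Strict Implicit.
Unset Printing Implicit Defensive.

Import Order.TTheory GRing.Theory Num.Theory.
Import numFieldNormedType.Exports.

Local Open Scope classical_set_scope.
Local Open Scope quotient_scope.
Local Open Scope ring_scope.

(* [measurableTypeR R] is [R] with its Borel sigma-algebra; the measurable,
   topological and normed structures of the plane are the product ones. *)
Notation plane R := (measurableTypeR R * measurableTypeR R)%type.

Definition leb2 (R : realType) : {measure set (plane R) -> \bar R} :=
  (lebesgue_measure \x lebesgue_measure)%E.

(* Square-integrable functions, before identification almost everywhere. *)
Definition L2fun_type (R : realType) := LfunType (leb2 R) (lee1n 2).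
HB.instance Definition _ (R : realType) := GRing.Lmodule.on (L2fun_type R).
Definition L2fun_val (R : realType) (f : L2fun_type R) : plane R -> R := f.

Section L2_space.
Context {R : realType}.

Definition aezero : {pred (L2fun_type R)} :=
  fun f => `[< \forall x \ae leb2 R, L2fun_val f x = 0 >].

Lemma aezero_submod : submod_closed aezero.
Proof.
split; first exact/asboolP/nearW.
move=> a f g /asboolP f0 /asboolP g0; apply/asboolP.
apply: filterS2 f0 g0 => x; rewrite /L2fun_val => fx gx.
by rewrite -[LHS]/(a * f x + g x) fx gx mulr0 addr0.
Qed.

HB.instance Definition _ :=
  GRing.isSubmodClosed.Build R (L2fun_type R) aezero aezero_submod.

Definition L2 := Quotient.quot aezero.

HB.instance Definition _ := Choice.on L2.
HB.instance Definition _ := GRing.Zmodule.on L2.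
HB.instance Definition _ := EqQuotient.on L2.

Definition L2scale (a : R) (f : L2) : L2 := \pi_L2 (a *: repr f).

Lemma pi_L2D (f g : L2fun_type R) : \pi_L2 (f + g) = \pi_L2 f + \pi_L2 g.
Proof. exact: Quotient.pi_add. Qed.

Lemma pi_L2Z (a : R) (f : L2fun_type R) :
  \pi_L2 (a *: f) = L2scale a (\pi_L2 f).
Proof.
apply/eqP; rewrite /L2scale -Quotient.idealrBE -scalerBr; apply: rpredZ.
by rewrite Quotient.idealrBE reprK.
Qed.

Lemma L2scaleA a b f : L2scale a (L2scale b f) = L2scale (a * b) f.
Proof. by rewrite -[f]reprK -(pi_L2Z b) -!pi_L2Z scalerA. Qed.

Lemma L2scale1 : left_id 1 L2scale.
Proof. by move=> f; rewrite -[f]reprK -pi_L2Z scale1r. Qed.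

Lemma L2scaleDr : right_distributive L2scale +%R.
Proof.
by move=> a f g; rewrite -[f]reprK -[g]reprK -pi_L2D -!pi_L2Z scalerDr pi_L2D.
Qed.

Lemma L2scaleDl f : {morph L2scale^~ f : a b / a + b}.
Proof. by move=> a b; rewrite -[f]reprK -!pi_L2Z scalerDl pi_L2D. Qed.

HB.instance Definition _ := GRing.Zmodule_isLmodule.Build R L2
  L2scaleA L2scale1 L2scaleDr L2scaleDl.

(* A representative of the class; all notions below depend on it only up to
   almost-everywhere equality. *)
Definition L2fun (f : L2) : plane R -> R := L2fun_val (repr f).

End L2_space.
Arguments L2 R : clear implicits.
Coercion L2fun : L2 >-> Funclass.

Section Subspaces.
Context {R : realType} {U : lmodType R}.

Definition linear_on (W : lmodType R) (S : set U) (f : U -> W) :=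
  forall (a : R) u v, S u -> S v -> f (a *: u + v) = a *: f u + f v.

Definition bilinear_on (S : set U) (b : U -> U -> R) :=
  (forall (a : R) u v w, S u -> S v -> S w ->
     b (a *: u + v) w = a * b u w + b v w) /\
  (forall (a : R) u v w, S u -> S v -> S w ->
     b w (a *: u + v) = a * b w u + b w v).

Definition norm_on (S : set U) (N : U -> R) :=
  [/\ forall u, S u -> 0 <= N u,
      forall u, S u -> N u = 0 -> u = 0,
      forall (a : R) u, S u -> N (a *: u) = `|a| * N u
    & forall u v, S u -> S v -> N (u + v) <= N u + N v].

Definition sumset (A B : set U) : set U := [set u + v | u in A & v in B].

Definition findim_subspace (A : set U) :=
  exists (d : nat) (e : 'I_d -> U),
    A = [set u | exists c : 'I_d -> R, u = \sum_(i < d) c i *: e i].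

End Subspaces.

Section Plane.
Context {R : realType}.
Notation pt := (plane R).

Definition coord (i : 'I_2) (x : pt) : R := if i == ord0 then x.1 else x.2.
Definition unitv (i : 'I_2) : pt := if i == ord0 then (1, 0) else (0, 1).
Definition dot (x y : pt) : R := \sum_(i < 2) coord i x * coord i y.
Definition enorm (x : pt) : R := Num.sqrt (dot x x).

Definition segment (a b : pt) : set pt :=
  [set a + t *: (b - a) | t in [set t : R | 0 <= t <= 1]].

Definition bdry (A : set pt) : set pt := closure A `\` A°.

(* Near each boundary point, in suitable orthonormal coordinates, [Om] is
   the set above the graph of a Lipschitz function. *)
Definition lipschitz_boundary (Om : set pt) :=
  forall x, bdry Om x -> exists (e1 e2 : pt) (r h k : R) (g : R -> R),
    [/\ [/\ dot e1 e1 = 1, dot e2 e2 = 1 & dot e1 e2 = 0],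
        0 < r, 0 < h, k.-lipschitz g
      & forall s t : R, `|s| < r -> `|t| < h ->
          (Om (x + s *: e1 + t *: e2) <-> g s < t)].

Definition polygonal_boundary (Om : set pt) :=
  exists s : seq (pt * pt),
    bdry Om = [set x | exists2 ab, ab \in s & segment ab.1 ab.2 x].

Definition polygonal_lipschitz_domain (Om : set pt) :=
  [/\ open Om, connected Om, Om !=set0 & bounded_set Om] /\
  lipschitz_boundary Om /\ polygonal_boundary Om.

Definition pd (i : 'I_2) (f : pt -> R) : pt -> R := 'D_(unitv i) f.

Fixpoint Ck (k : nat) (f : pt -> R) : Prop :=
  continuous f /\
  if k is k'.+1 then
    (forall i x, derivable f x (unitv i)) /\ forall i, Ck k' (pd i f)
  else True.

Definition smooth (f : pt -> R) := forall k, Ck k f.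

Definition testfun (U : set pt) (phi : pt -> R) :=
  let supp := closure [set x | phi x != 0] in
  [/\ smooth phi, compact supp & supp `<=` U].

Definition L2on (U : set pt) : set (L2 R) :=
  [set f | \forall x \ae leb2 R, ~ U x -> f x = 0].

(* Squared L^2(U) distance, possibly infinite. *)
Definition l2err (U : set pt) (f g : pt -> R) : \bar R :=
  (\int[leb2 R]_(x in U) ((f x - g x) ^+ 2)%:E)%E.

Definition is_wderiv (U : set pt) (i : 'I_2) (f g : L2 R) :=
  L2on U g /\
  forall phi, testfun U phi ->
    \int[leb2 R]_(x in U) (f x * pd i phi x) =
    - \int[leb2 R]_(x in U) (g x * phi x).

(* The weak partial derivative in L^2(U) of the restriction of [f] to the open
   set [U], extended by zero (and 0 if there is none). *)
Definition wderiv (U : set pt) (i : 'I_2) (f : L2 R) : L2 R :=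
  xget 0 (is_wderiv U i f).

(* The restriction of [f] to [U] belongs to H^1(U), resp. H^2(U). *)
Definition H1 (U : set pt) (f : L2 R) :=
  forall i, exists g, is_wderiv U i f g.
Definition H2 (U : set pt) (f : L2 R) :=
  H1 U f /\ forall i, H1 U (wderiv U i f).

(* H^2_0(Om) is the closure of the test functions in the norm of H^2(Om). *)
Definition H20 (Om : set pt) : set (L2 R) :=
  [set v | [/\ L2on Om v, H2 Om v &
    exists phi : nat -> pt -> R,
      [/\ forall m, testfun Om (phi m),
          l2err Om v (phi m) @[m --> \oo] --> 0%E,
          forall i, l2err Om (wderiv Om i v) (pd i (phi m))
            @[m --> \oo] --> 0%E
        & forall i j, l2err Om (wderiv Om j (wderiv Om i v))
            (pd j (pd i (phi m))) @[m --> \oo] --> 0%E]]].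

(* int_U D^2 v : D^2 w dx *)
Definition hess (U : set pt) (v w : L2 R) : R :=
  \sum_(i < 2) \sum_(j < 2) \int[leb2 R]_(x in U)
    (wderiv U j (wderiv U i v) x * wderiv U j (wderiv U i w) x).

(* (v|_A)(z), for the representative of [v] that is continuous on [A]. *)
Definition ptval (A : set pt) (v : L2 R) (z : pt) : R :=
  xget 0 [set y | exists f : pt -> R,
    [/\ {within A, continuous f},
        \forall x \ae leb2 R, A x -> v x = f x & y = f z]].

Definition poly2 (k : nat) (f : pt -> R) :=
  exists c : nat -> nat -> R, forall x,
    f x = \sum_(i < k.+1) \sum_(j < k.+1 | (i + j <= k)%N)
            c i j * coord ord0 x ^+ i * coord ord_max x ^+ j.

Definition poly_on (k : nat) (A : set pt) (v : L2 R) :=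
  exists2 f, poly2 k f & \forall x \ae leb2 R, A x -> v x = f x.

(* [g] is the L^2 trace, parametrised over [0, 1], along the segment from [a]
   to [b] of the H^1(U) function [w]: the continuous extension of the
   restriction of smooth functions. *)
Definition is_trace (U : set pt) (a b : pt) (w : L2 R) (g : R -> R) :=
  measurable_fun (`[0, 1] : set R) g /\
  exists phi : nat -> pt -> R,
    [/\ forall m, smooth (phi m),
        l2err U w (phi m) @[m --> \oo] --> 0%E,
        forall i, l2err U (wderiv U i w) (pd i (phi m)) @[m --> \oo] --> 0%E
      & (\int[lebesgue_measure]_(t in `[0%R, 1%R])
           ((g t - phi m (a + t *: (b - a))) ^+ 2)%:E)%E
          @[m --> \oo] --> 0%E].

Definition trace (U : set pt) (a b : pt) (w : L2 R) : R -> R :=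
  xget (cst 0) (is_trace U a b w).

End Plane.

(* Vertices are indexed by ['I_n] through [p]; triangles and edges are sets of
   three, resp. two, vertex indices. *)
Section Triangulation.
Context {R : realType} (Om : set (plane R)).
Context {n : nat} (p : 'I_n -> plane R) (TT : {set {set 'I_n}}).
Notation pt := (plane R).

Definition hull (S : {set 'I_n}) : set pt :=
  [set x | exists l : 'I_n -> R,
    [/\ forall i, 0 <= l i, forall i, i \notin S -> l i = 0,
        \sum_i l i = 1 & x = \sum_i l i *: p i]].

Definition mid (S : {set 'I_n}) : pt := #|S|%:R^-1 *: \sum_(i in S) p i.

Definition det2 (x y : pt) : R := x.1 * y.2 - x.2 * y.1.

(* In the last clause, [K :&: K'] has at most two elements: two distinct
   triangles are disjoint or share exactly a common vertex or edge. *)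
Definition triangulation :=
  [/\ injective p,
      forall z, exists2 K, K \in TT & z \in K,
      forall K, K \in TT -> exists i j k,
        K = [set i; j; k]%SET /\ det2 (p j - p i) (p k - p i) != 0,
      closure Om = [set x | exists2 K, K \in TT & hull K x]
    & forall K K', K \in TT -> K' \in TT -> K != K' ->
        hull K `&` hull K' = hull (K :&: K')].

(* Bounded ratio of diameter and inradius. *)
Definition shape_regular (kappa : R) :=
  forall K, K \in TT -> exists (x : pt) (r : R),
    [/\ 0 < r, [set y | enorm (y - x) <= r] `<=` hull K
      & forall i j, i \in K -> j \in K -> enorm (p i - p j) <= kappa * r].

Definition edges : {set {set 'I_n}} :=
  [set E : {set 'I_n} | (#|E| == 2%N) && [exists K in TT, E \subset K]]%SET.

Definition Tvertex (z : 'I_n) : {set {set 'I_n}} := [set K in TT | z \in K]%SET.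
Definition Tedge (E : {set 'I_n}) : {set {set 'I_n}} :=
  [set K in TT | E \subset K]%SET.

Definition int_vertex (z : 'I_n) := Om (p z).
Definition bdry_edge (E : {set 'I_n}) := hull E `<=` bdry Om.
Definition int_edge (E : {set 'I_n}) := ~ bdry_edge E.

Definition edge_a (E : {set 'I_n}) : pt := nth 0 [seq p i | i <- enum E] 0.
Definition edge_b (E : {set 'I_n}) : pt := nth 0 [seq p i | i <- enum E] 1.

Definition unit_normals (nu : {set 'I_n} -> pt) :=
  forall E, E \in edges ->
    dot (nu E) (nu E) = 1 /\ dot (nu E) (edge_b E - edge_a E) = 0.

Notation "K ^t" := ((hull K)°) (at level 2, format "K ^t").

Definition H2pw : set (L2 R) :=
  [set v | L2on Om v /\ forall K, K \in TT -> H2 K^t v].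

Definition apw (v w : L2 R) : R := \sum_(K in TT) hess K^t v w.
Definition npw (v : L2 R) : R := Num.sqrt (apw v v).

Definition V : set (L2 R) := H20 Om.
Definition aform (v w : L2 R) : R := hess Om v w.
Definition nV (v : L2 R) : R := Num.sqrt (aform v v).

Definition Ppw (k : nat) : set (L2 R) :=
  [set v | L2on Om v /\ forall K, K \in TT -> poly_on k (hull K) v].

Context (nu : {set 'I_n} -> pt).

(* Normal derivative across [E] at the point [x], from the triangle [K]. *)
Definition dnu_at (K E : {set 'I_n}) (v : L2 R) (x : pt) : R :=
  \sum_(i < 2) coord i (nu E) * ptval (hull K) (wderiv K^t i v) x.

(* int_E (d(v|_K) / d nu_E) ds, by means of the trace from [K]. *)
Definition flux (K E : {set 'I_n}) (v : L2 R) : R :=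
  enorm (edge_b E - edge_a E) *
  \int[lebesgue_measure]_(t in `[0, 1])
    (\sum_(i < 2)
       coord i (nu E) * trace K^t (edge_a E) (edge_b E) (wderiv K^t i v) t).

Definition Morley : set (L2 R) :=
  [set v | [/\ Ppw 2 v,
    forall z, int_vertex z -> forall K K', K \in Tvertex z ->
      K' \in Tvertex z -> ptval (hull K) v (p z) = ptval (hull K') v (p z),
    forall z, ~ int_vertex z -> forall K, K \in Tvertex z ->
      ptval (hull K) v (p z) = 0,
    forall E, E \in edges -> int_edge E -> forall K K', K \in Tedge E ->
      K' \in Tedge E -> dnu_at K E v (mid E) = dnu_at K' E v (mid E)
  & forall E, E \in edges -> bdry_edge E -> forall K, K \in Tedge E ->
      dnu_at K E v (mid E) = 0]].

(* An interior edge belongs to exactly two triangles, so that the average over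
   [Tedge E] is the arithmetic mean of the two traces.  The integral on the
   left-hand side is the same from both sides of [E], since the normal
   derivative is affine on [E] and continuous at its midpoint. *)
Definition is_morley_interp (IM : L2 R -> L2 R) :=
  forall v, H2pw v ->
    [/\ Morley (IM v),
        forall z, int_vertex z -> forall K, K \in Tvertex z ->
          ptval (hull K) (IM v) (p z) =
          #|Tvertex z|%:R^-1 *
            \sum_(K' in Tvertex z) ptval (hull K') v (p z)
      & forall E, E \in edges -> int_edge E -> forall K, K \in Tedge E ->
          flux K E (IM v) =
          #|Tedge E|%:R^-1 * \sum_(K' in Tedge E) flux K' E v].

(* conv{E, mid(K)} *)
Definition hct_cell (K E : {set 'I_n}) : set pt :=
  [set x | exists2 y, hull E y & segment y (mid K) x].

Definition HCT : set (L2 R) :=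
  [set v | V v /\ forall K E : {set 'I_n}, K \in TT -> E \subset K -> #|E| = 2%N ->
     poly_on 3 (hct_cell K E) v].

(* [Jv] is continuously differentiable up to the boundary, so its value and
   gradient at a vertex are those of the continuous representatives on the
   closure of [Om]. *)
Definition is_companion (LJ : R) (J : L2 R -> L2 R) :=
  linear_on Morley J /\
  forall v, Morley v ->
    [/\ sumset HCT (Ppw 8) (J v) /\ V (J v),
        forall z K, K \in Tvertex z ->
          ptval (closure Om) (J v) (p z) = ptval (hull K) v (p z),
        forall z i, int_vertex z ->
          ptval (closure Om) (wderiv Om i (J v)) (p z) =
          #|Tvertex z|%:R^-1 *
            \sum_(K in Tvertex z) ptval (hull K) (wderiv K^t i v) (p z),
        forall E K, E \in edges -> K \in Tedge E ->
          flux K E (J v) = flux K E v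
      & npw (v - J v) <= LJ * inf [set npw (v - w) | w in V] /\
        forall q, Ppw 2 q -> \int[leb2 R]_(x in Om) (L2fun (v - J v) x * q x) = 0].

Definition Lambda0 (J : L2 R -> L2 R) : R :=
  sup [set npw (v - J v) / npw v | v in [set v | Morley v /\ v != 0]].

(* V^*, with the dual norm of the energy norm *)
Definition dualV (F : L2 R -> R) :=
  linear_on V F /\ exists C : R, forall v, V v -> `|F v| <= C * nV v.

End Triangulation.

(* Main.v *)
Require Import Defs.
From HB Require Import structures.
From mathcomp Require Import all_boot all_order all_algebra.
From mathcomp Require Import ring_quotient.
From mathcomp Require Import all_classical all_reals all_analysis.
From mathcomp Require Import measurable_realfun.
From mathcomp Require Import ring lra.

(** The a priori estimate is Strang's argument for the discrete error
    [Ih (IM u) - uh], carried out in [quasi_optimality] for an arbitrary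
    semi-inner product. Coercivity bounds this error by the residual of
    [Ih (IM u)], and all terms of the residual but one are estimated by a
    hypothesis of the theorem with comparison functions [u] and [0]. The
    remaining term is [apw (IM u) w - F (J w)] with a Morley function [w].
    It equals [apw (u - IM u) (w - J w)] and is therefore at most [Lambda0]
    times the two energy norms, thanks to two orthogonalities:

    - [apw (v - IM v) q = 0] for [v] in H^2_0 and a Morley function [q];
    - [apw (w - J w) q = 0] for Morley functions [w] and [q].

    The estimate for the postprocessed solution ([companion_error]) is the
    triangle inequality.

    Both orthogonalities have the same reason. The Hessian of [q] is constant
    on each triangle [K], so only the integrals of the second derivatives over
    [K] matter. By the divergence theorem such an integral is a combination of
    the means of the gradient over the three edges. The tangential part of
    such a mean is a difference of vertex values and its normal part is a flux,
    so the mean Hessian is a function of the vertex values and the fluxes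
    ([same_mean_hessian]), and these agree for [v] and [IM v], and for [w] and
    [J w] ([apw_same_data]).

    The work lies in the fact that all these quantities are defined for
    elements of L^2. Uniqueness of weak derivatives is [fundamental_lemma]. An
    element of H^2_0 is a limit of test functions; these are integrals of their
    mixed second derivatives, hence converge uniformly, to a continuous
    representative vanishing outside the domain ([H20_continuous]), whose
    values are the point values ([ptval_tri]). On lines, the first derivatives
    of the test functions are integrals of second derivatives over transversal
    segments, hence converge in mean square, which provides the traces
    ([line_restriction_cvg]). The mean of any trace over an edge of a triangle
    is given by integrals over the triangle ([trace_tri]), so it is the limit
    of the means of the test functions ([trace_mean], [flux_lim]), and does not
    depend on the side of the edge. Piecewise polynomials fit in the same frame
    with constant sequences ([H2lim]).

    Finally, the energy form of H^2_0 is the piecewise one ([aform_apw]) because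
    the interiors of the triangles lie in the domain, which is where the
    Lipschitz regularity enters ([lipschitz_interior_closure]), and cover it up
    to a null set ([partition_ae]). *)

Set Implicit Arguments.
Unset Strict Implicit.
Unset Printing Implicit Defensive.

Import Order.TTheory GRing.Theory Num.Theory.
Import numFieldNormedType.Exports.

Local Open Scope classical_set_scope.
Local Open Scope quotient_scope.
Local Open Scope ring_scope.

(** * Planar sets and functions *)

Section Measurability.
Context {R : realType}.
Implicit Types (A U : set (plane R)).

Lemma plane_nbhsP (x : plane R) (A : set (plane R)) :
  nbhs x A <-> exists2 e : R, 0 < e &
    forall y : plane R, `|x.1 - y.1| < e -> `|x.2 - y.2| < e -> A y.
Proof.
split.
- move/nbhs_ballP => [e e0 xA]; exists e => // y y1 y2; apply: xA.
  by split; rewrite /ball/=.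
- move=> [e e0 xA]; apply/nbhs_ballP; exists e => // y [y1 y2]; exact: xA.
Qed.

Lemma open_planeP (A : set (plane R)) :
  open A <-> forall x, A x -> exists2 e : R, 0 < e &
    forall y : plane R, `|x.1 - y.1| < e -> `|x.2 - y.2| < e -> A y.
Proof.
rewrite openE; split => AA x /AA; by move/plane_nbhsP.
Qed.

Definition rect (a b c d : R) : set (plane R) := `]a, b[ `*` `]c, d[.

Lemma rectP (a b c d : R) (x : plane R) :
  rect a b c d x <-> a < x.1 < b /\ c < x.2 < d.
Proof. by rewrite /rect /= !in_itv. Qed.

Lemma measurable_rect a b c d : measurable (rect a b c d).
Proof. by apply: measurableX; exact: measurable_itv. Qed.

(** Rational corners make the rectangles countable in number, so that
    statements about an open set follow from countably many rectangles. *)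
Lemma in_rat_rect U (x : plane R) : open U -> U x ->
  exists a b c d : rat, rect (ratr a) (ratr b) (ratr c) (ratr d) x /\
    `[ratr a, ratr b] `*` `[ratr c, ratr d] `<=` U.
Proof.
move=> /open_planeP oU /oU[e e0 xU].
have q1 (y : R) : exists a b : rat, [/\ y - e < ratr a, ratr a < y, y < ratr b & ratr b < y + e].
  have [a /andP[]] := @rat_in_itvoo R (y - e) y ltac:(lra).
  rewrite !bnd_simp => a1 a2.
  have [b /andP[]] := @rat_in_itvoo R y (y + e) ltac:(lra).
  rewrite !bnd_simp => b1 b2.
  by exists a, b.
have [a [b [a1 a2 b1 b2]]] := q1 x.1.
have [c [d [c1 c2 d1 d2]]] := q1 x.2.
exists a, b, c, d; split; first by apply/rectP; rewrite a2 b1 c2 d1.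
move=> y [] /=; rewrite !in_itv /= => /andP[? ?] /andP[? ?].
by apply: xU; rewrite ltr_norml; lra.
Qed.

Lemma open_rat_rect U : open U ->
  U = \bigcup_(q in [set q : rat * rat * (rat * rat) |
        `[ratr q.1.1, ratr q.1.2] `*` `[ratr q.2.1, ratr q.2.2] `<=` U])
      rect (ratr q.1.1) (ratr q.1.2) (ratr q.2.1) (ratr q.2.2).
Proof.
move=> oU; apply/seteqP; split => x.
- move=> /(in_rat_rect oU)[a [b [c [d [xr rU]]]]].
  by exists ((a, b), (c, d)).
- move=> [[[a b] [c d]] /= qU xr]; apply: qU; move: xr => /rectP[/andP[? ?] /andP[? ?]].
  by split => /=; rewrite in_itv /=; lra.
Qed.

Lemma open_measurable_plane U : open U -> measurable U.
Proof.
move=> oU; rewrite (open_rat_rect oU) bigcup_mkcond.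
apply: countable_bigcupT_measurable; first exact: countableP.
by move=> q; case: ifPn => // _; exact: measurable_rect.
Qed.

Lemma continuous_measurable_plane (f : plane R -> R) :
  continuous f -> measurable_fun setT f.
Proof.
move=> /continuousP cf; apply: (measurability _ (@measurable_realfun.RGenOpens.measurableE R)).
move=> _ [_ [a [b ->] <-]]; rewrite setTI.
apply: open_measurable_plane; apply: cf; exact: interval_open.
Qed.

End Measurability.

(** * Square-integrable functions on the plane *)

Section L2basics.
Context {R : realType}.
Local Notation mu := (leb2 R).

Lemma L2fun_sqi (f : L2 R) : (f : plane R -> R) \in Lfun mu 2%:E.
Proof. exact: LfunP. Qed.

Lemma L2_measurable (f : L2 R) : measurable_fun setT (f : plane R -> R).
Proof. by have := L2fun_sqi f; rewrite inE => /andP[]; rewrite inE. Qed.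

Lemma pi_L2P (f g : L2fun_type R) :
  \pi_(L2 R) f = \pi_(L2 R) g <-> \forall x \ae mu, L2fun_val f x = L2fun_val g x.
Proof.
split.
- move/eqP; rewrite -Quotient.idealrBE => /asboolP; apply: filterS => x.
  rewrite /L2fun_val => h; apply/eqP; rewrite -subr_eq0; apply/eqP; exact: h.
- move=> h; apply/eqP; rewrite -Quotient.idealrBE; apply/asboolP.
  apply: filterS h => x; rewrite /L2fun_val => h.
  by rewrite -[LHS]/(f x - g x) h subrr.
Qed.

(** Equality in the quotient is almost-everywhere equality of representatives,
    whichever representatives are chosen. *)
Lemma L2P (f g : L2 R) : f = g <-> \forall x \ae mu, f x = g x.
Proof. by rewrite -pi_L2P !reprK. Qed.

Lemma pi_L2E (f : L2fun_type R) : \forall x \ae mu, (\pi_(L2 R) f : L2 R) x = L2fun_val f x.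
Proof. by apply/pi_L2P; rewrite reprK. Qed.

Lemma L2DE (f g : L2 R) : \forall x \ae mu, (f + g : L2 R) x = f x + g x.
Proof.
have := pi_L2E (repr f + repr g); rewrite pi_L2D !reprK.
by apply: filterS => x ->.
Qed.

Lemma L2ZE (a : R) (f : L2 R) : \forall x \ae mu, (a *: f : L2 R) x = a * f x.
Proof.
have := pi_L2E (a *: repr f); rewrite pi_L2Z reprK.
by apply: filterS => x ->.
Qed.

Lemma L20E : \forall x \ae mu, (0 : L2 R) x = 0.
Proof.
have := L2ZE 0 0; rewrite scale0r; apply: filterS => x ->; exact: mul0r.
Qed.

Lemma L2_exists (f : plane R -> R) : f \in Lfun mu 2%:E ->
  exists F : L2 R, \forall x \ae mu, F x = f x.
Proof.
move=> sf; exists (\pi_(L2 R) (Lfun_Sub (lee1n 2) sf)).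
by have := pi_L2E (Lfun_Sub (lee1n 2) sf); apply: filterS => x ->.
Qed.

End L2basics.

(** * Mean-square convergence *)

Lemma cvge0_lt {R : realType} (u : nat -> \bar R) (e : R) :
  u m @[m --> \oo] --> 0%E -> 0 < e -> \forall m \near \oo, (u m < e%:E)%E.
Proof.
move=> /fine_cvgP[uf u0] e0; move/cvgrPdist_lt : u0 => /(_ e e0) u0.
near=> m; rewrite -(@fineK _ (u m)); last by near: m.
rewrite lte_fin; have : `|0 - fine (u m)| < e by near: m.
by rewrite sub0r normrN => /ltr_normlP[].
Unshelve. all: by end_near. Qed.

Lemma cvge0P {R : realType} (u : nat -> \bar R) :
  (forall m, (0 <= u m)%E) ->
  (forall e : R, 0 < e -> \forall m \near \oo, (u m < e%:E)%E) ->
  u m @[m --> \oo] --> 0%E.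
Proof.
move=> u0 ue; apply/fine_cvgP; split.
  have := ue 1 ltr01; apply: filterS => m um.
  by rewrite ge0_fin_numE// (lt_le_trans um)// leey.
apply/cvgrPdist_lt => e e0; have := ue e e0; apply: filterS => m um.
have uf : u m \is a fin_num by rewrite ge0_fin_numE// (lt_le_trans um)// leey.
rewrite sub0r normrN ger0_norm; last by rewrite fine_ge0.
by rewrite -lte_fin fineK.
Qed.

Section L2conv.
Context d (T : measurableType d) (R : realType).
Variable mu : {measure set T -> \bar R}.
Variable (U : set T).
Hypothesis mU : measurable U.
Local Open Scope ereal_scope.

Lemma ge0_square_int (h : T -> R) : 0 <= \int[mu]_(x in U) ((h x) ^+ 2)%:E.
Proof. by apply: integral_ge0 => x _; rewrite lee_fin sqr_ge0. Qed.

(** From 2 e |k h| <= e^2 k^2 + h^2. The free weight [e] makes it a substitute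
    for the Cauchy-Schwarz inequality in limit arguments. *)
Lemma young_integral (k h : T -> R) (e : R) :
  measurable_fun U k -> measurable_fun U h -> (0 < e)%R ->
  \int[mu]_(x in U) `|(k x * h x)%:E| <=
  e%:E * \int[mu]_(x in U) (k x ^+ 2)%:E + (e^-1)%:E * \int[mu]_(x in U) (h x ^+ 2)%:E.
Proof.
move=> mk mh e0.
have mk2 : measurable_fun U (fun x => (k x ^+ 2 : R)%:E : \bar R).
  by apply/measurable_EFinP; exact: measurable_funX.
have mh2 : measurable_fun U (fun x => (h x ^+ 2 : R)%:E : \bar R).
  by apply/measurable_EFinP; exact: measurable_funX.
have e0' := ltW e0; have ei0 : (0 <= e^-1)%R by rewrite invr_ge0.
rewrite -ge0_integralZl_EFin//; last by move=> x _; rewrite lee_fin sqr_ge0.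
rewrite -ge0_integralZl_EFin//; last by move=> x _; rewrite lee_fin sqr_ge0.
rewrite -ge0_integralD//; last 4 first.
- by move=> x _; rewrite mule_ge0// lee_fin sqr_ge0.
- exact: measurable_funeM.
- by move=> x _; rewrite mule_ge0// lee_fin sqr_ge0.
- exact: measurable_funeM.
apply: ge0_le_integral => //.
- apply: measurableT_comp => //; apply/measurable_EFinP; exact: measurable_funM.
- by apply: emeasurable_funD; exact: measurable_funeM.
move=> x _; rewrite -!EFinM -EFinD abse_EFin lee_fin normrM.
rewrite -(real_normK (num_real (k x))) -(real_normK (num_real (h x))).
set a := `|k x|%R; set b := `|h x|%R.
have : (0 <= e^-1 * ((e * a - b)^+2 + e ^+2 * a ^+2 + b^+2))%R.
  by apply: mulr_ge0 => //; rewrite -exprMn !addr_ge0 ?sqr_ge0.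
have -> : (e^-1 * ((e * a - b)^+2 + e ^+2 * a ^+2 + b^+2) =
   2 * (e * a ^+ 2 + e^-1 * b ^+ 2 - a * b))%R by field; rewrite gt_eqF.
by rewrite pmulr_rge0// subr_ge0.
Qed.

Lemma integrable_square_mul (k h : T -> R) :
  measurable_fun U k -> measurable_fun U h ->
  \int[mu]_(x in U) (k x ^+ 2)%:E < +oo ->
  \int[mu]_(x in U) (h x ^+ 2)%:E < +oo ->
  mu.-integrable U (fun x => (k x * h x)%:E).
Proof.
move=> mk mh ik ih; apply/integrableP; split.
  by apply/measurable_EFinP; exact: measurable_funM.
apply: (le_lt_trans (young_integral mk mh ltr01)).
by rewrite invr1 !mul1e lte_add_pinfty.
Qed.

(** In Young's inequality the weight is chosen first, to make the term in [k
    ^+ 2] small, and then the index, to make the mean-square error small. *)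
Lemma cvg_square_pairing (k w : T -> R) (phi : nat -> T -> R) :
  measurable_fun U k -> measurable_fun U w ->
  (forall m, measurable_fun U (phi m)) ->
  \int[mu]_(x in U) (k x ^+ 2)%:E < +oo ->
  mu.-integrable U (fun x => (k x * w x)%:E) ->
  \int[mu]_(x in U) ((w x - phi m x) ^+ 2)%:E @[m --> \oo] --> 0 ->
  (\int[mu]_(x in U) (k x * phi m x))%R @[m --> \oo] -->
  (\int[mu]_(x in U) (k x * w x))%R.
Proof.
move=> mk mw mphi ik ikw cphi; apply/cvgrPdist_lt => e e0.
have ik0 := ge0_square_int k.
pose I := fine (\int[mu]_(x in U) (k x ^+ 2)%:E).
have IE : I%:E = \int[mu]_(x in U) (k x ^+ 2)%:E by rewrite /I fineK// ge0_fin_numE.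
have I0 : (0 <= I)%R by rewrite -lee_fin IE.
pose c := (e / 2 / (I + 1))%R.
have c0 : (0 < c)%R by rewrite !divr_gt0//; lra.
near=> m.
have hm : \int[mu]_(x in U) ((w x - phi m x) ^+ 2)%:E < (c * (e / 2))%:E.
  near: m; apply: cvge0_lt => //; apply: mulr_gt0 => //; lra.
have mh : measurable_fun U (fun x => (w x - phi m x)%R) by exact: measurable_funB.
have ih : mu.-integrable U (fun x => (k x * (w x - phi m x))%:E).
  by apply: integrable_square_mul => //; apply: (lt_trans hm); rewrite ltry.
have iphi : mu.-integrable U (fun x => (k x * phi m x)%:E).
  have -> : (fun x => (k x * phi m x)%:E) =
    (fun x => (k x * w x)%:E) \- (fun x => (k x * (w x - phi m x))%:E).
    by apply/funext => x /=; rewrite -EFinB; congr EFin; ring.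
  exact: integrableB.
have -> : (\int[mu]_(x in U) (k x * w x) - \int[mu]_(x in U) (k x * phi m x) =
   \int[mu]_(x in U) (k x * (w x - phi m x)))%R.
  rewrite -RintegralB//; apply: eq_Rintegral => x _ /=; ring.
apply: (le_lt_trans (le_normr_Rintegral mU ih)).
rewrite -lte_fin.
rewrite /Rintegral fineK; last first.
  by apply: integrable_fin_num => //; rewrite -/(abse \o _); exact: (integrable_abse ih).
apply: (le_lt_trans (young_integral mk mh c0)).
rewrite -IE.
have -> : (e = c * (I + 1) + e / 2)%R by rewrite /c; field; rewrite gt_eqF//; lra.
rewrite EFinD; apply: lee_ltD => //; first by rewrite lee_fin ler_wpM2l ?ltW//; lra.
by rewrite lte_pdivrMl// -EFinM.
Unshelve. all: by end_near. Qed.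

End L2conv.

(** * Linear changes of variables *)

Section Affine.
Context {R : realType}.
Local Notation leb := (@lebesgue_measure R).
Local Open Scope ereal_scope.

Lemma measurable_affine (a b : R) :
  measurable_fun setT (fun s : measurableTypeR R => (a * s + b)%R : measurableTypeR R).
Proof.
apply: measurable_funD => //; exact: measurable_funM.
Qed.

(** The scaled image measure agrees with the Lebesgue measure on half-open
    intervals, and uniqueness of the latter extends this to all measurable
    sets. For negative [a] the preimage of a half-open interval is half-open
    on the other side. *)
Lemma lebesgue_affine (a b : R) : a != 0%R -> forall A : set (measurableTypeR R),
  measurable A ->
  leb A = (`|a|%R)%:E * leb ((fun s : measurableTypeR R => (a * s + b)%R) @^-1` A).
Proof.
move=> a0 A mA.
pose na : {nonneg R} := NngNum (normr_ge0 a).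
have ma := measurable_affine a b.
pose phi (s : measurableTypeR R) : measurableTypeR R := (a * s + b)%R.
pose m' : {measure set (measurableTypeR R) -> \bar R} := mscale na (pushforward leb phi).
suff : leb A = m' ma A by [].
apply: lebesgue_measure_unique mA => _ [[x y] /= _ <-].
rewrite /m' /mscale /= /pushforward /=.
case: (ltgtP a 0%R) a0 => // a0 _.
- have -> : (fun s => (a * s + b)%R) @^-1` `]x, y] = `[((y - b) / a)%R, ((x - b) / a)%R[%classic.
    apply/seteqP; split => s /=; rewrite !in_itv/= ler_ndivrMr// ltr_ndivlMr// => /andP[? ?]; lra.
  rewrite !lebesgue_measure_itv /= !lte_fin.
  rewrite ltr_ndivrMr// -mulrA mulVf ?lt_eqF// mulr1 ltrBlDr subrK.
  case: ifP => _; last by rewrite mule0.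
  rewrite -!EFinB -EFinM ltr0_norm//; congr EFin; field; exact: ltr0_neq0.
- have -> : (fun s => (a * s + b)%R) @^-1` `]x, y] = `]((x - b) / a)%R, ((y - b) / a)%R]%classic.
    apply/seteqP; split => s /=; rewrite !in_itv/= ltr_pdivrMr// ler_pdivlMr// => /andP[? ?]; lra.
  rewrite !lebesgue_measure_itv /= !lte_fin.
  rewrite ltr_pdivrMr// -mulrA mulVf ?gt_eqF// mulr1 ltrBlDr subrK.
  case: ifP => _; last by rewrite mule0.
  rewrite -!EFinB -EFinM gtr0_norm//; congr EFin; field; exact: lt0r_neq0.
Qed.

Lemma ge0_integral_affine (a b : R) (f : measurableTypeR R -> \bar R) : a != 0%R ->
  measurable_fun setT f -> (forall x, 0 <= f x) ->
  \int[leb]_x f x = (`|a|%R)%:E * \int[leb]_s f (a * s + b)%R.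
Proof.
move=> a0 mf f0.
have ma := measurable_affine a b.
pose phi (s : measurableTypeR R) : measurableTypeR R := (a * s + b)%R.
pose nu : {measure set (measurableTypeR R) -> \bar R} := pushforward leb phi.
have -> : \int[leb]_s f (a * s + b)%R = \int[nu ma]_x f x.
  by rewrite (ge0_integral_pushforward ma).
pose na : {nonneg R} := NngNum (normr_ge0 a).
rewrite -(@ge0_integral_mscale _ _ _ (nu ma) setT _ na)//.
apply: eq_measure_integral => A mA _; exact: lebesgue_affine.
Qed.

End Affine.

Section Linear.
Context {R : realType}.
Local Notation leb := (@lebesgue_measure R).

Definition affine_map (P a b : plane R) (z : plane R) : plane R :=
  (P.1 + z.1 * a.1 + z.2 * b.1, P.2 + z.1 * a.2 + z.2 * b.2).

Lemma affine_mapE P a b z : affine_map P a b z = P + z.1 *: a + z.2 *: b.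
Proof. by []. Qed.

Lemma measurable_affine_map P a b : measurable_fun setT (affine_map P a b).
Proof.
apply: measurable_fun_pair => /=; apply: measurable_funD => //.
- apply: measurable_funD => //; exact: measurable_funM.
- exact: measurable_funM.
- apply: measurable_funD => //; exact: measurable_funM.
- exact: measurable_funM.
Qed.

Local Open Scope ereal_scope.

Let ge0_integral_linear1 (P a b : plane R) (h : plane R -> \bar R) :
  a.1 != 0%R -> det2 a b != 0%R ->
  measurable_fun setT h -> (forall x, 0 <= h x) ->
  \int[leb2 R]_x h x = (`|det2 a b|%R)%:E * \int[leb2 R]_z h (affine_map P a b z).
Proof.
move=> a1 dab mh h0.
have mha : measurable_fun setT (h \o affine_map P a b).
  by apply: measurableT_comp => //; exact: measurable_affine_map.
have ha0 x : 0 <= (h \o affine_map P a b) x by exact: h0.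
rewrite /leb2 (fubini_tonelli2 (h \o affine_map P a b))//.
pose g (w : plane R) : \bar R :=
  h (w.1, (a.2 / a.1 * (w.1 - P.1) + P.2 + det2 a b / a.1 * w.2)%R).
have mg : measurable_fun setT g.
  apply: measurableT_comp => //; apply: measurable_fun_pair => //=.
  apply: measurable_funD; last by apply: measurable_funM.
  apply: measurable_funD => //; apply: measurable_funM => //.
  exact: measurable_funB.
have g0 x : 0 <= g x by exact: h0.
have E1 (t : R) : (`|a.1|%R)%:E * fubini_G leb (h \o affine_map P a b) t =
    \int[leb]_x g (x, t).
  rewrite (@ge0_integral_affine _ a.1 (P.1 + t * b.1)%R)//; last by apply: (measurableT_comp mg).
  congr (_ * _); apply: eq_integral => s _.
  rewrite /g /affine_map /=; congr (h (_, _)); first by ring.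
  by rewrite /det2; field.
have E2 : (`|a.1|%R)%:E * \int[leb]_t fubini_G leb (h \o affine_map P a b) t =
   \int[leb]_x \int[leb]_t g (x, t).
  rewrite -ge0_integralZl//; last 2 first.
  - by apply: measurable_fun_fubini_tonelli_G => // x; exact: h0.
  - by move=> t _; apply: integral_ge0 => ? _; exact: h0.
  by under eq_integral do rewrite E1; rewrite -(fubini_tonelli g).
have E3 (x : R) : (`|det2 a b / a.1|%R)%:E * \int[leb]_t g (x, t) = \int[leb]_y h (x, y).
  rewrite [RHS](@ge0_integral_affine _ (det2 a b / a.1)%R (a.2 / a.1 * (x - P.1) + P.2)%R)//.
  - congr (_ * _); apply: eq_integral => s _; rewrite /g /=; congr (h (_, _)); ring.
  - by rewrite mulf_neq0// invr_neq0.
  - exact: measurableT_comp.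
rewrite (fubini_tonelli1 h mh h0).
under eq_integral do rewrite /fubini_F -E3.
have mG : measurable_fun setT (fun x : measurableTypeR R => \int[leb]_t g (x, t)).
  exact: (measurable_fun_fubini_tonelli_F g).
have G0 (x : measurableTypeR R) : setT x -> 0 <= \int[leb]_t g (x, t).
  by move=> _; apply: integral_ge0 => ? _; exact: g0.
have k0 : 0 <= (`|det2 a b / a.1|%R)%:E by rewrite lee_fin.
have Z := @ge0_integralZl _ _ _ leb _ measurableT _ mG _ G0 k0.
apply: (etrans Z).
rewrite -E2 muleA -EFinM -normrM; congr (_%:E * _); congr `|_|%R.
by field.
Qed.

(** When [a.1] is nonzero, the map changes one coordinate at a time by affine
    maps of one variable, under Tonelli's theorem; exchanging [a] and [b]
    reaches the remaining case. *)
Lemma ge0_integral_linear (P a b : plane R) (h : plane R -> \bar R) :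
  det2 a b != 0%R ->
  measurable_fun setT h -> (forall x, 0 <= h x) ->
  \int[leb2 R]_x h x = (`|det2 a b|%R)%:E * \int[leb2 R]_z h (affine_map P a b z).
Proof.
move=> dab mh h0.
have [a1|a1] := eqVneq a.1 0%R; last exact: ge0_integral_linear1.
have b1 : b.1 != 0%R.
  by apply: contraNneq dab => b1; rewrite /det2 a1 b1 mul0r mulr0 subrr.
have dba : det2 b a != 0%R.
  by apply: contraNneq dab; rewrite /det2 => H; apply/eqP; rewrite -[LHS]opprK -[in RHS]oppr0 -H; congr (- _)%R; ring.
rewrite (@ge0_integral_linear1 P b a)//.
have -> : (`|det2 b a| = `|det2 a b|)%R by rewrite -normrN; congr `|_|%R; rewrite /det2; ring.
congr (_ * _).
have m1 : measurable_fun setT (h \o affine_map P a b).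
  by apply: measurableT_comp => //; exact: measurable_affine_map.
have m2 : measurable_fun setT (h \o affine_map P b a).
  by apply: measurableT_comp => //; exact: measurable_affine_map.
have h1 x : 0 <= (h \o affine_map P a b) x by exact: h0.
have h2 x : 0 <= (h \o affine_map P b a) x by exact: h0.
rewrite /leb2 (fubini_tonelli1 (h \o affine_map P b a) m2 h2).
rewrite (fubini_tonelli2 (h \o affine_map P a b) m1 h1).
apply: eq_integral => t _; apply: eq_integral => s _ /=.
by rewrite /affine_map /=; congr (h (_, _)); ring.
Qed.

Lemma integrable_linear (P a b : plane R) (h : plane R -> \bar R) :
  det2 a b != 0%R -> (leb2 R).-integrable setT h ->
  (leb2 R).-integrable setT (h \o affine_map P a b).
Proof.
move=> dab /integrableP[mh ih]; apply/integrableP; split.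
  by apply: measurableT_comp => //; exact: measurable_affine_map.
move: ih; rewrite (@ge0_integral_linear P a b (abse \o h))//; last 2 first.
- exact: measurableT_comp.
- by move=> x; exact: abse_ge0.
move=> ih; rewrite ltNge leye_eq; apply/negP => /eqP i0; move: ih.
by rewrite /= i0 gt0_muley ?ltxx// lte_fin normr_gt0.
Qed.

Lemma integral_linear (P a b : plane R) (h : plane R -> \bar R) :
  det2 a b != 0%R -> (leb2 R).-integrable setT h ->
  \int[leb2 R]_x h x = (`|det2 a b|%R)%:E * \int[leb2 R]_z h (affine_map P a b z).
Proof.
move=> dab ih; have mh := measurable_int _ ih.
have iha := integrable_linear P dab ih.
rewrite [LHS]integralE.
rewrite (@ge0_integral_linear P a b h^\+)//; last exact: measurable_funepos.
rewrite (@ge0_integral_linear P a b h^\-)//; last exact: measurable_funeneg.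
have E : \int[leb2 R]_z h (affine_map P a b z) =
  \int[leb2 R]_z h^\+ (affine_map P a b z) - \int[leb2 R]_z h^\- (affine_map P a b z).
  rewrite [LHS]integralE; congr (_ - _); apply: eq_integral => x _.
    by rewrite (funepos_comp h (affine_map P a b)).
  by rewrite (funeneg_comp h (affine_map P a b)).
rewrite E [RHS]muleBr//; have := integrable_add_def measurableT iha.
by rewrite funepos_comp funeneg_comp.
Qed.

Lemma Rintegral_linear (P a b : plane R) (h : plane R -> R) :
  det2 a b != 0%R -> (leb2 R).-integrable setT (EFin \o h) ->
  (\int[leb2 R]_x h x = `|det2 a b| * \int[leb2 R]_z h (affine_map P a b z))%R.
Proof.
move=> dab ih; rewrite /Rintegral (integral_linear P dab ih) fineM//.
by apply: integrable_fin_num => //; exact: (integrable_linear P dab ih).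
Qed.

End Linear.

(** * Differentiable functions on the plane *)

Section Smooth.
Context {R : realType}.
Notation pt := (plane R).
Implicit Types (f g : pt -> R) (x a v : pt).

Lemma plane_eq x a : x.1 = a.1 -> x.2 = a.2 -> x = a.
Proof. by case: x a => [x1 x2] [a1 a2] /= -> ->. Qed.

Lemma Ck_continuous k f : Ck k f -> continuous f.
Proof. by case: k => [|k] []. Qed.

Lemma Ck_derivable k f i x : Ck k.+1 f -> derivable f x (unitv i).
Proof. by move=> [_ [df _]]. Qed.

Lemma Ck_pd k f i : Ck k.+1 f -> Ck k (pd i f).
Proof. by move=> [_ [_ dk]]; exact: dk. Qed.

Lemma CkW k f : Ck k.+1 f -> Ck k f.
Proof.
elim: k f => [|k IH] f; first by case.
move=> [cf [df dk]]; split; first exact: cf.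
by split=> [|i]; [exact: df|exact: IH (dk i)].
Qed.

Lemma pdD f g i : (forall x, derivable f x (unitv i)) ->
  (forall x, derivable g x (unitv i)) ->
  pd i (f + g) = pd i f + pd i g.
Proof. by move=> df dg; apply/funext => x; rewrite /pd deriveD. Qed.

Lemma pdM f g i : (forall x, derivable f x (unitv i)) ->
  (forall x, derivable g x (unitv i)) ->
  pd i (f * g) = pd i f * g + f * pd i g.
Proof.
move=> df dg; apply/funext => x; rewrite /pd deriveM// addrC; congr (_ + _).
exact: mulrC.
Qed.

Lemma pd_cst (c : R) i : pd i (cst c : pt -> R) = cst 0.
Proof. by apply/funext => x; rewrite /pd derive_cst. Qed.

Lemma Ck_cst k (c : R) : Ck k (cst c : pt -> R).
Proof.
elim: k c => [|k IH] c; first by split=> // x; apply: cvg_cst.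
split; first by move=> x; apply: cvg_cst.
split; first by move=> i x; exact: derivable_cst.
by move=> i; rewrite pd_cst.
Qed.

Lemma CkD k f g : Ck k f -> Ck k g -> Ck k (f + g).
Proof.
elim: k f g => [|k IH] f g.
  by move=> [cf _] [cg _]; split=> // x; apply: continuousD; [exact: cf|exact: cg].
move=> [cf [df kf]] [cg [dg kg]]; split.
  by move=> x; apply: continuousD; [exact: cf|exact: cg].
split=> i; first by move=> x; apply: derivableD.
by rewrite pdD//; apply: IH; [exact: kf|exact: kg].
Qed.

Lemma CkM k f g : Ck k f -> Ck k g -> Ck k (f * g).
Proof.
elim: k f g => [|k IH] f g.
  by move=> [cf _] [cg _]; split=> // x; apply: continuousM; [exact: cf|exact: cg].
move=> Cf Cg; have [cf [df kf]] := Cf; have [cg [dg kg]] := Cg; split.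
  by move=> x; apply: continuousM; [exact: cf|exact: cg].
split=> i; first by move=> x; apply: derivableM.
rewrite pdM//; apply: CkD; apply: IH.
- exact: kf.
- exact: CkW.
- exact: CkW.
- exact: kg.
Qed.

Lemma smooth_cst (c : R) : smooth (cst c : pt -> R).
Proof. by move=> k; exact: Ck_cst. Qed.

Lemma smoothD f g : smooth f -> smooth g -> smooth (f + g).
Proof. by move=> sf sg k; exact: CkD. Qed.

Lemma smoothM f g : smooth f -> smooth g -> smooth (f * g).
Proof. by move=> sf sg k; exact: CkM. Qed.

Lemma smooth_continuous f : smooth f -> continuous f.
Proof. by move=> sf; exact: Ck_continuous (sf 0%N). Qed.

Lemma smooth_derivable f i x : smooth f -> derivable f x (unitv i).
Proof. by move=> sf; exact: Ck_derivable (sf 1%N). Qed.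

Lemma smooth_pd f i : smooth f -> smooth (pd i f).
Proof. by move=> sf k; exact: Ck_pd (sf k.+1). Qed.

Lemma derivable_line f a v (t : R) : derivable f (a + t *: v) v ->
  is_derive t 1 (fun s : R => f (a + s *: v)) ('D_v f (a + t *: v)).
Proof.
move=> df; set g := fun s : R => f (a + s *: v).
have E : (fun h : R => h^-1 *: ((f \o shift (a + t *: v)) (h *: v) - f (a + t *: v)))
   = (fun h : R => h^-1 *: ((g \o shift t) (h *: (1 : R)) - g t)).
  apply/funext => h; rewrite /g; congr (_ *: (f _ - _)).
  have -> : h *: (1 : R) = h by exact: mulr1.
  by rewrite /shift scalerDl addrCA.
split; last by rewrite /derive -E.
by rewrite /derivable -E.
Qed.

(** Stated for both signs of [c], so that the same lemma serves difference
    quotients from either side. *)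
Lemma mean_value f v a (c : R) : (forall x, derivable f x v) ->
  exists2 t : R, 0 <= t <= 1 &
    f (a + c *: v) - f a = c * 'D_v f (a + (t * c) *: v).
Proof.
move=> df; pose g (s : R) := f (a + s *: v).
have dg (t : R) : is_derive t 1 g ('D_v f (a + t *: v)) by exact: derivable_line.
have cg (b d : R) : {within `[b, d], continuous g}.
  apply: continuous_subspaceT => t; apply: differentiable_continuous.
  exact/derivable1_diffP/(@ex_derive _ _ _ _ _ _ _ (dg t)).
have g0 : g 0 = f a by rewrite /g scale0r addr0.
have [c0|c0] := leP 0 c.
  have [t] := @MVT_segment R g _ 0 c c0 (fun z _ => dg z) (cg _ _).
  rewrite g0 in_itv/= subr0 => /andP[t0 tc] E.
  have [cz|cz] := eqVneq c 0.
    by exists 0; rewrite ?lexx ?ler01// cz mul0r scale0r addr0 subrr.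
  exists (t / c); first by rewrite divr_ge0//= ler_pdivrMr ?mul1r// lt_def cz.
  by rewrite -mulrA mulVf// mulr1 mulrC -E.
have [t] := @MVT_segment R g _ c 0 (ltW c0) (fun z _ => dg z) (cg _ _).
rewrite g0 in_itv/= sub0r => /andP[tc t0] E.
exists (t / c); first by rewrite ler_ndivlMr// mul0r t0 ler_ndivrMr// mul1r tc.
rewrite -mulrA mulVf ?lt_eqF// mulr1 -opprB E; ring.
Qed.

Definition gradd (v : pt) (f : pt -> R) (x : pt) : R :=
  v.1 * pd ord0 f x + v.2 * pd ord_max f x.

(** A continuously differentiable function is differentiable: two applications
    of the mean value theorem, one along each axis, reduce the difference
    quotient to partial derivatives at nearby points. *)
Lemma C1_derive f x v : Ck 1%N f -> is_derive x v f (gradd v f x).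
Proof.
move=> [cf [df dk]].
have cp i : {for x, continuous (pd i f)} by have [cp _] := dk i; exact: cp.
suff H : h^-1 *: ((f \o shift x) (h *: v) - f x) @[h --> 0^'] --> gradd v f x.
  apply: DeriveDef; first by apply/cvg_ex; exists (gradd v f x).
  exact: (cvg_lim _ H).
apply/cvgrPdist_lt => e e0.
pose c := `|v.1| + `|v.2| + 1.
have c0 : 0 < c by rewrite /c ltr_wpDl// addr_ge0.
have [d d0 Hd] : exists2 d : R, 0 < d & forall (i : 'I_2) y, `|x.1 - y.1| < d -> `|x.2 - y.2| < d ->
    `|pd i f x - pd i f y| < e / c.
  have H i : exists2 d : R, 0 < d & forall y, `|x.1 - y.1| < d -> `|x.2 - y.2| < d ->
    `|pd i f x - pd i f y| < e / c.
    have /cvgrPdist_lt /(_ (e / c)) := cp i.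
    move=> /(_ (divr_gt0 e0 c0)) /nbhs_ballP [d d0 xd]; exists d => // y y1 y2.
    by apply: xd; split.
  have [d0 d00 H0] := H ord0; have [d1 d10 H1] := H ord_max.
  exists (Num.min d0 d1); first by rewrite lt_min d00.
  move=> i y; rewrite !lt_min => /andP[a1 a2] /andP[b1 b2].
  have [->|->] : i = ord0 \/ i = ord_max.
    by case: i => [[|[|//]] ?]; [left|right]; exact: val_inj.
  - exact: H0.
  - exact: H1.
near=> h.
have h0 : h != 0 by near: h; exact: nbhs_dnbhs_neq.
have hd : `|h| * c < d.
  rewrite -ltr_pdivlMr//; near: h; apply: dnbhs0_lt; exact: divr_gt0.
have hv1 : `|h * v.1| < d.
  rewrite normrM; apply: le_lt_trans hd; apply: ler_wpM2l => //.
  by rewrite /c -addrA lerDl addr_ge0.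
have hv2 : `|h * v.2| < d.
  rewrite normrM; apply: le_lt_trans hd; apply: ler_wpM2l => //.
  by rewrite /c [`|_| + `|_|]addrC -addrA lerDl addr_ge0.
have [t /andP[t0 t1] Et] := @mean_value f (unitv ord0) (x.1, x.2 + h * v.2) (h * v.1) (df ord0).
have [s /andP[s0 s1] Es] := @mean_value f (unitv ord_max) x (h * v.2) (df ord_max).
have -> : (f \o shift x) (h *: v) - f x =
  h * (v.1 * pd ord0 f ((x.1, x.2 + h * v.2) + (t * (h * v.1)) *: unitv ord0) +
       v.2 * pd ord_max f (x + (s * (h * v.2)) *: unitv ord_max)).
  move: Et Es; rewrite -/(pd ord0 f _) -/(pd ord_max f _).
  set A := pd ord0 f _; set B := pd ord_max f _ => Et Es.
  have -> : h * (v.1 * A + v.2 * B) = h * v.1 * A + h * v.2 * B by ring.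
  rewrite -Et -Es.
  have -> : (x.1, x.2 + h * v.2) + (h * v.1) *: unitv ord0 = h *: v + x :> pt.
    by apply: plane_eq; rewrite /= /GRing.scale /=; ring.
  have -> : x + (h * v.2) *: unitv ord_max = (x.1, x.2 + h * v.2) :> pt.
    by apply: plane_eq; rewrite /= /GRing.scale /=; ring.
  by rewrite /=; ring.
rewrite /GRing.scale /= mulKf// /gradd.
set p : pt := (x.1, x.2 + h * v.2) + (t * (h * v.1)) *: unitv ord0.
set q : pt := x + (s * (h * v.2)) *: unitv ord_max.
have -> : v.1 * pd ord0 f x + v.2 * pd ord_max f x - (v.1 * pd ord0 f p + v.2 * pd ord_max f q) =
  v.1 * (pd ord0 f x - pd ord0 f p) + v.2 * (pd ord_max f x - pd ord_max f q) by ring.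
have small (r w : R) : 0 <= r -> r <= 1 -> `|w| < d -> `|r * w| < d.
  by move=> r0 r1 wd; rewrite normrM ger0_norm//; apply: le_lt_trans wd; rewrite ler_piMl.
have Hp : `|pd ord0 f x - pd ord0 f p| < e / c.
  apply: Hd; rewrite /p /= /GRing.scale /=.
    by rewrite mulr1 opprD addNKr normrN small.
  by rewrite mulr0 addr0 opprD addNKr normrN.
have Hq : `|pd ord_max f x - pd ord_max f q| < e / c.
  apply: Hd; rewrite /q /= /GRing.scale /=.
    by rewrite mulr0 addr0 subrr normr0.
  by rewrite mulr1 opprD addNKr normrN small.
apply: (le_lt_trans (ler_normD _ _)); rewrite !normrM.
have -> : e = (`|v.1| + `|v.2| + 1) * (e / c) by rewrite /c; field; rewrite gt_eqF.
have ec : 0 < e / c by exact: divr_gt0.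
rewrite !mulrDl mul1r; apply: ltr_pwDr => //.
have v10 := normr_ge0 v.1. have v20 := normr_ge0 v.2.
by apply: lerD; apply: ler_wpM2l => //; exact: ltW.
Unshelve. all: by end_near. Qed.

Lemma smooth_derive_line f a v (t : R) : smooth f ->
  is_derive t 1 (fun s : R => f (a + s *: v)) (gradd v f (a + t *: v)).
Proof.
move=> sf; have Cf := sf 1%N; have H := C1_derive (a + t *: v) v Cf.
have := derivable_line (@ex_derive _ _ _ _ _ _ _ H).
by rewrite (@derive_val _ _ _ _ _ _ _ H).
Qed.

End Smooth.

(** * Smooth bumps *)

Section Lift.
Context {R : realType}.
Notation pt := (plane R).

Lemma derivable_line_inv (f : pt -> R) (a v : pt) (t l : R) :
  is_derive t 1 (fun s : R => f (a + s *: v)) l ->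
  is_derive (a + t *: v) v f l.
Proof.
move=> [dg Dg]; set g := fun s : R => f (a + s *: v) in dg Dg.
have E : (fun h : R => h^-1 *: ((f \o shift (a + t *: v)) (h *: v) - f (a + t *: v)))
   = (fun h : R => h^-1 *: ((g \o shift t) (h *: (1 : R)) - g t)).
  apply/funext => h; rewrite /g; congr (_ *: (f _ - _)).
  have -> : h *: (1 : R) = h by exact: mulr1.
  by rewrite /shift scalerDl addrCA.
split; last by rewrite /derive E.
by rewrite /derivable E.
Qed.

Lemma continuous_coord (i : 'I_2) : continuous (@Defs.coord R i).
Proof.
rewrite /Defs.coord; case: (i == ord0) => x.
  exact: cvg_fst. 
exact: cvg_snd.
Qed.

Lemma coordD (i : 'I_2) (x y : pt) : Defs.coord i (x + y) = Defs.coord i x + Defs.coord i y.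
Proof. by rewrite /Defs.coord; case: ifP. Qed.

Lemma coordZ (i : 'I_2) (c : R) (x : pt) : Defs.coord i (c *: x) = c * Defs.coord i x.
Proof. by rewrite /Defs.coord; case: ifP. Qed.

Lemma coord_unitv (i j : 'I_2) : Defs.coord i (unitv j : pt) = (i == j)%:R.
Proof.
have ij (k : 'I_2) : k = ord0 \/ k = ord_max.
  by case: k => [[|[|//]] ?]; [left|right]; exact: val_inj.
by rewrite /Defs.coord /unitv; case: (ij i) => ->; case: (ij j) => ->.
Qed.

Lemma is_derive_lift (h h' : R -> R) (i j : 'I_2) (c d : R) (x : pt) :
  (forall t : R, is_derive t 1 h (h' t)) ->
  is_derive x (unitv j) (fun y : pt => h (c * Defs.coord i y + d))
    ((i == j)%:R * c * h' (c * Defs.coord i x + d)).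
Proof.
move=> dh; rewrite -[x](addr0) -(scale0r (unitv j)).
apply: derivable_line_inv.
set e := (i == j)%:R * c.
have -> : (fun s : R => h (c * Defs.coord i (x + s *: unitv j) + d)) =
   h \o (fun s : R => s * e + (c * Defs.coord i x + d)).
  apply/funext => s /=; congr h; rewrite coordD coordZ coord_unitv /e; ring.
rewrite scale0r addr0 [e * _]mulrC; apply: is_derive1_comp.
  by rewrite mul0r add0r; exact: dh.
have -> : (fun s : R => s * e + (c * Defs.coord i x + d)) =
   horner (e *: 'X + (c * Defs.coord i x + d)%:P).
  by apply/funext => s; rewrite hornerD hornerZ hornerX hornerC mulrC.
by apply: is_derive_eq; rewrite derivD derivZ derivX derivC addr0 hornerZ hornerC mulr1.
Qed.

(** Partial derivatives of a member are constant multiples of members, so that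
    C^k-regularity follows by induction on [k] for the whole family at once.
    *)
Lemma smooth_lift (I : Type) (D : I -> I) (h : I -> R -> R) :
  (forall p t, is_derive (t : R) 1 (h p) (h (D p) t)) ->
  forall p i c d, smooth (fun x : pt => h p (c * Defs.coord i x + d)).
Proof.
move=> dh p i c d k; elim: k p => [|k IH] p.
  split=> // x.
  have ch : {for (c * Defs.coord i x + d), continuous (h p)}.
    apply: differentiable_continuous; apply/derivable1_diffP.
    exact: (@ex_derive _ _ _ _ _ _ _ (dh p _)).
  apply: (@continuous_comp _ _ _ (fun y : pt => c * Defs.coord i y + d) (h p)) => //.
  apply: continuousD; last exact: cst_continuous.
  apply: continuousM; first exact: cst_continuous.
  exact: continuous_coord.
have dp j x := is_derive_lift i j c d x (dh p).
split; first exact: Ck_continuous (IH p).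
split=> j; first by move=> x; exact: (@ex_derive _ _ _ _ _ _ _ (dp j x)).
have -> : pd j (fun x : pt => h p (c * Defs.coord i x + d)) =
   (cst ((i == j)%:R * c)) * (fun x : pt => h (D p) (c * Defs.coord i x + d)).
  by apply/funext => x; exact: (@derive_val _ _ _ _ _ _ _ (dp j x)).
by apply: CkM; [exact: Ck_cst|exact: IH].
Qed.

Lemma smooth_poly1 (p : {poly R}) (i : 'I_2) : smooth (fun x : pt => p.[Defs.coord i x]).
Proof.
have := @smooth_lift {poly R} (fun p => p^`()) (fun p => horner p)
  (fun p t => is_derive_poly p t) p i 1 0.
by congr smooth; apply/funext => x; rewrite mul1r addr0.
Qed.

Lemma smooth_coordX (i : 'I_2) n : smooth (fun x : pt => Defs.coord i x ^+ n).
Proof.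
have := smooth_poly1 'X^n i; congr smooth; apply/funext => x; exact: hornerXn.
Qed.

End Lift.

Section Bump.
Context {R : realType}.

(** The function p(1/x) exp(-1/x), continued by zero. The polynomial is
    carried along because differentiating exp(-1/x) produces one; the
    resulting family is closed under differentiation. *)
Definition bumpp (p : {poly R}) (x : R) : R :=
  if 0 < x then p.[x^-1] * expR (- x^-1) else 0.

(** At the origin exp(-1/x) beats any power of 1/x: bound exp(y) from below by
    (y / (i+1))^(i+1) for each monomial. *)
Lemma bumpp_bound (p : {poly R}) : exists C : R, forall x, `|bumpp p x| <= C * `|x|.
Proof.
exists (\sum_(i < size p) `|p`_i| * i.+1%:R ^+ i.+1) => x; rewrite /bumpp.
case: ifPn => [x0|_]; last first.
  by rewrite normr0 mulr_ge0// sumr_ge0// => i _; rewrite mulr_ge0.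
rewrite horner_coef !mulr_suml; apply: (le_trans (ler_norm_sum _ _ _)).
apply: ler_sum => i _; rewrite !normrM -!mulrA ler_wpM2l//.
rewrite normrX gtr0_norm ?invr_gt0// gtr0_norm ?expR_gt0// gtr0_norm//.
set y := x^-1; have y0 : 0 < y by rewrite invr_gt0.
have H : (y / i.+1%:R) ^+ i.+1 <= expR y.
  have -> : expR y = expR (y / i.+1%:R) ^+ i.+1.
    by rewrite -expRM_natl; congr expR; rewrite mulrC divfK ?pnatr_eq0.
  apply: lerXn2r; rewrite ?nnegrE ?expR_ge0//; first by rewrite divr_ge0// ltW.
  by apply: le_trans (expR_ge1Dx _); rewrite lerDr.
rewrite expRN ler_pdivrMr ?expR_gt0//.
have -> : x = y^-1 by rewrite /y invrK.
rewrite expr_div_n ler_pdivrMr ?exprn_gt0// in H.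
rewrite mulrAC ler_pdivlMr// -exprSr mulrC; exact: H.
Qed.

(** Away from the origin this is the chain rule. At the origin the difference
    quotient of [bumpp p] is [bumpp ('X * p)], which tends to zero by the
    preceding bound. *)
Lemma bumpp_derive (p : {poly R}) (x : R) :
  is_derive x 1 (bumpp p) (bumpp ('X^2 * (p - p^`())) x).
Proof.
have [x0|x0|x0] := ltgtP x 0.
- have E : {near x, cst 0 =1 bumpp p}.
    near=> y; rewrite /bumpp ifF//; apply/negbTE; rewrite -leNgt ltW//; near: y.
    exact: lt_nbhsl.
  have -> : bumpp ('X^2 * (p - p^`())) x = 0 by rewrite /bumpp ifF// ltNge ltW.
  apply: DeriveDef; first by apply: (near_eq_derivable E); exact: derivable_cst.
  by rewrite -(near_eq_derive _ E) derive_cst.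
- have E : {near x, (fun y : R => p.[y^-1] * expR (- y^-1)) =1 bumpp p}.
    near=> y; rewrite /bumpp ifT//; near: y; exact: lt_nbhsr.
  have xn0 : x != 0 by rewrite gt_eqF.
  have dV : is_derive x 1 (fun y : R => y^-1) (- x ^- 2).
    have := @is_deriveV R id x 1 1 xn0 (is_derive_id _ _).
    by rewrite /GRing.scale /= mulr1.
  have dp := is_derive1_comp (is_derive_poly p x^-1) dV.
  have de : is_derive x 1 (expR \o (fun y : R => - y^-1)) (expR (- x^-1) * (x^-2)).
    apply: is_derive1_comp.
    by have := is_deriveN dV; rewrite opprK.
  have D := is_deriveM dp de.
  have -> : bumpp ('X^2 * (p - p^`())) x =
     ((horner p \o (fun y : R => y^-1)) x *: (expR (- x^-1) * x ^- 2) +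
      (expR \o (fun y : R => - y^-1)) x *: (p^`().[x^-1] * (- x ^- 2))).
    rewrite /bumpp x0 /GRing.scale /= hornerM hornerXn hornerD hornerN exprVn; ring.
  apply: DeriveDef.
    by apply: (near_eq_derivable E); exact: (@ex_derive _ _ _ _ _ _ _ D).
  by rewrite -(near_eq_derive _ E); exact: (@derive_val _ _ _ _ _ _ _ D).
- rewrite x0 {x x0}.
  have -> : bumpp ('X^2 * (p - p^`())) 0 = 0 by rewrite /bumpp ltxx.
  have [C HC] := bumpp_bound ('X * p).
  have H : h^-1 *: ((bumpp p \o shift (0:R)) (h *: (1 : R)) - bumpp p 0) @[h --> 0^'] --> (0 : R).
    apply/cvgrPdist_lt => e e0.
    pose c := `|C| + 1; have c0 : 0 < c by rewrite /c ltr_wpDl.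
    near=> h.
    have h0 : h != 0 by near: h; exact: nbhs_dnbhs_neq.
    have hd : c * `|h| < e.
      rewrite mulrC -ltr_pdivlMr//; near: h; apply: dnbhs0_lt; exact: divr_gt0.
    rewrite sub0r normrN; apply: le_lt_trans hd.
    have -> : h^-1 *: ((bumpp p \o shift (0:R)) (h *: (1 : R)) - bumpp p 0) = bumpp ('X * p) h.
      have -> : (bumpp p \o shift (0:R)) (h *: (1 : R)) = bumpp p h.
        by rewrite /= addr0; congr bumpp; exact: mulr1.
      rewrite /bumpp ltxx subr0; case: ifP => _; last by rewrite scaler0.
      by rewrite hornerM hornerX /GRing.scale /= mulrA.
    apply: (le_trans (HC h)); apply: ler_wpM2r => //.
    by rewrite /c; apply: (le_trans (ler_norm _)); rewrite lerDl.
  apply: DeriveDef; last exact: (cvg_lim _ H).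
  by apply/cvg_ex; exists 0.
Unshelve. all: by end_near. Qed.

Definition sbump : R -> R := bumpp 1.

Lemma sbumpE x : sbump x = if 0 < x then expR (- x^-1) else 0.
Proof. by rewrite /sbump /bumpp hornerC mul1r. Qed.

Lemma sbump_ge0 x : 0 <= sbump x.
Proof. by rewrite sbumpE; case: ifP => // _; exact: expR_ge0. Qed.

Lemma sbump_le1 x : sbump x <= 1.
Proof.
rewrite sbumpE; case: ifP => // x0.
by rewrite -expR0 ler_expR oppr_le0 invr_ge0 ltW.
Qed.

Lemma sbump_eq0 x : x <= 0 -> sbump x = 0.
Proof. by move=> x0; rewrite sbumpE ifF// ltNge x0. Qed.

Lemma sbump_cvg1 x : 0 < x -> sbump (n.+1%:R * x) @[n --> \oo] --> (1 : R).
Proof.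
move=> x0.
have -> : (fun n => sbump (n.+1%:R * x)) = expR \o (fun n => - (harmonic n * x^-1)).
  apply/funext => n /=; rewrite sbumpE mulr_gt0//; congr (expR (- _)).
  by rewrite /harmonic /= invfM.
rewrite -expR0.
apply: (@cvg_comp _ _ _ (fun n : nat => - (harmonic n * x^-1)) (@expR R) _ (nbhs (0 : R))).
  rewrite -oppr0 -(mul0r (x^-1)); apply: cvgN; apply: cvgMr_tmp; exact: cvg_harmonic.
exact: continuous_expR.
Qed.

Lemma smooth_sbump (i : 'I_2) (c d : R) :
  smooth (fun x : plane R => sbump (c * Defs.coord i x + d)).
Proof. exact: (smooth_lift bumpp_derive). Qed.

End Bump.

(** * Integrability on bounded sets *)

Section Box.
Context {R : realType}.
Notation pt := (plane R).
Local Notation mu := (leb2 R).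

Definition box (r : R) : set pt := `[- r, r] `*` `[- r, r].

Lemma boxP r (x : pt) : box r x <-> `|x.1| <= r /\ `|x.2| <= r.
Proof. by rewrite /box /= !in_itv /= -!ler_norml. Qed.

Lemma bounded_box (A : set pt) : bounded_set A -> exists2 r, 0 < r & A `<=` box r.
Proof.
move=> [M [_ HM]]; exists (`|M| + 1); first by rewrite ltr_wpDl.
move=> x Ax; have MM : M < `|M| + 1.
  by apply: (le_lt_trans (ler_norm M)); rewrite ltrDl.
have : Num.max `|x.1| `|x.2| <= `|M| + 1 := HM _ MM x Ax.
by rewrite ge_max => /andP[? ?]; apply/boxP.
Qed.

Lemma measurable_box r : measurable (box r).
Proof. by apply: measurableX; exact: measurable_itv. Qed.

Lemma compact_box r : compact (box r).
Proof. by apply: compact_setX; exact: segment_compact. Qed.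

Lemma box_finite r : (mu (box r) < +oo)%E.
Proof.
have -> : mu (box r) = (@lebesgue_measure R `[(- r)%R, r] * @lebesgue_measure R `[(- r)%R, r])%E.
  by apply: product_measure1E; exact: measurable_itv.
rewrite !lebesgue_measure_itv /=; case: ifP => _; last by rewrite mule0.
by rewrite -EFinB -EFinM ltry.
Qed.

Lemma sub_box_finite (A : set pt) r : measurable A -> A `<=` box r -> (mu A < +oo)%E.
Proof.
move=> mA Ar; apply: le_lt_trans (box_finite r).
by apply: le_measure => //; rewrite inE//; exact: measurable_box.
Qed.

Lemma continuous_bounded_on (f : pt -> R) (A : set pt) r : continuous f -> A `<=` box r ->
  exists2 C, 0 <= C & forall x, A x -> `|f x| <= C.
Proof.
move=> cf Ar.
have : compact (f @` box r).
  apply: continuous_compact; last exact: compact_box.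
  exact: continuous_subspaceT.
move=> /compact_bounded [M [_ HM]]; exists (`|M| + 1); first by rewrite addr_ge0.
move=> x /Ar bx; apply: HM; last by exists x.
by apply: (le_lt_trans (ler_norm M)); rewrite ltrDl.
Qed.

Lemma bounded_integrable (f : pt -> R) (A : set pt) r C : measurable A -> A `<=` box r ->
  measurable_fun A f -> (forall x, A x -> `|f x| <= C) -> mu.-integrable A (EFin \o f).
Proof.
move=> mA Ar mf fC; apply: measurable_bounded_integrable => //.
  exact: sub_box_finite Ar.
exists C; split; first exact: num_real.
by move=> M CM x Ax; apply: (le_trans (fC x Ax)); exact: ltW.
Qed.

Lemma continuous_integrable (f : pt -> R) (A : set pt) r : measurable A -> A `<=` box r ->
  continuous f -> mu.-integrable A (EFin \o f).
Proof.
move=> mA Ar cf; have [C _ HC] := continuous_bounded_on cf Ar.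
apply: (bounded_integrable mA Ar _ HC).
by apply: measurable_funTS; exact: continuous_measurable_plane.
Qed.

Lemma bounded_square_finite (f : pt -> R) (A : set pt) r C : measurable A -> A `<=` box r ->
  measurable_fun A f -> (forall x, A x -> `|f x| <= C) ->
  (\int[mu]_(x in A) (f x ^+ 2)%:E < +oo)%E.
Proof.
move=> mA Ar mf fC; apply: integrable_lty => //.
apply: (@bounded_integrable (fun x => f x ^+ 2) A r (C ^+ 2)) => //.
  exact: measurable_funX.
move=> x Ax; rewrite normrX lerXn2r// ?nnegrE//; last exact: fC.
exact: le_trans (fC x Ax).
Qed.

Lemma continuous_square_finite (f : pt -> R) (A : set pt) r : measurable A -> A `<=` box r ->
  continuous f -> (\int[mu]_(x in A) (f x ^+ 2)%:E < +oo)%E.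
Proof.
move=> mA Ar cf; have [C _ HC] := continuous_bounded_on cf Ar.
apply: (bounded_square_finite mA Ar _ HC).
by apply: measurable_funTS; exact: continuous_measurable_plane.
Qed.

Lemma L2_square_finite (f : L2 R) (A : set pt) : measurable A ->
  (\int[mu]_(x in A) (f x ^+ 2)%:E < +oo)%E.
Proof.
move=> mA; have := Lfun2_integrable_sqr (L2fun_sqi f) => /integrable_lty.
move=> /(_ measurableT); apply: le_lt_trans.
apply: ge0_subset_integral => //.
- by apply/measurable_EFinP; apply: measurable_funX; exact: L2_measurable.
- by move=> x _; rewrite lee_fin sqr_ge0.
Qed.

Lemma L2_mul_integrable (f g : L2 R) (A : set pt) : measurable A ->
  mu.-integrable A (fun x => (f x * g x)%:E).
Proof.
move=> mA; apply: integrable_square_mul => //.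
- exact: measurable_funTS (L2_measurable f).
- exact: measurable_funTS (L2_measurable g).
- exact: L2_square_finite.
- exact: L2_square_finite.
Qed.

Lemma L2_bounded_mul_integrable (f : L2 R) (g : pt -> R) (A : set pt) r C :
  measurable A -> A `<=` box r -> measurable_fun A g -> (forall x, A x -> `|g x| <= C) ->
  mu.-integrable A (fun x => (f x * g x)%:E).
Proof.
move=> mA Ar mg gC; apply: integrable_square_mul => //.
- exact: measurable_funTS (L2_measurable f).
- exact: L2_square_finite.
- exact: (bounded_square_finite mA Ar mg gC).
Qed.

Lemma L2_continuous_mul_integrable (f : L2 R) (g : pt -> R) (A : set pt) r :
  measurable A -> A `<=` box r -> continuous g ->
  mu.-integrable A (fun x => (f x * g x)%:E).
Proof.
move=> mA Ar cg; have [C _ HC] := continuous_bounded_on cg Ar.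
apply: (L2_bounded_mul_integrable f mA Ar _ HC).
by apply: measurable_funTS; exact: continuous_measurable_plane.
Qed.

Lemma L2_integrable (f : L2 R) (A : set pt) r : measurable A -> A `<=` box r ->
  mu.-integrable A (EFin \o f).
Proof.
move=> mA Ar; have := @L2_continuous_mul_integrable f (cst 1) A r mA Ar (@cst_continuous _ _ _).
by apply: eq_integrable => // x _; rewrite /= mulr1.
Qed.

Lemma ae_eq_Rintegral (f g : pt -> R) (A : set pt) : measurable A ->
  measurable_fun A f -> measurable_fun A g ->
  (\forall x \ae mu, A x -> f x = g x) ->
  \int[mu]_(x in A) f x = \int[mu]_(x in A) g x.
Proof.
move=> mA mf mg fg; rewrite /Rintegral; congr fine.
apply: ae_eq_integral => //; [exact/measurable_EFinP|exact/measurable_EFinP|].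
by apply: filterS fg => x h Ax; rewrite h.
Qed.

Lemma Lfun2P (f : pt -> R) : measurable_fun setT f ->
  (\int[mu]_x (f x ^+ 2)%:E < +oo)%E -> f \in Lfun mu 2%:E.
Proof.
move=> mf fi; rewrite inE; apply/andP; split; rewrite inE//=.
rewrite /finite_norm unlock /Lnorm poweR_lty//.
apply: le_lt_trans fi; rewrite le_eqVlt; apply/orP; left; apply/eqP.
by apply: eq_integral => x _ /=; rewrite powR_mulrn// real_normK// num_real.
Qed.

Lemma L2_of_bounded (f : pt -> R) (A : set pt) r C : measurable A -> A `<=` box r ->
  measurable_fun A f -> (forall x, A x -> `|f x| <= C) ->
  exists F : L2 R, (\forall x \ae mu, A x -> F x = f x) /\
     (\forall x \ae mu, ~ A x -> F x = 0).
Proof.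
move=> mA Ar mf fC.
have mfA : measurable_fun setT (f \_ A) by apply/(measurable_restrictT _ mA).
have [F HF] : exists F : L2 R, \forall x \ae mu, F x = (f \_ A) x.
  apply: L2_exists; apply: Lfun2P => //.
  have -> : (\int[mu]_x ((f \_ A) x ^+ 2)%:E = \int[mu]_(x in A) (f x ^+ 2)%:E)%E.
    rewrite [RHS]integral_mkcond; apply: eq_integral => x _.
    by rewrite !patchE; case: ifP => // _; rewrite expr0n.
  exact: (bounded_square_finite mA Ar mf fC).
exists F; split; apply: filterS HF => x ->; rewrite patchE => xA.
  by rewrite mem_set.
by rewrite memNset.
Qed.

End Box.

(** * Test functions *)

Section TestFunctions.
Context {R : realType}.
Notation pt := (plane R).
Local Notation mu := (leb2 R).

Lemma continuous_line (f : pt -> R) (a v : pt) : continuous f ->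
  continuous (fun t : R => f (a + t *: v)).
Proof.
move=> cf t; apply: (@continuous_comp _ _ _ (fun t : R => a + t *: v) f); last exact: cf.
apply: continuousD; first exact: cst_continuous.
exact: scalel_continuous.
Qed.

Lemma smooth_gradd (f : pt -> R) v : smooth f -> smooth (gradd v f).
Proof.
move=> sf; have -> : gradd v f = cst v.1 * pd ord0 f + cst v.2 * pd ord_max f by [].
by apply: smoothD; apply: smoothM; by [exact: smooth_cst|exact: smooth_pd].
Qed.

Lemma FTC_line (f : pt -> R) (a v : pt) (s t : R) : smooth f -> s <= t ->
  \int[lebesgue_measure]_(x in `[s, t]) gradd v f (a + x *: v) =
  f (a + t *: v) - f (a + s *: v).
Proof.
move=> sf; rewrite le_eqVlt => /predU1P[<-|st].
  by rewrite subrr set_itv1 Rintegral_set1.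
pose F (x : R) := f (a + x *: v).
have dF (x : R) : is_derive x 1 F (gradd v f (a + x *: v)) by exact: smooth_derive_line.
have cF : continuous F by exact/continuous_line/smooth_continuous.
have cg : continuous (fun x : R => gradd v f (a + x *: v)).
  exact/continuous_line/smooth_continuous/smooth_gradd.
rewrite /Rintegral (@continuous_FTC2 _ _ F)//.
- exact: continuous_subspaceT.
- split; [by move=> x _; exact: (@ex_derive _ _ _ _ _ _ _ (dF x))|..].
  + exact/cvg_at_right_filter/cF.
  + exact/cvg_at_left_filter/cF.
- by move=> x _; rewrite derive1E; exact: (@derive_val _ _ _ _ _ _ _ (dF x)).
Qed.

Lemma testfun_smooth (U : set pt) phi : testfun U phi -> smooth phi.
Proof. by case. Qed.

Lemma testfunS (U W : set pt) phi : U `<=` W -> testfun U phi -> testfun W phi.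
Proof. by move=> UW [s c h]; split => //; exact: subset_trans UW. Qed.

Lemma pd_off_support (phi : pt -> R) i x :
  ~ closure [set x | phi x != 0] x -> pd i phi x = 0.
Proof.
move=> xs; have : {near x, cst 0 =1 phi}.
  have : \forall y \near x, ~ closure [set x | phi x != 0] y.
    apply: open_nbhs_nbhs; split => //.
    by apply: closed_openC; exact: closed_closure.
  apply: filterS => y ys; apply/esym/eqP; apply: contra_notT ys => y0.
  exact: subset_closure.
move=> /(near_eq_derive (unitv i)) E; rewrite /pd -E; exact: derive_cst.
Qed.

Lemma testfun_out (U : set pt) phi x : testfun U phi -> ~ U x -> phi x = 0.
Proof.
move=> [_ _ sU] Ux; apply/eqP; apply: contra_notT Ux => p0.
by apply: sU; exact: subset_closure.
Qed.

Lemma testfun_pd_out (U : set pt) phi i x : testfun U phi -> ~ U x -> pd i phi x = 0.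
Proof. by move=> [_ _ sU] Ux; apply: pd_off_support => /sU. Qed.

Lemma testfun_sub_support (U : set pt) (phi psi : pt -> R) : testfun U phi -> smooth psi ->
  (forall x, ~ closure [set x | phi x != 0] x -> psi x = 0) -> testfun U psi.
Proof.
move=> [s c h] spsi H.
have sub : closure [set x | psi x != 0] `<=` closure [set x | phi x != 0].
  rewrite [X in _ `<=` X](iffLR (closure_id _) (@closed_closure _ _)).
  apply: closure_subset => x /= p0; apply: contrapT => /H.
  by move/eqP; rewrite (negbTE p0).
split => //; last exact: subset_trans h.
exact: (subclosed_compact (@closed_closure _ _) c sub).
Qed.

Lemma testfun_pd (U : set pt) phi i : testfun U phi -> testfun U (pd i phi).
Proof.
move=> tp; apply: (testfun_sub_support tp); first exact/smooth_pd/(testfun_smooth tp).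
by move=> x; exact: pd_off_support.
Qed.

Lemma testfunM (U : set pt) (q phi : pt -> R) : smooth q -> testfun U phi -> testfun U (q * phi).
Proof.
move=> sq tp; apply: (testfun_sub_support tp).
  by apply: smoothM => //; exact: testfun_smooth tp.
move=> x xs; rewrite /= (_ : (q * phi) x = q x * phi x)//.
have -> : phi x = 0; last by rewrite mulr0.
by apply/eqP; apply: contra_notT xs => p0; exact: subset_closure.
Qed.

Lemma testfunZ (U : set pt) (c : R) phi : testfun U phi -> testfun U (cst c * phi).
Proof. by apply: testfunM; exact: smooth_cst. Qed.

Lemma testfunD (U : set pt) phi psi : testfun U phi -> testfun U psi -> testfun U (phi + psi).
Proof.
move=> [s1 c1 h1] [s2 c2 h2].
have sub : closure [set x | (phi + psi) x != 0] `<=`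
    closure [set x | phi x != 0] `|` closure [set x | psi x != 0].
  rewrite -closureU; apply: closure_subset => x /= p0.
  have [p1|p1] := eqVneq (phi x) 0; last by left.
  right => /=; apply: contra_neq p0 => p2.
  by rewrite (_ : (phi + psi) x = phi x + psi x)// p1 p2 addr0.
split; first exact: smoothD.
  apply: (subclosed_compact (@closed_closure _ _) _ sub); exact: compactU.
by apply: (subset_trans sub) => x [/h1|/h2].
Qed.

Lemma testfun_box (U : set pt) phi : testfun U phi ->
  exists2 r, 0 < r & forall x, ~ box r x -> phi x = 0.
Proof.
move=> [_ /compact_bounded/bounded_box[r r0 cr] _]; exists r => // x xr.
apply/eqP; apply: contra_notT xr => p0; apply: cr; exact: subset_closure.
Qed.

Lemma testfun_bounded (U : set pt) phi : testfun U phi -> exists2 C, 0 <= C & forall x, `|phi x| <= C.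
Proof.
move=> tp; have [r r0 pr] := testfun_box tp.
have [C C0 HC] := continuous_bounded_on (smooth_continuous (testfun_smooth tp)) (@subset_refl _ (box r)).
exists C => // x; have [xr|xr] := pselect (box r x); first exact: HC.
by rewrite pr// normr0.
Qed.

Lemma testfun_integrable (U : set pt) phi : testfun U phi -> mu.-integrable setT (EFin \o phi).
Proof.
move=> tp; have [r r0 pr] := testfun_box tp.
have : mu.-integrable (box r) (EFin \o phi).
  apply: (@continuous_integrable _ _ (box r) r) => //; first exact: measurable_box.
  exact: smooth_continuous (testfun_smooth tp).
rewrite integrable_mkcond; last exact: measurable_box.
congr (integrable mu setT _); apply/funext => x; rewrite patchE.
by case: ifPn => //; rewrite notin_setE => /pr /= ->.
Qed.

Lemma L2_testfun_integrable (U A : set pt) (f : L2 R) phi : measurable A -> testfun U phi ->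
  mu.-integrable A (fun x => (f x * phi x)%:E).
Proof.
move=> mA tp; have [r r0 pr] := testfun_box tp.
have mphi : measurable_fun setT phi.
  by apply: continuous_measurable_plane; exact: smooth_continuous (testfun_smooth tp).
have [C C0 HC] := testfun_bounded tp.
have mAb : measurable (A `&` box r) by apply: measurableI => //; exact: measurable_box.
have : mu.-integrable (A `&` box r) (fun x => (f x * phi x)%:E).
  apply: (@L2_bounded_mul_integrable R f phi _ r C) => //; exact: measurable_funTS.
move=> H; have := (integrable_restrict mu (measurable_box r) mA _).1 H.
congr (integrable mu A _); apply/funext => x; rewrite patchE.
by case: ifPn => //; rewrite notin_setE => /pr /= ->; rewrite mulr0.
Qed.

(** Integrate first in the direction of the derivative: on each line the
    fundamental theorem of calculus gives the difference of two values outside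
    the support. *)
Lemma Rintegral_pd_testfun (U : set pt) phi i : testfun U phi ->
  \int[mu]_x pd i phi x = 0.
Proof.
move=> tp; have ti := testfun_integrable (testfun_pd i tp).
have [r r0 pr] := testfun_box tp.
have [r' r'0 pr'] := testfun_box (testfun_pd i tp).
pose s := r + r'.
have sr : r < s by rewrite ltrDl. have sr' : r' < s by rewrite ltrDr.
have ss : - s <= s by lra.
have phis (x : pt) : ~ box r x -> phi x = 0 by exact: pr.
have I0 (a v : pt) (f : R -> R) : (forall t, f t = gradd v phi (a + t *: v)) ->
    (forall t, s < `|t| -> f t = 0) -> phi (a + s *: v) = 0 -> phi (a + (- s) *: v) = 0 ->
    (\int[lebesgue_measure]_t (f t)%:E = 0)%E.
  move=> fE f0 p1 p2.
  have cf : continuous f.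
    rewrite (_ : f = fun t => gradd v phi (a + t *: v)); last exact/funext.
    exact/continuous_line/smooth_continuous/smooth_gradd/(testfun_smooth tp).
  have -> : (\int[lebesgue_measure]_t (f t)%:E = \int[lebesgue_measure]_(t in `[(- s)%R, s]) (f t)%:E)%E.
    rewrite [RHS]integral_mkcond; apply: eq_integral => t _; rewrite patchE.
    case: ifPn => //; rewrite notin_setE /= in_itv /= -ler_norml => /negP.
    by rewrite -ltNge => /f0 ->.
  rewrite -[LHS](@fineK R); last first.
    apply: integrable_fin_num => //.
    apply: continuous_compact_integrable; first exact: segment_compact.
    exact: continuous_subspaceT.
  have := @FTC_line phi a v (- s) s (testfun_smooth tp) ss.
  rewrite p1 p2 subrr /Rintegral => E.
  rewrite (_ : 0%E = (0 : R)%:E)// -E; congr (fine _)%:E.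
  by apply: eq_integral => t _; rewrite fE.
rewrite /Rintegral.
have [iE|iE] : i = ord0 \/ i = ord_max.
  by case: (i) => [[|[|//]] ?]; [left|right]; exact: val_inj.
- rewrite /leb2 -integral21_prod_meas1//.
  rewrite (_ : fubini_G _ _ = cst 0%E) ?integral0//; apply/funext => y.
  apply: (I0 (0, y) (1, 0)) => //.
  + move=> t; rewrite /gradd /= mul1r mul0r addr0 iE; congr pd; apply: plane_eq => /=.
      by rewrite /GRing.scale /= mulr1 add0r.
    by rewrite /GRing.scale /= mulr0 addr0.
  + by move=> t st; apply: pr' => /boxP[/= tr _]; move: st; rewrite ltNge (le_trans tr)// ltW.
  + apply: phis => /boxP[+ _]; rewrite /= /GRing.scale /= mulr1 add0r.
    by rewrite gtr0_norm ?(lt_trans r0)// leNgt sr.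
  + apply: phis => /boxP[+ _]; rewrite /= /GRing.scale /= mulr1 add0r normrN.
    by rewrite gtr0_norm ?(lt_trans r0)// leNgt sr.
- rewrite /leb2 -integral12_prod_meas1//.
  rewrite (_ : fubini_F _ _ = cst 0%E) ?integral0//; apply/funext => y.
  apply: (I0 (y, 0) (0, 1)) => //.
  + move=> t; rewrite /gradd /= mul1r mul0r add0r iE; congr pd; apply: plane_eq => /=.
      by rewrite /GRing.scale /= mulr0 addr0.
    by rewrite /GRing.scale /= mulr1 add0r.
  + by move=> t st; apply: pr' => /boxP[_ /= tr]; move: st; rewrite ltNge (le_trans tr)// ltW.
  + apply: phis => /boxP[_]; rewrite /= /GRing.scale /= mulr1 add0r.
    by rewrite gtr0_norm ?(lt_trans r0)// leNgt sr.
  + apply: phis => /boxP[_]; rewrite /= /GRing.scale /= mulr1 add0r normrN.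
    by rewrite gtr0_norm ?(lt_trans r0)// leNgt sr.
Qed.

End TestFunctions.

(** * The fundamental lemma of the calculus of variations *)

Section FundamentalLemma.
Context {R : realType}.
Notation pt := (plane R).
Local Notation mu := (leb2 R).

Let G : set (set pt) := [set A | exists a b c d : R, A = rect a b c d].

Lemma rectI (a b c d a' b' c' d' : R) :
  rect a b c d `&` rect a' b' c' d' =
  rect (Num.max a a') (Num.min b b') (Num.max c c') (Num.min d d').
Proof.
apply/seteqP; split => x; last first.
  move=> /rectP; rewrite !gt_max !lt_min => -[/andP[/andP[? ?] /andP[? ?]] /andP[/andP[? ?] /andP[? ?]]].
  by split; apply/rectP; split; apply/andP.
move=> [/rectP[/andP[? ?] /andP[? ?]] /rectP[/andP[? ?] /andP[? ?]]]; apply/rectP.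
by rewrite !gt_max !lt_min; split; do 2 (apply/andP; split).
Qed.

Lemma ex_bigger (x : R) : exists n : nat, `|x| < n%:R.
Proof. by exists (Num.truncn `|x|).+1; have /andP[] := truncn_itv (normr_ge0 x). Qed.

(** The coordinate projections are measurable for the sigma-algebra generated
    by the rectangles, the preimage of an interval being a countable union of
    rectangles. *)
Lemma measurable_rects : @measurable _ pt = <<s G >>.
Proof.
apply/seteqP; split; last first.
  apply: smallest_sub; first exact: sigma_algebra_measurable.
  by move=> _ [a [b [c [d ->]]]]; exact: measurable_rect.
rewrite measurable_prod_measurableType.
apply: smallest_sub; first exact: smallest_sigma_algebra.
move=> _ [A mA [B mB <-]].
pose T' := g_sigma_algebraType G.
have mr a b c d : @measurable _ T' (rect a b c d).
  by apply: sub_sigma_algebra; exists a, b, c, d.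
have m1 : measurable_fun setT (fst : T' -> R).
  apply: (measurability _ (@RGenOpens.measurableE R)) => _ [_ [x [y ->] <-]].
  have -> : [set: T'] `&` fst @^-1` `]x, y[ = \bigcup_n rect x y (- n%:R) n%:R.
    apply/seteqP; split => z.
      move=> [_ /=]; rewrite in_itv /= => xy; have [n zn] := ex_bigger z.2.
      by exists n => //; apply/rectP; rewrite -ltr_norml.
    by move=> [n _ /rectP[xy _]]; split => //=; rewrite in_itv.
  by apply: bigcupT_measurable => n; exact: mr.
have m2 : measurable_fun setT (snd : T' -> R).
  apply: (measurability _ (@RGenOpens.measurableE R)) => _ [_ [x [y ->] <-]].
  have -> : [set: T'] `&` snd @^-1` `]x, y[ = \bigcup_n rect (- n%:R) n%:R x y.
    apply/seteqP; split => z.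
      move=> [_ /=]; rewrite in_itv /= => xy; have [n zn] := ex_bigger z.1.
      by exists n => //; apply/rectP; rewrite -ltr_norml.
    by move=> [n _ /rectP[_ xy]]; split => //=; rewrite in_itv.
  by apply: bigcupT_measurable => n; exact: mr.
have -> : A `*` B = ([set: T'] `&` fst @^-1` A) `&` ([set: T'] `&` snd @^-1` B).
  by apply/seteqP; split => z [] /=; [split|move=> [_ ?] [_ ?]].
apply: (@measurableI _ T'); [exact: m1|exact: m2].
Qed.

(** As the scale grows, these functions, bounded by 1, converge pointwise to
    the indicator of the open rectangle. *)
Definition rect_bump (a b c d : R) (n : nat) : pt -> R :=
  (fun x : pt => sbump (n.+1%:R * (x.1 - a))) * (fun x : pt => sbump (n.+1%:R * (b - x.1))) *
  (fun x : pt => sbump (n.+1%:R * (x.2 - c))) * (fun x : pt => sbump (n.+1%:R * (d - x.2))).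

Lemma rect_bumpE a b c d n x : rect_bump a b c d n x =
  sbump (n.+1%:R * (x.1 - a)) * sbump (n.+1%:R * (b - x.1)) *
  sbump (n.+1%:R * (x.2 - c)) * sbump (n.+1%:R * (d - x.2)).
Proof. by []. Qed.

Lemma rect_bump_out a b c d n x : ~ rect a b c d x -> rect_bump a b c d n x = 0.
Proof.
move=> xr; apply/eqP; apply: contra_notT xr; rewrite rect_bumpE !mulf_eq0 !negb_or.
have pos (z : R) : sbump (n.+1%:R * z) != 0 -> 0 < z.
  by apply: contraNT; rewrite -leNgt => z0; rewrite sbump_eq0// mulr_ge0_le0.
move=> /andP[/andP[/andP[/pos + /pos +] /pos +] /pos].
by rewrite !subr_gt0 => ? ? ? ?; apply/rectP; split; apply/andP.
Qed.

Lemma closed_itvX (a b c d : R) : closed (`[a, b] `*` `[c, d] : set pt).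
Proof.
have -> : `[a, b] `*` `[c, d] = (fst : pt -> R) @^-1` `[a, b] `&` (snd : pt -> R) @^-1` `[c, d] by [].
apply: closedI; apply: (iffLR (continuous_closedP _)); try exact: interval_closed.
- by move=> x; exact: cvg_fst.
- by move=> x; exact: cvg_snd.
Qed.

Lemma rect_bump_testfun (U : set pt) a b c d n :
  `[a, b] `*` `[c, d] `<=` U -> testfun U (rect_bump a b c d n).
Proof.
move=> rU.
have sub : closure [set x | rect_bump a b c d n x != 0] `<=` `[a, b] `*` `[c, d].
  rewrite [X in _ `<=` X](iffLR (closure_id _)); last first.
    exact: closed_itvX.
  apply: closure_subset => x /= p0.
  have : rect a b c d x by apply: contrapT => /(rect_bump_out n) /eqP; rewrite (negbTE p0).
  move=> /rectP[/andP[? ?] /andP[? ?]].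
  by split; rewrite /= in_itv /= !ltW.
split; last exact: subset_trans rU.
  have sb (f : pt -> R) (e g : R) i : (forall x, f x = sbump (e * Defs.coord i x + g)) -> smooth f.
    by move=> fE; rewrite (_ : f = fun x => sbump (e * Defs.coord i x + g)); [exact: smooth_sbump|exact/funext].
  rewrite /rect_bump; apply: smoothM; first (apply: smoothM; first apply: smoothM).
  - by apply: (sb _ n.+1%:R (- n.+1%:R * a) ord0) => x; congr sbump; rewrite /Defs.coord /=; ring.
  - by apply: (sb _ (- n.+1%:R) (n.+1%:R * b) ord0) => x; congr sbump; rewrite /Defs.coord /=; ring.
  - by apply: (sb _ n.+1%:R (- n.+1%:R * c) ord_max) => x; congr sbump; rewrite /Defs.coord /=; ring.
  - by apply: (sb _ (- n.+1%:R) (n.+1%:R * d) ord_max) => x; congr sbump; rewrite /Defs.coord /=; ring.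
apply: (subclosed_compact (@closed_closure _ _) _ sub).
by apply: compact_setX; exact: segment_compact.
Qed.

Lemma rect_bump_le1 a b c d n x : `|rect_bump a b c d n x| <= 1.
Proof.
rewrite rect_bumpE !normrM !ger0_norm ?sbump_ge0//.
by rewrite !mulr_ile1// ?mulr_ge0// ?sbump_ge0 ?sbump_le1.
Qed.

Lemma rect_bump_cvg a b c d x : rect a b c d x ->
  rect_bump a b c d n x @[n --> \oo] --> (1 : R).
Proof.
move=> /rectP[/andP[? ?] /andP[? ?]].
rewrite (_ : (1 : R) = 1 * 1 * 1 * 1); last by rewrite !mulr1.
have b1 (z : R) : 0 < z -> sbump (n.+1%:R * z) @[n --> \oo] --> (1 : R) by exact: sbump_cvg1.
apply: cvgM; first (apply: cvgM; first apply: cvgM); apply: b1; rewrite subr_gt0//.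
Qed.

Lemma sub_rect_box (a b c d : R) : exists r, rect a b c d `<=` box r.
Proof.
exists (`|a| + `|b| + `|c| + `|d|) => x /rectP[/andP[? ?] /andP[? ?]]; apply/boxP.
have := ler_norm b; have := ler_norm d; have := ler_norm (- a); have := ler_norm (- c).
have := normr_ge0 a; have := normr_ge0 b; have := normr_ge0 c; have := normr_ge0 d.
rewrite !normrN !ler_norml; lra.
Qed.

Let rect_int0 (U : set pt) (g : L2 R) a b c d : open U ->
  (forall phi, testfun U phi -> \int[mu]_(x in U) (g x * phi x) = 0) ->
  `[a, b] `*` `[c, d] `<=` U -> (\int[mu]_(x in rect a b c d) (g x)%:E = 0)%E.
Proof.
move=> oU gU rU; have mU := open_measurable_plane oU.
have mr := measurable_rect a b c d.
have [r rr] := sub_rect_box a b c d.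
have ig := L2_integrable g mr rr.
have rU' : rect a b c d `<=` U.
  move=> x /rectP[/andP[? ?] /andP[? ?]]; apply: rU.
  by split; rewrite /= in_itv /= !ltW.
have I0 n : (\int[mu]_(x in rect a b c d) (g x * rect_bump a b c d n x)%:E = 0)%E.
  have tn := rect_bump_testfun n rU.
  have E := gU _ tn; rewrite /Rintegral in E.
  transitivity (0 : R)%:E => //; rewrite -[in RHS]E fineK; last first.
    by apply: integrable_fin_num => //; exact: L2_testfun_integrable tn.
  rewrite [LHS]integral_mkcond [RHS]integral_mkcond; apply: eq_integral => x _.
  rewrite !patchE; case: ifPn => [xr|].
    by rewrite mem_set//; apply: rU'; exact: set_mem xr.
  by rewrite notin_setE => /(rect_bump_out n) ->; rewrite mulr0; case: ifP.
have C : (\int[mu]_(x in rect a b c d) (g x * rect_bump a b c d n x)%:E @[n --> \oo] -->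
          \int[mu]_(x in rect a b c d) (g x)%:E)%E.
  apply: (@dominated_cvg _ _ _ mu _ mr (fun n x => (g x * rect_bump a b c d n x)%:E)
     (fun x => (g x)%:E) (fun x => `|(g x)%:E|%E)).
  - move=> n; apply/measurable_EFinP; apply: measurable_funM.
      exact: measurable_funTS (L2_measurable g).
    apply: measurable_funTS; apply: continuous_measurable_plane.
    exact: smooth_continuous (testfun_smooth (rect_bump_testfun n rU)).
  - move=> x rx; apply: cvg_EFin; first exact: nearW.
    by rewrite -[X in _ --> X]mulr1; apply: cvgM; [exact: cvg_cst|exact: rect_bump_cvg].
  - by move=> x _; rewrite abse_fin_num.
  - exact: integrable_abse.
  - move=> n x _; rewrite !abse_EFin lee_fin normrM ler_piMr//; exact: rect_bump_le1.
move: C; under eq_fun do rewrite I0.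
by move=> /(cvg_lim (@ereal_hausdorff R)) <-; apply: (cvg_lim (@ereal_hausdorff R)); exact: cvg_cst.
Qed.

(** Testing with bumps, the integral of [g] vanishes on every rectangle inside
    [U]; rectangles are stable under intersection, so this propagates to all
    measurable subsets of a rectangle by induction over the generated sigma-
    algebra, whence [g] vanishes almost everywhere there. Countably many
    rectangles cover [U]. *)
Lemma fundamental_lemma (U : set pt) (g : L2 R) : open U ->
  (forall phi, testfun U phi -> \int[mu]_(x in U) (g x * phi x) = 0) ->
  \forall x \ae mu, U x -> g x = 0.
Proof.
move=> oU gU.
have rU a b c d : `[a, b] `*` `[c, d] `<=` U ->
    \forall x \ae mu, rect a b c d x -> g x = 0.
  move=> rU; have mr := measurable_rect a b c d.
  have [r rr] := sub_rect_box a b c d.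
  have ig := L2_integrable g mr rr.
  have igS S : measurable S -> mu.-integrable (S `&` rect a b c d) (EFin \o g).
    by move=> mS; apply: (integrableS mr) => //; exact: measurableI.
  have P S : measurable S -> (\int[mu]_(x in S `&` rect a b c d) (g x)%:E = 0)%E.
    move=> mS; have : <<s G >> S by rewrite -measurable_rects.
    move: S {mS}; apply: dynkin_induction; first exact: measurable_rects.
    - move=> _ _ [a1 [b1 [c1 [d1 ->]]]] [a2 [b2 [c2 [d2 ->]]]].
      by rewrite rectI; do 4 eexists; reflexivity.
    - by rewrite setTI; exact: (rect_int0 oU gU).
    - move=> _ [a1 [b1 [c1 [d1 ->]]]]; rewrite rectI; apply: (rect_int0 oU gU).
      apply: subset_trans rU => x [] /=; rewrite !in_itv /= !ge_max !le_min.
      by move=> /andP[/andP[? ?] /andP[? ?]] /andP[/andP[? ?] /andP[? ?]]; split; apply/andP.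
    - move=> S mS IS.
      have : (\int[mu]_(x in rect a b c d) (g x)%:E = 0)%E by exact: (rect_int0 oU gU).
      have E : rect a b c d = (S `&` rect a b c d) `|` (~` S `&` rect a b c d).
        by rewrite -setIUl setUv setTI.
      rewrite [in X in X = _ -> _]E {E}.
      have m1 : measurable (S `&` rect a b c d) by exact: measurableI.
      have m2 : measurable (~` S `&` rect a b c d).
        by apply: measurableI => //; exact: measurableC.
      have mg : measurable_fun (S `&` rect a b c d `|` ~` S `&` rect a b c d) (EFin \o g).
        apply/measurable_EFinP; exact: measurable_funTS (L2_measurable g).
      rewrite (integral_setU _ m1 m2 mg).
        by rewrite IS add0e; apply.
      rewrite disj_set2E; apply/eqP/seteqP; split => x //= -[[Sx _] [nSx _]]; exact: nSx.
    - move=> F mF tF IF; rewrite setI_bigcupl integral_bigcup//.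
      + by rewrite eseries0.
      + exact: trivIset_setIr.
      + by move=> k; exact: measurableI.
      + by rewrite -setI_bigcupl; apply: igS; exact: bigcupT_measurable.
  have : ae_eq mu (rect a b c d) (EFin \o g) (cst 0%E).
    apply: integral_ae_eq => //.
    move=> E Er mE; rewrite integral0; have := P E mE.
    by rewrite (setIidl Er).
  by apply: filterS => x h /h /= [].
pose Q (q : rat * rat * (rat * rat)) (x : pt) :=
  `[ratr q.1.1, ratr q.1.2] `*` `[ratr q.2.1, ratr q.2.2] `<=` U ->
  rect (ratr q.1.1) (ratr q.1.2) (ratr q.2.1) (ratr q.2.2) x -> g x = 0.
have : \forall x \ae mu, forall n : nat, forall q : rat * rat * (rat * rat), pickle q = n -> Q q x.
  apply: ae_foralln => n.
  have [[q qn]|nq] := pselect (exists q : rat * rat * (rat * rat), pickle q = n); last first.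
    by apply: nearW => x q qn; case: nq; exists q.
  have [qU|qU] := pselect (`[ratr q.1.1, ratr q.1.2] `*` `[ratr q.2.1, ratr q.2.2] `<=` U :> Prop).
    have := rU _ _ _ _ qU; apply: filterS => x H q' q'n _.
    by have -> : q' = q by apply: (pcan_inj pickleK); rewrite q'n.
  apply: nearW => x q' q'n; have -> : q' = q by apply: (pcan_inj pickleK); rewrite q'n.
  by move=> /qU.
apply: filterS => x H Ux.
have [a [b [c [d [xr rU2]]]]] := in_rat_rect oU Ux.
exact: (H _ ((a, b), (c, d)) erefl).
Qed.

End FundamentalLemma.

(** * Weak derivatives *)

Section WeakDerivatives.
Context {R : realType}.
Notation pt := (plane R).
Local Notation mu := (leb2 R).
Implicit Types (U W : set pt) (f g h v w : L2 R).

Lemma L2_lin (a : R) f g : \forall x \ae mu, (a *: f + g : L2 R) x = a * f x + g x.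
Proof.
have H1 := L2DE (a *: f) g; have H2 := L2ZE a f.
by apply: filterS2 H1 H2 => x -> ->.
Qed.

Lemma L2on_lin U (a : R) f g : L2on U f -> L2on U g -> L2on U (a *: f + g).
Proof.
move=> Hf Hg; have Hl := L2_lin a f g.
apply: filterS3 Hf Hg Hl => x h1 h2 -> nU.
by rewrite h1// h2// mulr0 addr0.
Qed.

Lemma L2on0 U : L2on U (0 : L2 R).
Proof. by have := @L20E R; apply: filterS => x. Qed.

Lemma Rintegral_L2_lin (a : R) f g (A B : set pt) (k : pt -> R) : measurable A ->
  measurable_fun A k ->
  mu.-integrable A (fun x => (f x * k x)%:E) -> mu.-integrable A (fun x => (g x * k x)%:E) ->
  \int[mu]_(x in A) ((a *: f + g : L2 R) x * k x) =
  a * \int[mu]_(x in A) (f x * k x) + \int[mu]_(x in A) (g x * k x).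
Proof.
move=> mA mk fk gk.
rewrite -RintegralZl// -RintegralD//; last first.
  have := integrableZl mA a fk; by apply: eq_integrable.
apply: ae_eq_Rintegral => //.
- by apply: measurable_funM => //; exact: measurable_funTS (L2_measurable _).
- apply: measurable_funD; first apply: measurable_funM => //.
    by apply: measurable_funM => //; exact: measurable_funTS (L2_measurable _).
  by apply: measurable_funM => //; exact: measurable_funTS (L2_measurable _).
- by have := L2_lin a f g; apply: filterS => x -> _; ring.
Qed.

Lemma testfun_measurable U phi : testfun U phi -> measurable_fun setT (phi : pt -> R).
Proof.
by move=> tp; apply: continuous_measurable_plane; exact: smooth_continuous (testfun_smooth tp).
Qed.

Lemma is_wderiv_lin U i (a : R) f g f' g' : measurable U ->
  is_wderiv U i f f' -> is_wderiv U i g g' -> is_wderiv U i (a *: f + g) (a *: f' + g').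
Proof.
move=> mU [of' f'E] [og' g'E]; split; first exact: L2on_lin.
move=> phi tp; have tpi := testfun_pd i tp.
rewrite !Rintegral_L2_lin//; do ?[exact: L2_testfun_integrable tp|exact: L2_testfun_integrable tpi
  |exact: measurable_funTS (testfun_measurable tp)|exact: measurable_funTS (testfun_measurable tpi)].
by rewrite f'E// g'E//; ring.
Qed.

(** The difference of two weak derivatives is orthogonal to all test
    functions, and both vanish outside [U] by definition. *)
Lemma is_wderiv_unique U i f g g' : open U ->
  is_wderiv U i f g -> is_wderiv U i f g' -> g = g'.
Proof.
move=> oU [og gE] [og' g'E]; have mU := open_measurable_plane oU.
have H : \forall x \ae mu, U x -> ((- 1) *: g + g' : L2 R) x = 0.
  apply: fundamental_lemma => // phi tp.
  rewrite Rintegral_L2_lin//; do ?[exact: L2_testfun_integrable tp|exact: measurable_funTS (testfun_measurable tp)].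
  by have := gE _ tp; rewrite g'E// => /oppr_inj ->; ring.
apply/L2P; have Hl := L2_lin (- 1) g g'.
have Hs : \forall x \ae mu, ~ U x -> g x = g' x.
  by apply: filterS2 og og' => x h1 h2 nU; rewrite h1// h2.
apply: filterS3 H Hl Hs => x H Hl Hs.
have [/H|/Hs//] := pselect (U x); rewrite Hl mulN1r => /eqP.
by rewrite addrC subr_eq0 => /eqP.
Qed.

Lemma wderivE U i f g : open U -> is_wderiv U i f g -> wderiv U i f = g.
Proof.
move=> oU fg; apply: xget_unique => // g' fg'; exact: is_wderiv_unique fg' fg.
Qed.

Lemma wderivP U i f : H1 U f -> is_wderiv U i f (wderiv U i f).
Proof. by move=> /(_ i) ex; exact: (xgetPex 0 ex). Qed.

Lemma H1_lin U (a : R) f g : measurable U -> H1 U f -> H1 U g -> H1 U (a *: f + g).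
Proof.
move=> mU Hf Hg i; exists (a *: wderiv U i f + wderiv U i g).
by apply: is_wderiv_lin => //; exact: wderivP.
Qed.

Lemma wderiv_lin U i (a : R) f g : open U -> H1 U f -> H1 U g ->
  wderiv U i (a *: f + g) = a *: wderiv U i f + wderiv U i g.
Proof.
move=> oU Hf Hg; apply: wderivE => //; apply: is_wderiv_lin.
- exact: open_measurable_plane.
- exact: wderivP.
- exact: wderivP.
Qed.

Lemma H2_lin U (a : R) f g : open U -> H2 U f -> H2 U g -> H2 U (a *: f + g).
Proof.
move=> oU [Hf Hf'] [Hg Hg']; have mU := open_measurable_plane oU.
split=> [|i]; first exact: H1_lin.
by rewrite wderiv_lin//; exact: H1_lin.
Qed.

Lemma wderiv2_lin U i j (a : R) f g : open U -> H2 U f -> H2 U g ->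
  wderiv U j (wderiv U i (a *: f + g)) =
  a *: wderiv U j (wderiv U i f) + wderiv U j (wderiv U i g).
Proof. by move=> oU [Hf Hf'] [Hg Hg']; rewrite !wderiv_lin. Qed.

(** Test functions on a subset extend by zero; this is why weak derivatives
    restrict to smaller open sets. *)
Lemma Rintegral_testfun_sub W U phi f : W `<=` U -> testfun W phi ->
  \int[mu]_(x in W) (f x * phi x) = \int[mu]_(x in U) (f x * phi x).
Proof.
move=> WU tp; rewrite [LHS]Rintegral_mkcond [RHS]Rintegral_mkcond.
apply: eq_Rintegral => x _; rewrite !patchE.
case: ifPn => [/set_mem xW|]; first by rewrite mem_set//; exact: WU.
by rewrite notin_setE => xW; rewrite (testfun_out tp xW) mulr0; case: ifP.
Qed.

Lemma is_wderiv_sub W U i f g f' g' : open W -> open U -> W `<=` U ->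
  is_wderiv U i f g ->
  (\forall x \ae mu, W x -> f' x = f x) -> (\forall x \ae mu, W x -> g' x = g x) ->
  L2on W g' -> is_wderiv W i f' g'.
Proof.
move=> oW oU WU [og gE] ff gg og'; split=> // phi tp.
have mW := open_measurable_plane oW.
have tp' := testfunS WU tp; have tpi := testfun_pd i tp.
have mp := testfun_measurable tp; have mpi := testfun_measurable tpi.
rewrite (@ae_eq_Rintegral _ _ (fun x => f x * pd i phi x))//; last 3 first.
- by apply: measurable_funM; apply: measurable_funTS => //; exact: L2_measurable.
- by apply: measurable_funM; apply: measurable_funTS => //; exact: L2_measurable.
- by apply: filterS ff => x ff xW; rewrite ff.
rewrite [in RHS](@ae_eq_Rintegral _ _ (fun x => g x * phi x))//; last 3 first.
- by apply: measurable_funM; apply: measurable_funTS => //; exact: L2_measurable.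
- by apply: measurable_funM; apply: measurable_funTS => //; exact: L2_measurable.
- by apply: filterS gg => x gg xW; rewrite gg.
by rewrite (Rintegral_testfun_sub f WU tpi) gE// (Rintegral_testfun_sub g WU tp).
Qed.

Lemma L2_restrict W f : measurable W ->
  exists g : L2 R, (\forall x \ae mu, W x -> g x = f x) /\ L2on W g.
Proof.
move=> mW.
have mf : measurable_fun setT ((f : pt -> R) \_ W).
  by apply/(measurable_restrictT _ mW); exact: measurable_funTS (L2_measurable _).
have [g gE] : exists g : L2 R, \forall x \ae mu, g x = ((f : pt -> R) \_ W) x.
  apply: L2_exists; apply: Lfun2P => //.
  have -> : (\int[mu]_x (((f : pt -> R) \_ W) x ^+ 2)%:E = \int[mu]_(x in W) (f x ^+ 2)%:E)%E.
    rewrite [RHS]integral_mkcond; apply: eq_integral => x _.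
    by rewrite !patchE; case: ifP => // _; rewrite expr0n.
  exact: L2_square_finite.
exists g; split; apply: filterS gE => x ->; rewrite patchE => xW.
  by rewrite mem_set.
by rewrite memNset.
Qed.

(** The normalisation of [wderiv] by zero outside its open set makes the two
    derivatives different elements of L^2; they agree only on [W]. *)
Lemma wderiv_sub W U i f f' : open W -> open U -> W `<=` U -> H1 U f ->
  (\forall x \ae mu, W x -> f' x = f x) ->
  is_wderiv W i f' (wderiv W i f') /\
  \forall x \ae mu, W x -> wderiv W i f' x = wderiv U i f x.
Proof.
move=> oW oU WU Hf ff; have mW := open_measurable_plane oW.
have [g [gE og]] := L2_restrict (wderiv U i f) mW.
have H := is_wderiv_sub oW oU WU (wderivP i Hf) ff gE og.
by rewrite (wderivE oW H).
Qed.

Lemma H1_sub W U f f' : open W -> open U -> W `<=` U -> H1 U f ->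
  (\forall x \ae mu, W x -> f' x = f x) -> H1 W f'.
Proof.
move=> oW oU WU Hf ff i; have [H _] := wderiv_sub i oW oU WU Hf ff.
by exists (wderiv W i f').
Qed.

Lemma H2_sub W U f : open W -> open U -> W `<=` U -> H2 U f -> H2 W f.
Proof.
move=> oW oU WU [Hf Hf'].
have ff : \forall x \ae mu, W x -> f x = f x by exact: nearW.
split; first exact: H1_sub WU Hf ff.
move=> i; have [_ E] := wderiv_sub i oW oU WU Hf ff.
exact: (H1_sub oW oU WU (Hf' i) E).
Qed.

Lemma wderiv2_sub W U i j f : open W -> open U -> W `<=` U -> H2 U f ->
  \forall x \ae mu, W x -> wderiv W j (wderiv W i f) x = wderiv U j (wderiv U i f) x.
Proof.
move=> oW oU WU [Hf Hf'].
have ff : \forall x \ae mu, W x -> f x = f x by exact: nearW.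
have [_ E] := wderiv_sub i oW oU WU Hf ff.
by have [_] := wderiv_sub j oW oU WU (Hf' i) E.
Qed.

(** The product of a smooth function with a test function is a test function,
    and the integral of its derivative vanishes: this is integration by parts.
    *)
Lemma smooth_is_wderiv W r i (q : pt -> R) f g : open W -> W `<=` box r -> smooth q ->
  (\forall x \ae mu, W x -> f x = q x) -> (\forall x \ae mu, W x -> g x = pd i q x) ->
  L2on W g -> is_wderiv W i f g.
Proof.
move=> oW Wr sq fq gq og; split=> // phi tp; have mW := open_measurable_plane oW.
have tpi := testfun_pd i tp.
have mp := testfun_measurable tp; have mpi := testfun_measurable tpi.
have sp := testfun_smooth tp.
have mq : measurable_fun setT q by apply: continuous_measurable_plane; exact: smooth_continuous.
have mqi : measurable_fun setT (pd i q).
  by apply: continuous_measurable_plane; apply: smooth_continuous; exact: smooth_pd.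
rewrite (@ae_eq_Rintegral _ _ (fun x => q x * pd i phi x))//; last 3 first.
- by apply: measurable_funM; apply: measurable_funTS => //; exact: L2_measurable.
- by apply: measurable_funM; exact: measurable_funTS.
- by apply: filterS fq => x fq xW; rewrite fq.
rewrite [in RHS](@ae_eq_Rintegral _ _ (fun x => pd i q x * phi x))//; last 3 first.
- by apply: measurable_funM; apply: measurable_funTS => //; exact: L2_measurable.
- by apply: measurable_funM; exact: measurable_funTS.
- by apply: filterS gq => x gq xW; rewrite gq.
have cint (k : pt -> R) : smooth k -> mu.-integrable W (EFin \o k).
  by move=> sk; apply: (continuous_integrable mW Wr); exact: smooth_continuous.
apply/eqP; rewrite -addr_eq0; apply/eqP.
rewrite -RintegralD//; last 2 first.
- exact: (cint (q * pd i phi) (smoothM sq (smooth_pd i sp))).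
- exact: (cint (pd i q * phi) (smoothM (smooth_pd i sq) sp)).
rewrite -[RHS](Rintegral_pd_testfun i (testfunM sq tp)).
rewrite Rintegral_mkcond; apply: eq_Rintegral => x _; rewrite patchE.
rewrite pdM; last 2 first.
- by move=> y; exact: smooth_derivable.
- by move=> y; exact: smooth_derivable.
rewrite (_ : (pd i q * phi + q * pd i phi) x = pd i q x * phi x + q x * pd i phi x)//.
case: ifPn => [_|]; first by rewrite addrC.
by rewrite notin_setE => xW; rewrite (testfun_out tp xW) (testfun_pd_out i tp xW) !mulr0 addr0.
Qed.

Lemma smooth_wderiv W r i (q : pt -> R) f : open W -> W `<=` box r -> smooth q ->
  (\forall x \ae mu, W x -> f x = q x) ->
  is_wderiv W i f (wderiv W i f) /\ \forall x \ae mu, W x -> wderiv W i f x = pd i q x.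
Proof.
move=> oW Wr sq fq; have mW := open_measurable_plane oW.
have [C _ HC] := continuous_bounded_on (smooth_continuous (smooth_pd i sq)) Wr.
have mqi : measurable_fun W (pd i q).
  apply: measurable_funTS; apply: continuous_measurable_plane.
  by apply: smooth_continuous; exact: smooth_pd.
have [g [gq og]] := L2_of_bounded mW Wr mqi HC.
have H := smooth_is_wderiv oW Wr sq fq gq og.
by rewrite (wderivE oW H).
Qed.

Lemma smooth_H2 W r (q : pt -> R) f : open W -> W `<=` box r -> smooth q ->
  (\forall x \ae mu, W x -> f x = q x) -> H2 W f.
Proof.
move=> oW Wr sq fq; split.
  by move=> i; have [H _] := smooth_wderiv i oW Wr sq fq; exists (wderiv W i f).
move=> i j; have [_ E] := smooth_wderiv i oW Wr sq fq.
have [H _] := smooth_wderiv j oW Wr (smooth_pd i sq) E.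
by exists (wderiv W j (wderiv W i f)).
Qed.

Lemma smooth_wderiv2 W r i j (q : pt -> R) f : open W -> W `<=` box r -> smooth q ->
  (\forall x \ae mu, W x -> f x = q x) ->
  \forall x \ae mu, W x -> wderiv W j (wderiv W i f) x = pd j (pd i q) x.
Proof.
move=> oW Wr sq fq; have [_ E] := smooth_wderiv i oW Wr sq fq.
by have [] := smooth_wderiv j oW Wr (smooth_pd i sq) E.
Qed.

(** * The piecewise energy form *)

Lemma hess_lin_l U (a : R) v w z : open U -> H2 U v -> H2 U w ->
  hess U (a *: v + w) z = a * hess U v z + hess U w z.
Proof.
move=> oU Hv Hw; have mU := open_measurable_plane oU.
rewrite /hess mulr_sumr -big_split; apply: eq_bigr => i _ /=.
rewrite mulr_sumr -big_split; apply: eq_bigr => j _ /=.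
rewrite wderiv2_lin// Rintegral_L2_lin//; try exact: L2_mul_integrable.
exact: measurable_funTS (L2_measurable _).
Qed.

Lemma hess_sym U v w : hess U v w = hess U w v.
Proof.
apply: eq_bigr => i _; apply: eq_bigr => j _.
by apply: eq_Rintegral => x _; exact: mulrC.
Qed.

Lemma hess_ge0 U v : 0 <= hess U v v.
Proof.
apply: sumr_ge0 => i _; apply: sumr_ge0 => j _; apply: Rintegral_ge0 => x _.
by rewrite -expr2 sqr_ge0.
Qed.

End WeakDerivatives.

Section SemiInner.
Context {R : realType} {V : lmodType R}.
Variables (S : set V) (b : V -> V -> R).
Hypothesis b_lin : forall (a : R) u v w, S u -> S v -> b (a *: u + v) w = a * b u w + b v w.
Hypothesis b_sym : forall u v, b u v = b v u.
Hypothesis b_ge0 : forall u, 0 <= b u u.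

Lemma semi_inner_quadratic (a : R) u v : S u -> S v ->
  b (a *: u + v) (a *: u + v) = a ^+ 2 * b u u + 2 * a * b u v + b v v.
Proof.
move=> Su Sv; rewrite b_lin// [b u _]b_sym [b v _]b_sym !b_lin//.
rewrite [b v u]b_sym; ring.
Qed.

(** The discriminant argument for the nonnegative quadratic
    [semi_inner_quadratic] in [a]; the form may be degenerate. *)
Lemma semi_inner_CS u v : S u -> S v -> b u v <= Num.sqrt (b u u) * Num.sqrt (b v v).
Proof.
move=> Su Sv.
have H a : 0 <= a ^+ 2 * b u u + 2 * a * b u v + b v v.
  by rewrite -semi_inner_quadratic.
have Hu := b_ge0 u; have Hv := b_ge0 v.
have sq : b u v ^+ 2 <= b u u * b v v.
  have [u0|u0] := eqVneq (b u u) 0.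
    have [->|uv0] := eqVneq (b u v) 0; first by rewrite expr0n mulr_ge0.
    have := H (- (b v v + 1) / (2 * b u v)); rewrite u0 mulr0 add0r.
    have -> : 2 * (- (b v v + 1) / (2 * b u v)) * b u v = - (b v v + 1) by field.
    lra.
  have up : 0 < b u u by rewrite lt_def u0 Hu.
  have := H (- b u v / b u u).
  have -> : (- b u v / b u u) ^+ 2 * b u u + 2 * (- b u v / b u u) * b u v + b v v =
    (b u u * b v v - b u v ^+ 2) / b u u by field.
  by rewrite pmulr_lge0 ?invr_gt0// subr_ge0.
rewrite -sqrtrM//; apply: le_trans (ler_norm _) _.
by rewrite -sqrtr_sqr ler_wsqrtr.
Qed.

Lemma semi_inner_triangle u v : S u -> S v ->
  Num.sqrt (b (u + v) (u + v)) <= Num.sqrt (b u u) + Num.sqrt (b v v).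
Proof.
move=> Su Sv; rewrite -[u in u + v]scale1r semi_inner_quadratic// expr1n !mul1r mulr1.
have := semi_inner_CS Su Sv; have Hu := sqr_sqrtr (b_ge0 u); have Hv := sqr_sqrtr (b_ge0 v).
move: Hu Hv; set x := Num.sqrt (b u u); set y := Num.sqrt (b v v) => Hu Hv xy.
have x0 : 0 <= x by exact: sqrtr_ge0. have y0 : 0 <= y by exact: sqrtr_ge0.
rewrite -[x + y]ger0_norm ?addr_ge0// -sqrtr_sqr; apply: ler_wsqrtr.
by rewrite sqrrD Hu Hv; lra.
Qed.

End SemiInner.

(** * Calculus on triangles *)

Section Triangle.
Context {R : realType}.
Notation pt := (plane R).
Local Notation mu := (leb2 R).
Local Notation leb := (@lebesgue_measure R).

(** In the affine coordinates given by [b] and a normal vector, the line is a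
    product of a point with the real line. *)
Lemma line_null (P b : pt) : b != 0 -> mu [set x | det2 (x - P) b = 0] = 0%E.
Proof.
move=> b0; pose a : pt := (b.2, - b.1).
have dab : det2 a b != 0.
  rewrite /det2 /=; apply: contraNneq b0 => /eqP.
  rewrite mulNr opprK -!expr2 paddr_eq0 ?sqr_ge0// !sqrf_eq0 => /andP[/eqP b2 /eqP b1].
  by apply/eqP; exact: plane_eq.
set L := [set x | _].
have mL : measurable L.
  have -> : L = (fun x : pt => det2 (x - P) b) @^-1` [set 0].
    by apply/seteqP; split.
  rewrite -[X in measurable X]setTI; apply: (_ : measurable_fun setT _) => //.
  apply: measurable_funB; apply: measurable_funM => //; exact: measurable_funB.
rewrite -(setIT L) -integral_indic//.
rewrite (@ge0_integral_linear _ P a b)//; last by apply/measurable_EFinP; exact: measurable_indic.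
have -> : (\int[mu]_z (\1_L (affine_map P a b z))%:E = mu ([set 0%R] `*` setT))%E.
  have mS : measurable ([set 0] `*` setT : set pt).
    by apply: measurableX => //; exact: measurable_set1.
  rewrite -[in RHS](setIT (_ `*` _)) -[RHS]integral_indic//.
  apply: eq_integral => z _; congr EFin; rewrite !indicE; congr (GRing.natmul _ (nat_of_bool _)).
  have E : det2 (affine_map P a b z - P) b = z.1 * det2 a b.
    by rewrite /det2 /affine_map /=; ring.
  apply/idP/idP => /set_mem H; apply/mem_set.
    by move: H; rewrite /L /= E => /eqP; rewrite mulf_eq0 (negbTE dab) orbF => /eqP.
  by case: H => /= z0 _; rewrite /L /= E z0 mul0r.
have -> : mu ([set 0%R] `*` setT) = (leb [set 0%R] * leb setT)%E.
  by apply: product_measure1E => //; exact: measurable_set1.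
by rewrite lebesgue_measure_set1 mul0e mule0.
Qed.

Variables (A B C : pt).
Local Notation D := (det2 (B - A) (C - A)).

(** The barycentric coordinate attached to [B], by Cramer's rule; the
    coordinates in the basis [B - A], [C - A]. *)
Definition baryB (x : pt) : R := det2 (x - A) (C - A) / D.
Definition baryC (x : pt) : R := det2 (B - A) (x - A) / D.

Definition tri : set pt := [set x | [/\ 0 <= baryB x, 0 <= baryC x & baryB x + baryC x <= 1]].
Definition itri : set pt := [set x | [/\ 0 < baryB x, 0 < baryC x & baryB x + baryC x < 1]].

Lemma baryB_line (x v : pt) (t : R) : baryB (x + t *: v) = baryB x + t * (det2 v (C - A) / D).
Proof. by rewrite /baryB /det2 /= /GRing.scale /=; ring. Qed.

Lemma baryC_line (x v : pt) (t : R) : baryC (x + t *: v) = baryC x + t * (det2 (B - A) v / D).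
Proof. by rewrite /baryC /det2 /= /GRing.scale /=; ring. Qed.

Lemma smooth_affine (c d e : R) (f : pt -> R) : (forall x, f x = c * x.1 + d * x.2 + e) -> smooth f.
Proof.
move=> fE; rewrite (_ : f = cst c * (fun x => Defs.coord ord0 x ^+ 1) +
  cst d * (fun x => Defs.coord ord_max x ^+ 1) + cst e); last exact/funext.
apply: smoothD; last exact: smooth_cst.
by apply: smoothD; apply: smoothM; by [exact: smooth_cst|exact: smooth_coordX].
Qed.

Lemma smooth_baryB : smooth baryB.
Proof.
apply: (@smooth_affine ((C - A).2 / D) (- (C - A).1 / D) ((A.2 * (C - A).1 - A.1 * (C - A).2) / D)).
by move=> x; rewrite /baryB [det2 (x - A) _]/det2 /=; ring.
Qed.

Lemma smooth_baryC : smooth baryC.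
Proof.
apply: (@smooth_affine (- (B - A).2 / D) ((B - A).1 / D) ((A.1 * (B - A).2 - A.2 * (B - A).1) / D)).
by move=> x; rewrite /baryC [det2 _ (x - A)]/det2 /=; ring.
Qed.

Lemma closed_tri : closed tri.
Proof.
have cB := smooth_continuous smooth_baryB; have cC := smooth_continuous smooth_baryC.
have -> : tri = baryB @^-1` [set x | 0 <= x] `&` baryC @^-1` [set x | 0 <= x] `&`
   (baryB + baryC) @^-1` [set x | x <= 1].
  by apply/seteqP; split => x; [move=> []|move=> [[]]].
apply: closedI; first apply: closedI.
- by apply: (iffLR (continuous_closedP _)) => //; exact: closed_ge.
- by apply: (iffLR (continuous_closedP _)) => //; exact: closed_ge.
- apply: (iffLR (continuous_closedP _)); last exact: closed_le.
  exact: smooth_continuous (smoothD smooth_baryB smooth_baryC).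
Qed.

Lemma open_itri : open itri.
Proof.
have cB := smooth_continuous smooth_baryB; have cC := smooth_continuous smooth_baryC.
have -> : itri = baryB @^-1` [set x | 0 < x] `&` baryC @^-1` [set x | 0 < x] `&`
   (baryB + baryC) @^-1` [set x | x < 1].
  by apply/seteqP; split => x; [move=> []|move=> [[]]].
apply: openI; first apply: openI.
- by apply: (iffLR (continuousP _)) => //; exact: open_gt.
- by apply: (iffLR (continuousP _)) => //; exact: open_gt.
- apply: (iffLR (continuousP _)); last exact: open_lt.
  exact: smooth_continuous (smoothD smooth_baryB smooth_baryC).
Qed.

Lemma measurable_tri : measurable tri.
Proof.
by rewrite -(setCK tri); apply: measurableC; apply: open_measurable_plane; exact: closed_openC closed_tri.
Qed.

Lemma itri_sub : itri `<=` tri.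
Proof. by move=> x [? ? ?]; split; exact: ltW. Qed.

Hypothesis D0 : D != 0.

Lemma bary_affine (z : pt) : baryB (affine_map A (B - A) (C - A) z) = z.1 /\
  baryC (affine_map A (B - A) (C - A) z) = z.2.
Proof.
rewrite /baryB /baryC.
have -> : det2 (affine_map A (B - A) (C - A) z - A) (C - A) = z.1 * D.
  by rewrite /det2 /affine_map /=; ring.
have -> : det2 (B - A) (affine_map A (B - A) (C - A) z - A) = z.2 * D.
  by rewrite /det2 /affine_map /=; ring.
by rewrite !mulfK.
Qed.

Lemma affine_bary (x : pt) : affine_map A (B - A) (C - A) (baryB x, baryC x) = x.
Proof.
have id1 (a1 a2 b1 b2 c1 c2 x1 x2 : R) : b1 * c2 - b2 * c1 != 0 ->
    a1 + ((x1 - a1) * c2 - (x2 - a2) * c1) / (b1 * c2 - b2 * c1) * b1 +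
    (b1 * (x2 - a2) - b2 * (x1 - a1)) / (b1 * c2 - b2 * c1) * c1 = x1 /\
    a2 + ((x1 - a1) * c2 - (x2 - a2) * c1) / (b1 * c2 - b2 * c1) * b2 +
    (b1 * (x2 - a2) - b2 * (x1 - a1)) / (b1 * c2 - b2 * c1) * c2 = x2.
  by move=> d0; split; field.
by apply: plane_eq; have [] := id1 A.1 A.2 (B - A).1 (B - A).2 (C - A).1 (C - A).2 x.1 x.2 D0.
Qed.

Definition reftri : set pt := [set z | [/\ 0 <= z.1, 0 <= z.2 & z.1 + z.2 <= 1]].

Lemma tri_affine (z : pt) : tri (affine_map A (B - A) (C - A) z) <-> reftri z.
Proof. by rewrite /tri /reftri /=; have [-> ->] := bary_affine z. Qed.

Lemma tri_itri_null : mu (tri `\` itri) = 0%E.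
Proof.
have CA : C - A != 0.
  by apply: contraNneq D0 => ->; rewrite /det2 /= !mulr0 subrr.
have BA : B - A != 0.
  by apply: contraNneq D0 => ->; rewrite /det2 /= !mul0r subrr.
have CB : C - B != 0.
  apply: contraNneq D0 => CB; have -> : C - A = B - A by rewrite -(subrK B C) CB add0r.
  by rewrite /det2 mulrC subrr.
have n1 := line_null A CA. have n2 := line_null A BA. have n3 := line_null B CB.
have mline (P b : pt) : measurable [set x : pt | det2 (x - P) b = 0].
  have -> : [set x : pt | det2 (x - P) b = 0] = setT `&` (fun x : pt => det2 (x - P) b) @^-1` [set 0].
    by rewrite setTI; apply/seteqP; split.
  apply: (_ : measurable_fun setT _) => //.
  apply: measurable_funB; apply: measurable_funM => //; exact: measurable_funB.
apply/eqP; rewrite -measure_le0; apply: (@le_trans _ _ (mu ([set x | det2 (x - A) (C - A) = 0] `|`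
   ([set x | det2 (x - A) (B - A) = 0] `|` [set x | det2 (x - B) (C - B) = 0])))).
  apply: le_measure; rewrite ?inE.
  - by apply: measurableD; [exact: measurable_tri|exact: open_measurable_plane open_itri].
  - by apply: measurableU => //; exact: measurableU.
  move=> x [[tB tC tBC] nt].
  have [B0|B0] := eqVneq (baryB x) 0.
    by left; move/eqP: B0; rewrite mulf_eq0 invr_eq0 (negbTE D0) orbF => /eqP.
  have [C0|C0] := eqVneq (baryC x) 0.
    right; left; move/eqP: C0; rewrite mulf_eq0 invr_eq0 (negbTE D0) orbF => /eqP C0.
    by rewrite /= -[RHS]oppr0 -C0 /det2; ring.
  have [BC1|BC1] := eqVneq (baryB x + baryC x) 1; last first.
    by exfalso; apply: nt; split; rewrite lt_def ?B0 ?C0 // eq_sym BC1.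
  right; right => /=.
  have E : (baryB x + baryC x - 1) * D = det2 (x - B) (C - B).
    by rewrite /baryB /baryC mulrBl mulrDl !divfK// mul1r /det2 /=; ring.
  by rewrite -E BC1 subrr mul0r.
apply: (le_trans (measureU2 _ _ _)) => //; first exact: measurableU.
have le3 := measureU2 mu (mline A (B - A)) (mline B (C - B)).
have le0 (x y : \bar R) : (x = 0 -> y <= 0 -> x + y <= 0)%E by move=> ->; rewrite add0e.
apply: (le0 _ _ n1); apply: (le_trans le3); apply: (le0 _ _ n2).
by have := lexx (0 : \bar R)%E; rewrite -{1}n3.
Qed.

Lemma tri_box : exists r, tri `<=` box r.
Proof.
exists (`|A.1| + `|A.2| + `|(B - A).1| + `|(B - A).2| + `|(C - A).1| + `|(C - A).2|) => x [xB xC xBC].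
have xB1 : baryB x <= 1 by lra. have xC1 : baryC x <= 1 by lra.
have H (l y : R) : 0 <= l -> l <= 1 -> `|l * y| <= `|y|.
  by move=> l0 l1; rewrite normrM ger0_norm// ler_piMl.
apply/boxP; rewrite -(affine_bary x) /affine_map /=; split.
- apply: (le_trans (ler_normD _ _)); apply: (le_trans (lerD (ler_normD _ _) (lexx _))).
  have := H _ (B - A).1 xB xB1; have := H _ (C - A).1 xC xC1 => /=.
  have := normr_ge0 A.2; have := normr_ge0 (B.2 - A.2); have := normr_ge0 (C.2 - A.2); lra.
- apply: (le_trans (ler_normD _ _)); apply: (le_trans (lerD (ler_normD _ _) (lexx _))).
  have := H _ (B - A).2 xB xB1; have := H _ (C - A).2 xC xC1 => /=.
  have := normr_ge0 A.1; have := normr_ge0 (B.1 - A.1); have := normr_ge0 (C.1 - A.1); lra.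
Qed.

End Triangle.

(** * Edge means and the divergence theorem *)

Section Divergence.
Context {R : realType}.
Notation pt := (plane R).
Local Notation mu := (leb2 R).
Local Notation leb := (@lebesgue_measure R).

(** Parametrised over the unit interval, hence without the length factor. *)
Definition seg_avg (f : pt -> R) (P Q : pt) : R :=
  \int[leb]_(t in `[0, 1]) f (P + t *: (Q - P)).

Lemma continuous_itv_integrable (g : R -> R) (s t : R) : continuous g ->
  leb.-integrable `[s, t] (EFin \o g).
Proof.
move=> cg; apply: continuous_compact_integrable; first exact: segment_compact.
exact: continuous_subspaceT.
Qed.

Lemma seg_avg_sym (f : pt -> R) P Q : continuous f -> seg_avg f P Q = seg_avg f Q P.
Proof.
move=> cf; rewrite /seg_avg.
have cl := @continuous_line _ f P (Q - P) cf.
rewrite (@Rintegration_by_substitution_onem _ (fun t : R => f (P + t *: (Q - P))) 1)//; last 2 first.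
- by rewrite ler01 lexx.
- exact: continuous_subspaceT.
rewrite /unstable.onem subrr; apply: eq_Rintegral => t _; congr f.
by rewrite scalerBl scale1r !scalerBr opprB; apply: plane_eq => /=; ring.
Qed.

Lemma seg_avg_lin (a : R) (f g : pt -> R) P Q : continuous f -> continuous g ->
  seg_avg (cst a * f + g) P Q = a * seg_avg f P Q + seg_avg g P Q.
Proof.
move=> cf cg; have cf' := @continuous_line _ f P (Q - P) cf; have cg' := @continuous_line _ g P (Q - P) cg.
rewrite /seg_avg -RintegralZl//; last exact: continuous_itv_integrable.
rewrite -RintegralD//.
- apply: (@continuous_itv_integrable (fun t : R => a * f (P + t *: (Q - P)))) => t.
  by apply: cvgM; [exact: cvg_cst|exact: cf'].
- exact: continuous_itv_integrable.
Qed.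

Lemma seg_avg_gradd (f : pt -> R) P Q : smooth f ->
  seg_avg (gradd (Q - P) f) P Q = f Q - f P.
Proof.
move=> sf; rewrite /seg_avg FTC_line//.
by rewrite scale1r scale0r addr0; congr (f _ - _); apply: plane_eq => /=; ring.
Qed.

Section OneTriangle.
Variables (A B C : pt).
Local Notation D := (det2 (B - A) (C - A)).
Hypothesis D0 : D != 0.
Local Notation Phi := (affine_map A (B - A) (C - A)).

Lemma affine_map_line (x y : R) :
  Phi (x, y) = A + y *: (C - A) + x *: (B - A).
Proof. by rewrite affine_mapE addrAC. Qed.

(** The divergence theorem on a triangle, in the direction of an edge: by
    Fubini in affine coordinates, only the two other edges contribute. *)
Lemma divergence_tri (f : pt -> R) : smooth f ->
  \int[mu]_(x in tri A B C) gradd (B - A) f x =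
  `|D| * (seg_avg f B C - seg_avg f A C).
Proof.
move=> sf; pose g := gradd (B - A) f.
have cg : continuous g by apply: smooth_continuous; exact: smooth_gradd.
have cf := smooth_continuous sf.
have mT := measurable_tri A B C.
have [r Tr] := tri_box D0.
have ig : mu.-integrable setT (EFin \o (g \_ (tri A B C))).
  rewrite -restrict_EFin.
  by apply: (integrable_mkcond _ mT).1; exact: (continuous_integrable mT Tr cg).
rewrite Rintegral_mkcond (Rintegral_linear A D0)//; congr (_ * _).
have igA := integrable_linear A D0 ig.
pose h (y : R) := f (B + y *: (C - B)) - f (A + y *: (C - A)).
have inner (y : R) : (fubini_G leb (EFin \o (g \_ (tri A B C)) \o Phi) y =
   ((h \_ `[0%R, 1%R]) y)%:E)%E.
  rewrite /fubini_G.
  have E0 : ((0 <= y) = false) -> (\int[leb]_x ((EFin \o (g \_ (tri A B C)) \o Phi) (x, y)) = 0)%E.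
    move=> y0; rewrite integral0_eq// => x _ /=; rewrite patchE memNset// => /(tri_affine D0).
    by move=> [_ /=]; rewrite y0.
  have E1 : ((y <= 1) = false) -> (\int[leb]_x ((EFin \o (g \_ (tri A B C)) \o Phi) (x, y)) = 0)%E.
    move=> y0; rewrite integral0_eq// => x _ /=; rewrite patchE memNset// => /(tri_affine D0).
    by move=> [/= x0 _ xy]; move/negbT: y0; rewrite -ltNge; lra.
  rewrite patchE; case: ifPn; last first.
    by rewrite notin_setE /= in_itv /= => /negP; rewrite negb_and => /orP[] /negbTE.
  move=> /set_mem; rewrite /= in_itv /= => /andP[y0 y1].
  have -> : (\int[leb]_x ((EFin \o (g \_ (tri A B C)) \o Phi) (x, y)) =
     \int[leb]_(x in `[0%R, (1 - y)%R]) (g (A + y *: (C - A) + x *: (B - A)))%:E)%E.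
    rewrite [RHS]integral_mkcond; apply: eq_integral => x _ /=.
    rewrite !patchE -affine_map_line.
    have -> : (Phi (x, y) \in tri A B C) = (x \in `[0%R, (1 - y)%R]%classic).
      apply/idP/idP => /set_mem H; apply/mem_set.
        have /tri_affine [//|/= x0 _ xy] := H.
        by rewrite /= in_itv /= x0/=; lra.
      apply/(tri_affine D0); move: H; rewrite /= in_itv /= => /andP[x0 x1].
      by split => //=; lra.
    by case: ifP.
  have y1' : 0 <= 1 - y by lra.
  have := FTC_line (A + y *: (C - A)) (B - A) sf y1'.
  rewrite /Rintegral => H; rewrite /h.
  have -> : B + y *: (C - B) = A + y *: (C - A) + (1 - y) *: (B - A).
    by apply: plane_eq; rewrite /= /GRing.scale /=; ring.
  rewrite scale0r addr0 in H; rewrite -H fineK//.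
  apply: integrable_fin_num => //; apply: (@continuous_itv_integrable (fun x => g (A + y *: (C - A) + x *: (B - A)))).
  exact: continuous_line.
have -> : \int[mu]_z (g \_ (tri A B C)) (Phi z) = \int[leb]_y (h \_ `[0, 1]) y.
  rewrite /Rintegral /leb2 -integral21_prod_meas1//; congr fine.
  by apply: eq_integral => y _; rewrite -inner.
rewrite -Rintegral_mkcond /h /seg_avg RintegralB//.
- exact/continuous_itv_integrable/continuous_line.
- exact/continuous_itv_integrable/continuous_line.
Qed.

End OneTriangle.

Lemma det2_swap (A B C : pt) : det2 (C - A) (B - A) = - det2 (B - A) (C - A).
Proof. by rewrite /det2; ring. Qed.

Lemma bary_swap (A B C x : pt) : baryB A C B x = baryC A B C x /\ baryC A C B x = baryB A B C x.
Proof.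
rewrite /baryB /baryC (det2_swap A B C) invrN !mulrN -!mulNr.
by split; congr (_ / _); rewrite /det2; ring.
Qed.

Lemma tri_swap (A B C : pt) : tri A C B = tri A B C.
Proof.
apply/seteqP; split => x; rewrite /tri /=; have [-> ->] := bary_swap A B C x.
  by move=> [? ? ?]; split => //; rewrite addrC.
by move=> [? ? ?]; split => //; rewrite addrC.
Qed.

Lemma graddM (v : pt) (f g : pt -> R) x : smooth f -> smooth g ->
  gradd v (f * g) x = gradd v f x * g x + f x * gradd v g x.
Proof.
move=> sf sg.
have df i y : derivable f y (unitv i) by exact: smooth_derivable.
have dg i y : derivable g y (unitv i) by exact: smooth_derivable.
have E i : pd i (f * g) x = pd i f x * g x + f x * pd i g x by rewrite pdM.
by rewrite /gradd E [pd ord_max _ _]E; ring.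
Qed.

Lemma gradd_affine (f : pt -> R) (x v : pt) (c : R) : smooth f ->
  (forall t : R, f (x + t *: v) = f x + t * c) -> gradd v f x = c.
Proof.
move=> sf fE; have H := smooth_derive_line x v 0 sf.
rewrite scale0r addr0 in H; rewrite -(@derive_val _ _ _ _ _ _ _ H).
rewrite (_ : (fun s : R => f (x + s *: v)) = horner (c *: 'X + (f x)%:P)); last first.
  by apply/funext => s; rewrite fE hornerD hornerZ hornerX hornerC addrC mulrC.
rewrite (@derive_val _ _ _ _ _ _ _ (is_derive_poly _ _)).
by rewrite derivD derivZ derivX derivC addr0 hornerZ hornerC mulr1.
Qed.

(** Apply the divergence theorem to [baryB * f] in the direction [B - A] and
    to [baryC * f] in the direction [C - A]. Each product vanishes on the edge
    through [A] that would contribute with a minus sign, and the two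
    barycentric coordinates add up to one on the edge from [B] to [C]. *)
Lemma trace_tri (A B C : pt) (f : pt -> R) : det2 (B - A) (C - A) != 0 -> smooth f ->
  `|det2 (B - A) (C - A)| * seg_avg f B C =
  \int[mu]_(x in tri A B C) (2 * f x + baryB A B C x * gradd (B - A) f x +
     baryC A B C x * gradd (C - A) f x).
Proof.
move=> D0 sf; have D0' : det2 (C - A) (B - A) != 0 by rewrite (det2_swap A B C) oppr_eq0.
set lB := baryB A B C; set lC := baryC A B C.
have sB : smooth lB by exact: smooth_baryB. have sC : smooth lC by exact: smooth_baryC.
have gB x : gradd (B - A) lB x = 1.
  by apply: gradd_affine => // t; rewrite /lB baryB_line divff.
have gC x : gradd (C - A) lC x = 1.
  by apply: gradd_affine => // t; rewrite /lC baryC_line divff.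
have mT := measurable_tri A B C; have [r Tr] := tri_box D0.
have E1 := divergence_tri D0 (smoothM sB sf).
have E2 := divergence_tri D0' (smoothM sC sf).
rewrite tri_swap (det2_swap A B C) normrN in E2.
have cint (k : pt -> R) : smooth k -> mu.-integrable (tri A B C) (EFin \o k).
  by move=> sk; apply: (continuous_integrable mT Tr); exact: smooth_continuous.
have -> : \int[mu]_(x in tri A B C) (2 * f x + lB x * gradd (B - A) f x + lC x * gradd (C - A) f x) =
   \int[mu]_(x in tri A B C) (gradd (B - A) (lB * f) x + gradd (C - A) (lC * f) x).
  by apply: eq_Rintegral => x _; rewrite (graddM _ _ sB sf) (graddM _ _ sC sf) gB gC; ring.
rewrite RintegralD//; last 2 first.
- by apply: cint; apply: smooth_gradd; exact: smoothM.
- by apply: cint; apply: smooth_gradd; exact: smoothM.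
rewrite E1 E2 -mulrDr; congr (_ * _).
have Z1 : seg_avg (lB * f) A C = 0.
  rewrite /seg_avg; transitivity (\int[leb]_(t in `[0%R, 1%R]) (0 : R)).
    apply: eq_Rintegral => t _; rewrite (_ : (lB * f) _ = lB (A + t *: (C - A)) * f (A + t *: (C - A)))//.
    by rewrite /lB baryB_line /baryB subrr /det2 /=; ring.
  by rewrite Rintegral_cst// mul0r.
have Z2 : seg_avg (lC * f) A B = 0.
  rewrite /seg_avg; transitivity (\int[leb]_(t in `[0%R, 1%R]) (0 : R)).
    apply: eq_Rintegral => t _; rewrite (_ : (lC * f) _ = lC (A + t *: (B - A)) * f (A + t *: (B - A)))//.
    by rewrite /lC baryC_line /baryC subrr /det2 /=; ring.
  by rewrite Rintegral_cst// mul0r.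
rewrite Z1 Z2 !subr0 (@seg_avg_sym _ C B); last exact: smooth_continuous (smoothM sC sf).
have cBf := smooth_continuous (smoothM sB sf); have cCf := smooth_continuous (smoothM sC sf).
rewrite /seg_avg -RintegralD//; last 2 first.
- exact: (@continuous_itv_integrable (fun t : R => (lB * f) (B + t *: (C - B))) 0 1 (@continuous_line _ _ B (C - B) cBf)).
- exact: (@continuous_itv_integrable (fun t : R => (lC * f) (B + t *: (C - B))) 0 1 (@continuous_line _ _ B (C - B) cCf)).
apply: eq_Rintegral => t _; set y := B + t *: (C - B).
have -> : (lB * f) y + (lC * f) y = (lB y + lC y) * f y by rewrite mulrDl.
suff -> : lB y + lC y = 1 by rewrite mul1r.
rewrite /lB /lC /baryB /baryC -mulrDl.
have -> : det2 (y - A) (C - A) + det2 (B - A) (y - A) = det2 (B - A) (C - A).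
  by rewrite /y /det2 /= /GRing.scale /=; ring.
exact: divff.
Qed.

End Divergence.

(** * Traces *)

Section Traces.
Context {R : realType}.
Notation pt := (plane R).
Local Notation mu := (leb2 R).
Local Notation leb := (@lebesgue_measure R).

(** The approximating functions are smooth on the whole plane, so that they
    can be evaluated on the boundary of [W]. *)
Definition H1approx (W : set pt) (w : L2 R) (phi : nat -> pt -> R) :=
  [/\ forall m, smooth (phi m),
      l2err W w (phi m) @[m --> \oo] --> 0%E
    & forall i, l2err W (wderiv W i w) (pd i (phi m)) @[m --> \oo] --> 0%E].

Lemma cvg_l2err_pairing (W : set pt) r (w : L2 R) (phi : nat -> pt -> R) (k : pt -> R) :
  measurable W -> W `<=` box r -> (forall m, continuous (phi m)) -> continuous k ->
  l2err W w (phi m) @[m --> \oo] --> 0%E ->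
  \int[mu]_(x in W) (k x * phi m x) @[m --> \oo] --> \int[mu]_(x in W) (k x * w x).
Proof.
move=> mW Wr cphi ck cv.
have mk : measurable_fun W k by apply: measurable_funTS; exact: continuous_measurable_plane.
apply: cvg_square_pairing => //.
- exact: measurable_funTS (L2_measurable w).
- by move=> m; apply: measurable_funTS; exact: continuous_measurable_plane.
- exact: continuous_square_finite Wr ck.
- apply: eq_integrable (L2_continuous_mul_integrable w mW Wr ck) => // x _.
  by rewrite mulrC.
Qed.

Lemma is_trace_integrable (W : set pt) (P Q : pt) (w : L2 R) (g : R -> R) (phi : nat -> pt -> R) :
  (forall m, smooth (phi m)) -> measurable_fun (`[0, 1] : set R) g ->
  (\int[leb]_(t in `[0%R, 1%R])
           ((g t - phi m (P + t *: (Q - P))) ^+ 2)%:E)%E @[m --> \oo] --> 0%E ->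
  leb.-integrable `[0, 1] (EFin \o g) /\
  seg_avg (phi m) P Q @[m --> \oo] --> \int[leb]_(t in `[0, 1]) g t.
Proof.
move=> sphi mg cv.
have m01 : measurable (`[0, 1] : set (measurableTypeR R)) by exact: measurable_itv.
have cl m : continuous (fun t : R => phi m (P + t *: (Q - P))).
  by apply: continuous_line; exact: smooth_continuous.
have ml m : measurable_fun (`[0, 1] : set R) (fun t : R => phi m (P + t *: (Q - P))).
  by apply: measurable_funTS; exact: continuous_measurable_fun.
have i1 : (\int[leb]_(t in `[0%R, 1%R]) ((1 : R) ^+ 2)%:E < +oo)%E.
  apply: integrable_lty => //.
  exact: (@continuous_itv_integrable R (cst (1 ^+ 2)) 0 1 (@cst_continuous _ _ _)).
have ig : leb.-integrable `[0, 1] (EFin \o g).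
  have [N _ HN] := cvge0_lt cv ltr01.
  have HN' := HN N (leqnn N).
  have ih : leb.-integrable `[0, 1] (fun t => ((1 : R) * (g t - phi N (P + t *: (Q - P))))%:E).
    apply: integrable_square_mul => //.
    - exact: measurable_funB mg (ml N).
    - by apply: (lt_le_trans HN'); rewrite leey.
  have := integrableD m01 ih (@continuous_itv_integrable R _ 0 1 (cl N)).
  by apply: eq_integrable => // t _ /=; rewrite -EFinD; congr EFin; ring.
split=> //.
have E (h : R -> R) : \int[leb]_(t in `[0%R, 1%R]) ((cst 1 : R -> R) t * h t) = \int[leb]_(t in `[0%R, 1%R]) h t.
  by apply: eq_Rintegral => t _; rewrite mul1r.
have -> : (fun m => seg_avg (phi m) P Q) =
  (fun m => \int[leb]_(t in `[0%R, 1%R]) ((cst 1 : R -> R) t * phi m (P + t *: (Q - P)))).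
  by apply/funext => m; rewrite E.
rewrite -(E g); apply: cvg_square_pairing => //.
by apply: eq_integrable ig => // t _; rewrite /= mul1r.
Qed.

Variables (W : set pt) (A B C : pt).
Hypothesis oW : open W.
Hypothesis itW : itri A B C `<=` W.
Hypothesis Wt : W `<=` tri A B C.
Local Notation D := (det2 (B - A) (C - A)).
Hypothesis D0 : D != 0.

Let mW : measurable W. Proof. exact: open_measurable_plane. Qed.

Lemma sub_tri_box : exists r, W `<=` box r.
Proof. by have [r Tr] := tri_box D0; exists r; exact: subset_trans Tr. Qed.

Lemma Rintegral_tri (k : pt -> R) : continuous k ->
  \int[mu]_(x in tri A B C) k x = \int[mu]_(x in W) k x.
Proof.
move=> ck; have mT := measurable_tri A B C; have [r Tr] := tri_box D0.
have mN : measurable (tri A B C `\` W) by exact: measurableD.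
rewrite /Rintegral (@negligible_integral _ _ _ _ _ (tri A B C `\` W))//.
- congr fine; congr (integral mu _ _); apply/seteqP; split => x.
    by move=> [Tx nx]; apply: contrapT => Wx; apply: nx; split.
  by move=> Wx; split; [exact: Wt|move=> []].
- exact: (continuous_integrable mT Tr ck).
- apply/eqP; rewrite -measure_le0 -(tri_itri_null D0); apply: le_measure; rewrite ?inE//.
    by apply: measurableD => //; apply: open_measurable_plane; exact: open_itri.
  by move=> x [Tx Wx]; split => // /itW.
Qed.

Let kap (i : 'I_2) (x : pt) : R :=
  baryB A B C x * Defs.coord i (B - A) + baryC A B C x * Defs.coord i (C - A).

Let smooth_kap i : smooth (kap i).
Proof.
apply: smoothD; apply: smoothM; try exact: smooth_cst.
- exact: smooth_baryB.
- exact: smooth_baryC.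
Qed.

(** The right-hand side of [trace_tri], with weak derivatives. It is
    continuous in H^1, so that the mean of a trace depends neither on the
    approximating sequence nor on the choice of the trace. *)
Definition edge_mean (w : L2 R) : R := `|D|^-1 *
  (\int[mu]_(x in W) (2 * w x) + \sum_(i < 2) \int[mu]_(x in W) (kap i x * wderiv W i w x)).

(** Both sides of [trace_tri] converge, the right-hand side as a finite sum of
    pairings with bounded weights. *)
Lemma seg_avg_cvg (w : L2 R) phi : H1approx W w phi ->
  seg_avg (phi m) B C @[m --> \oo] --> edge_mean w.
Proof.
move=> [sphi cv cvd]; have [r Wr] := sub_tri_box.
have -> : (fun m => seg_avg (phi m) B C) = (fun m => `|D|^-1 *
  (\int[mu]_(x in W) (cst 2 x * phi m x) + \sum_(i < 2) \int[mu]_(x in W) (kap i x * pd i (phi m) x))).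
  apply/funext => m.
  have nD : `|D| != 0 by rewrite normr_eq0.
  apply: (mulfI nD); rewrite mulVKf// trace_tri//.
  have cint (k : pt -> R) : smooth k -> mu.-integrable W (EFin \o k).
    by move=> sk; apply: (continuous_integrable mW Wr); exact: smooth_continuous.
  have s1 : smooth (cst 2 * phi m) by apply: smoothM => //; exact: smooth_cst.
  have s2 i : smooth (kap i * pd i (phi m)) by apply: smoothM => //; exact: smooth_pd.
  rewrite Rintegral_tri; last first.
    apply: smooth_continuous.
    apply: (@smoothD _ (fun x => 2 * phi m x + baryB A B C x * gradd (B - A) (phi m) x)).
      apply: (@smoothD _ (fun x => 2 * phi m x)) => //.
      by apply: smoothM; [exact: smooth_baryB|exact: smooth_gradd].
    by apply: smoothM; [exact: smooth_baryC|exact: smooth_gradd].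
  rewrite big_ord_recl big_ord1.
  have -> : lift ord0 ord0 = ord_max :> 'I_2 by exact: val_inj.
  rewrite -(@RintegralD _ _ _ mu W (fun x => kap ord0 x * _))//; last 2 first.
  - exact: cint (s2 ord0).
  - exact: cint (s2 ord_max).
  rewrite -RintegralD//; last 2 first.
  - exact: cint s1.
  - exact: cint (smoothD (s2 ord0) (s2 ord_max)).
  by apply: eq_Rintegral => x _; rewrite /gradd /kap /Defs.coord /=; ring.
apply: cvgM; first exact: cvg_cst.
apply: cvgD.
  apply: (cvg_l2err_pairing (k := cst 2) mW Wr) => //.
  - by move=> m; exact: smooth_continuous.
  - exact: cst_continuous.
apply: cvg_big => [|i _]; first exact: add_continuous.
  apply: (cvg_l2err_pairing mW Wr) => //.
  + by move=> m; apply: smooth_continuous; exact: smooth_pd.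
  + exact: smooth_continuous.
Qed.

Lemma trace_mean (w : L2 R) (g : R -> R) : is_trace W B C w g ->
  leb.-integrable `[0, 1] (EFin \o g) /\ \int[leb]_(t in `[0, 1]) g t = edge_mean w.
Proof.
move=> [mg [phi [sphi cv cvd ct]]].
have [ig cg] := is_trace_integrable W w sphi mg ct.
split=> //.
have H : H1approx W w phi by [].
by rewrite -(cvg_lim _ cg)// (cvg_lim _ (seg_avg_cvg H)).
Qed.

(** The mean of a weak derivative in the direction of one edge is read off
    from the means over the two other edges. *)
Lemma divergence_cvg (w : L2 R) phi : H1approx W w phi ->
  `|D| * (seg_avg (phi m) B C - seg_avg (phi m) A C) @[m --> \oo] -->
  \sum_(i < 2) Defs.coord i (B - A) * \int[mu]_(x in W) wderiv W i w x.
Proof.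
move=> [sphi cv cvd]; have [r Wr] := sub_tri_box.
have -> : (fun m => `|D| * (seg_avg (phi m) B C - seg_avg (phi m) A C)) =
  (fun m => \sum_(i < 2) Defs.coord i (B - A) * \int[mu]_(x in W) (cst 1 x * pd i (phi m) x)).
  apply/funext => m; rewrite -divergence_tri// Rintegral_tri; last first.
    by apply: smooth_continuous; exact: smooth_gradd.
  have cint (k : pt -> R) : smooth k -> mu.-integrable W (EFin \o k).
    by move=> sk; apply: (continuous_integrable mW Wr); exact: smooth_continuous.
  have E i : \int[mu]_(x in W) (cst 1 x * pd i (phi m) x) = \int[mu]_(x in W) (pd i (phi m) x).
    by apply: eq_Rintegral => x _; rewrite /= mul1r.
  rewrite big_ord_recl big_ord1 !E.
  have -> : lift ord0 ord0 = ord_max :> 'I_2 by exact: val_inj.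
  rewrite -RintegralZl//; last exact: cint (smooth_pd _ (sphi m)).
  rewrite -RintegralZl//; last exact: cint (smooth_pd _ (sphi m)).
  rewrite -RintegralD//.
  - by apply: (cint (cst _ * pd _ _)); apply: smoothM; [exact: smooth_cst|exact: smooth_pd].
  - by apply: (cint (cst _ * pd _ _)); apply: smoothM; [exact: smooth_cst|exact: smooth_pd].
apply: cvg_big => [|i _]; first exact: add_continuous.
apply: cvgM; first exact: cvg_cst.
have -> : \int[mu]_(x in W) wderiv W i w x = \int[mu]_(x in W) (cst 1 x * wderiv W i w x).
  by apply: eq_Rintegral => x _; rewrite /= mul1r.
apply: (cvg_l2err_pairing mW Wr) => //.
- by move=> m; apply: smooth_continuous; exact: smooth_pd.
- exact: cst_continuous.
Qed.

End Traces.

(** * Geometry of the triangulation *)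

Section OrthonormalFrames.
Context {R : realType}.
Notation pt := (plane R).

Lemma dotE (x y : pt) : dot x y = x.1 * y.1 + x.2 * y.2.
Proof. by rewrite /dot big_ord_recl big_ord1. Qed.

Lemma orthonormal_expand (e1 e2 : pt) : dot e1 e1 = 1 -> dot e2 e2 = 1 -> dot e1 e2 = 0 ->
  forall w : pt, w = dot w e1 *: e1 + dot w e2 *: e2.
Proof.
move=> + + + w; rewrite !dotE; case: e1 => a b; case: e2 => c d /= h1 h2 h3.
pose del := a * d - b * c.
have dd : del * del = 1.
  have -> : del * del = (a * a + b * b) * (c * c + d * d) - (a * c + b * d) * (a * c + b * d).
    by rewrite /del; ring.
  by rewrite h1 h2 h3; ring.
have dE : d = a * del.
  have -> : a * del = (a * a + b * b) * d - b * (a * c + b * d) by rewrite /del; ring.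
  by rewrite h1 h3; ring.
have cE : c = - b * del.
  have -> : - b * del = (a * a + b * b) * c - a * (a * c + b * d) by rewrite /del; ring.
  by rewrite h1 h3; ring.
case: w => w1 w2; apply: plane_eq; rewrite /= /GRing.scale /= cE dE.
- have -> : (w1 * a + w2 * b) * a + (w1 * (- b * del) + w2 * (a * del)) * (- b * del) =
     w1 * (a * a + (del * del) * (b * b)) + w2 * (a * b - (del * del) * (a * b)) by ring.
  by rewrite dd !mul1r h1 subrr; ring.
- have -> : (w1 * a + w2 * b) * b + (w1 * (- b * del) + w2 * (a * del)) * (a * del) =
     w2 * (b * b + (del * del) * (a * a)) + w1 * (a * b - (del * del) * (a * b)) by ring.
  by rewrite dd !mul1r [b * b + _]addrC h1 subrr; ring.
Qed.

Lemma unit_coord (e : pt) : dot e e = 1 -> `|e.1| <= 1 /\ `|e.2| <= 1.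
Proof.
rewrite dotE -!expr2 => h; have h1 := sqr_ge0 e.1; have h2 := sqr_ge0 e.2.
by split; rewrite -(@ler_pXn2r _ 2)// ?nnegrE// expr1n real_normK ?num_real//; lra.
Qed.

End OrthonormalFrames.

Section Geometry.
Context {R : realType} (Om : set (plane R)) {n : nat} (p : 'I_n -> plane R)
  (TT : {set {set 'I_n}}).
Notation pt := (plane R).
Local Notation mu := (leb2 R).
Notation "K ^t" := ((hull p K)°) (at level 2, format "K ^t").

(** Near a boundary point, a Lipschitz domain leaves out an open cone: every
    neighbourhood of the point contains points that are not even in the
    closure of the domain. *)
Lemma lipschitz_interior_closure : open Om -> lipschitz_boundary Om ->
  forall U, open U -> U `<=` closure Om -> U `<=` Om.
Proof.
move=> oOm lip U oU UO x Ux; apply: contrapT => nOx.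
have bx : bdry Om x by split; [exact: UO|move=> /interior_subset].
have [e1 [e2 [r [h [k [g [ [n11 n22 n12] r0 h0 lg gE] ]]]]]] := lip x bx.
have g0 : 0 <= g 0.
  rewrite leNgt; apply/negP => g0.
  have /(gE 0 0) : `|(0 : R)| < r by rewrite normr0.
  by rewrite normr0 !scale0r !addr0 => /(_ h0) [_ /(_ g0)].
have [u11 u12] := unit_coord n11; have [u21 u22] := unit_coord n22.
have /open_planeP /(_ x Ux) [e ep xU] := oU.
pose tau := Num.min (e / 2) (h / 2).
have tau0 : 0 < tau by rewrite lt_min !divr_gt0.
have taue : tau < e by rewrite gt_min; apply/orP; left; lra.
have tauh : tau < h by rewrite gt_min; apply/orP; right; lra.
(* [y] lies below the graph by [tau]; as the graph is Lipschitz, all points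
   close to [y] lie below it as well. *)
pose y := x + (- tau) *: e2.
have yU : U y.
  have small (a : R) : `|a| <= 1 -> `|tau * a| < e.
    by move=> a1; rewrite normrM gtr0_norm//; apply: le_lt_trans taue; rewrite ler_piMr// ltW.
  apply: xU; rewrite /y.
  - have -> : x.1 - (x + (- tau) *: e2).1 = tau * e2.1 by rewrite /= /GRing.scale /=; ring.
    exact: small.
  - have -> : x.2 - (x + (- tau) *: e2).2 = tau * e2.2 by rewrite /= /GRing.scale /=; ring.
    exact: small.
have /UO := yU.
pose c := `|k| + 1; have c1 : 1 <= c by rewrite /c lerDr.
have c0 : 0 < c by apply: lt_le_trans c1.
pose de := Num.min (tau / (2 * c)) (Num.min r (h - tau)).
have de0 : 0 < de by rewrite !lt_min r0 subr_gt0 tauh divr_gt0// mulr_gt0.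
have der : de <= r by rewrite !ge_min lexx orbT.
have deh : de <= h - tau by rewrite !ge_min lexx !orbT.
have det : c * de <= tau / 2.
  have : de <= tau / (2 * c) by rewrite ge_min lexx.
  rewrite ler_pdivlMr ?mulr_gt0// => H; rewrite ler_pdivlMr//.
  by rewrite (_ : c * de * 2 = de * (2 * c))//; ring.
move=> /(_ [set z | `|y.1 - z.1| < de / 2 /\ `|y.2 - z.2| < de / 2]).
case.
  apply/plane_nbhsP; exists (de / 2); first exact: divr_gt0.
  by move=> z; split.
move=> z [Oz /= [z1 z2]].
pose s := dot (z - y) e1; pose t := dot (z - y) e2.
have bnd (a : pt) : `|a.1| <= 1 -> `|a.2| <= 1 -> `|dot (z - y) a| < de.
  move=> a1 a2; rewrite dotE /=; apply: (le_lt_trans (ler_normD _ _)).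
  have -> : de = de / 2 + de / 2 by field.
  apply: ltrD; rewrite normrM distrC.
    by apply: le_lt_trans z1; rewrite ler_piMr.
  by apply: le_lt_trans z2; rewrite ler_piMr.
have sd : `|s| < de by exact: bnd.
have td : `|t| < de by exact: bnd.
have zE : z = x + s *: e1 + (t - tau) *: e2.
  rewrite -[z in LHS](subrK y) {1}(orthonormal_expand n11 n22 n12 (z - y)) -/s -/t /y.
  by rewrite scalerBl scaleNr addrC -!addrA; congr (x + _); rewrite addrC -addrA.
have sr : `|s| < r by exact: lt_le_trans der.
have th : `|t - tau| < h.
  by apply: (le_lt_trans (ler_normB _ _)); rewrite (gtr0_norm tau0); lra.
have [/(_ _) + _] := gE s (t - tau) sr th.
rewrite -zE => /(_ Oz) gst.
have : `|g 0 - g s| <= k * `|0 - s| by apply: (lg (0, s)).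
rewrite sub0r normrN => lgs.
have kc : k * `|s| <= c * de.
  apply: (le_trans (ler_norm _)); rewrite normrM normr_id.
  apply: ler_pM => //; [by rewrite /c lerDl|exact: ltW].
have := ler_norm (g 0 - g s); have := ler_norm t.
have cd : de <= c * de by rewrite ler_peMl// ltW.
lra.
Qed.

Lemma sum_supp3 (W : nmodType) (F : 'I_n -> W) (i j k : 'I_n) :
  i != j -> i != k -> j != k ->
  (forall x, x \notin [set i; j; k]%SET -> F x = 0) -> \sum_x F x = F i + F j + F k.
Proof.
move=> ij ik jk F0; rewrite (bigD1 i)//= (bigD1 j)/=; last by rewrite eq_sym.
rewrite (bigD1 k)/=; last by rewrite ![k == _]eq_sym ik.
rewrite big1 ?addr0 ?addrA// => x /andP[/andP[xi xj] xk].
by apply: F0; rewrite !inE !negb_or xi xj.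
Qed.

Lemma det2_distinct (i j k : 'I_n) : det2 (p j - p i) (p k - p i) != 0 ->
  [/\ i != j, i != k & j != k].
Proof.
move=> d0; split; apply: contraNneq d0 => ->; rewrite /det2 /=.
- by rewrite !subrr !mul0r subrr.
- by rewrite !subrr !mulr0 subrr.
- by rewrite mulrC subrr.
Qed.

Section OneTriangle.
Variables (i j k : 'I_n).
Hypothesis d0 : det2 (p j - p i) (p k - p i) != 0.
Local Notation K := ([set i; j; k]%SET).

Lemma hull_bary (l : 'I_n -> R) : (forall z, z \notin K -> l z = 0) -> \sum_z l z = 1 ->
  baryB (p i) (p j) (p k) (\sum_z l z *: p z) = l j /\
  baryC (p i) (p j) (p k) (\sum_z l z *: p z) = l k.
Proof.
have [ij ik jk] := det2_distinct d0 => l0 l1.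
rewrite (sum_supp3 ij ik jk); last by move=> x /l0 ->; rewrite scale0r.
rewrite (sum_supp3 ij ik jk l0) in l1.
have -> : l i *: p i + l j *: p j + l k *: p k =
  affine_map (p i) (p j - p i) (p k - p i) (l j, l k).
  have -> : l i = 1 - l j - l k by rewrite -l1; ring.
  by apply: plane_eq; rewrite /affine_map /= /GRing.scale /=; ring.
exact: bary_affine.
Qed.

Lemma hull_tri : hull p K = tri (p i) (p j) (p k).
Proof.
have [ij ik jk] := det2_distinct d0.
apply/seteqP; split => x.
  move=> [l [lp l0 l1 ->]]; have [E1 E2] := hull_bary l0 l1.
  rewrite /tri /= E1 E2; split=> //.
  by rewrite -l1 (sum_supp3 ij ik jk l0) -addrA lerDr.
move=> [xB xC xBC]; set b := baryB _ _ _ x in xB xBC; set c := baryC _ _ _ x in xC xBC.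
exists (fun z => if z == i then 1 - b - c else if z == j then b else if z == k then c else 0).
have supp z : z \notin K -> (if z == i then 1 - b - c else if z == j then b else if z == k then c else 0) = 0.
  by rewrite !inE !negb_or => /andP[/andP[/negbTE -> /negbTE ->] /negbTE ->].
split=> //.
- by move=> z; do ?[case: ifP => // _]; lra.
- rewrite (sum_supp3 ij ik jk supp) eqxx [j == i]eq_sym (negbTE ij) eqxx [k == i]eq_sym (negbTE ik).
  by rewrite [k == j]eq_sym (negbTE jk) eqxx; ring.
- rewrite (sum_supp3 ij ik jk); last by move=> z /supp ->; rewrite scale0r.
  rewrite eqxx [j == i]eq_sym (negbTE ij) eqxx [k == i]eq_sym (negbTE ik).
  rewrite [k == j]eq_sym (negbTE jk) eqxx -[LHS](affine_bary d0) -/b -/c.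
  by apply: plane_eq; rewrite /affine_map /= /GRing.scale /=; ring.
Qed.

Lemma itri_interior : itri (p i) (p j) (p k) `<=` K^t.
Proof.
move=> x xi; have : nbhs x (itri (p i) (p j) (p k)).
  by apply: open_nbhs_nbhs; split => //; exact: open_itri.
by apply: filterS; rewrite hull_tri; exact: itri_sub.
Qed.

Lemma interior_tri : K^t `<=` tri (p i) (p j) (p k).
Proof. by rewrite -hull_tri; exact: interior_subset. Qed.

Lemma hull_face_out (S : {set 'I_n}) z : z \in K -> z \notin S ->
  forall x, hull p (K :&: S) x -> ~ itri (p i) (p j) (p k) x.
Proof.
have [ij ik jk] := det2_distinct d0.
move=> zK zS x [l [lp l0 l1 ->]].
have l0' y : y \notin K -> l y = 0.
  by move=> yK; apply: l0; rewrite inE negb_and yK.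
have [E1 E2] := hull_bary l0' l1; rewrite /itri /= E1 E2 => -[lj lk ljk].
have lz : l z = 0 by apply: l0; rewrite inE negb_and zS orbT.
move: l1; rewrite (sum_supp3 ij ik jk l0') => l1.
move: zK; rewrite !inE => /orP[/orP[]|] /eqP zE; rewrite zE in lz; lra.
Qed.

(** The open triangle fills the closed one up to a null set, and its points
    have three positive barycentric coordinates, so that they lie in no proper
    face. *)
Lemma hull_ae : \forall x \ae mu, hull p K x ->
  K^t x /\ forall (S : {set 'I_n}) z, z \in K -> z \notin S -> ~ hull p (K :&: S) x.
Proof.
have mT := measurable_tri (p i) (p j) (p k).
have mI : measurable (itri (p i) (p j) (p k)).
  by apply: open_measurable_plane; exact: open_itri.
exists (tri (p i) (p j) (p k) `\` itri (p i) (p j) (p k)).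
split; [exact: measurableD|exact: tri_itri_null|].
move=> x /= nx; apply: contrapT => H; apply: nx => Kx.
have Tx : tri (p i) (p j) (p k) x by rewrite -hull_tri.
have Ix : itri (p i) (p j) (p k) x by apply: contrapT => nI; exact: H.
split; first exact: itri_interior.
by move=> S z zK zS /(hull_face_out zK zS).
Qed.

End OneTriangle.

Hypothesis tr : triangulation Om p TT.

Lemma triangleP K : K \in TT -> exists i j k, K = [set i; j; k]%SET /\
  det2 (p j - p i) (p k - p i) != 0.
Proof. by case: tr => _ _ h _ _ /h. Qed.

Lemma card_triangle K : K \in TT -> #|K| = 3%N.
Proof.
move=> /triangleP[i [j [k [-> /det2_distinct [ij ik jk]]]]].
by rewrite finset.setUC cardsU1 cards2 !inE negb_or ![k == _]eq_sym ik jk ij.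
Qed.

Lemma measurable_interiorK (K : {set 'I_n}) : measurable K^t.
Proof. by apply: open_measurable_plane; exact: open_interior. Qed.

Lemma hull_sub_closure K : K \in TT -> hull p K `<=` closure Om.
Proof. by case: tr => _ _ _ -> _ KT x xK; exists K. Qed.

Hypothesis dom : polygonal_lipschitz_domain Om.

Lemma open_Om : open Om. Proof. by case: dom => -[]. Qed.
Lemma measurable_Om : measurable Om.
Proof. by apply: open_measurable_plane; exact: open_Om. Qed.
Lemma Om_box : exists r, Om `<=` box r.
Proof. by case: dom => -[_ _ _ /bounded_box [r _ h]] _; exists r. Qed.

(** The triangles only cover the closure of the domain; that their interiors
    avoid the boundary uses its Lipschitz regularity. *)
Lemma interior_sub_Om K : K \in TT -> K^t `<=` Om.
Proof.
move=> KT; apply: lipschitz_interior_closure.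
- exact: open_Om.
- by case: dom => _ [].
- exact: open_interior.
- by apply: subset_trans (hull_sub_closure KT); exact: interior_subset.
Qed.

(** Two distinct triangles meet in a common face that is proper in both, and
    faces are null sets. *)
Lemma partition_ae (h : pt -> R) :
  \forall x \ae mu, (h \_ Om) x = \sum_(K in TT) (h \_ K^t) x.
Proof.
have : \forall x \ae mu, forall K, K \in TT -> hull p K x ->
  K^t x /\ forall (S : {set 'I_n}) z, z \in K -> z \notin S -> ~ hull p (K :&: S) x.
  apply: filter_forall => K; have [KT|] := boolP (K \in TT); last by move=> _; apply: nearW => x.
  have [i [j [k [KE d0]]]] := triangleP KT.
  by have := hull_ae d0; rewrite -KE; apply: filterS => x + _.
apply: filterS => x H.
have [Ox|nOx] := pselect (Om x); last first.
  rewrite patchE memNset// big1// => K KT; rewrite patchE memNset// => /(interior_sub_Om KT).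
  exact: nOx.
rewrite patchE mem_set//.
have [K KT xK] : exists2 K, K \in TT & hull p K x.
  by case: tr => _ _ _ cE _; have := subset_closure Ox; rewrite cE.
have [xKt xS] := H K KT xK.
rewrite (bigD1 K)//= patchE mem_set// big1 ?addr0// => K' /andP[KT' KK'].
rewrite patchE memNset// => xK'.
have xK'' := interior_subset xK'.
have [_ _ _ _ inter] := tr.
have xI : hull p (K :&: K') x.
  have KK'' : K != K' by rewrite eq_sym.
  by rewrite -(inter K K')//; split.
have [z zK zK'] : exists2 z, z \in K & z \notin K'.
  apply/subsetPn; apply/negP => sub; move/negP: KK'; apply.
  by rewrite eq_sym eqEcard sub/= !card_triangle.
exact: (xS K' z zK zK').
Qed.

Lemma Rintegral_partition (h : pt -> R) : mu.-integrable setT (EFin \o h) ->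
  \int[mu]_(x in Om) h x = \sum_(K in TT) \int[mu]_(x in K^t) h x.
Proof.
move=> ih; have mh : measurable_fun setT h by apply/measurable_EFinP; exact: measurable_int ih.
have mp (W : set pt) : measurable W -> measurable_fun setT (h \_ W).
  by move=> mW; apply/(measurable_restrictT _ mW); exact: measurable_funTS.
have ip (W : set pt) : measurable W -> mu.-integrable setT (EFin \o (h \_ W)).
  move=> mW; rewrite -restrict_EFin; apply: (integrable_mkcond _ mW).1.
  exact: integrableS ih.
have mOm := measurable_Om.
have mS : measurable_fun setT (fun x : pt => \sum_(K in TT) (h \_ K^t) x).
  have mK (K : {set 'I_n}) : measurable_fun setT (fun x : pt => if K \in TT then (h \_ K^t) x else 0).
    case: (K \in TT); last exact: measurable_cst.
    exact: mp (measurable_interiorK K).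
  have := measurable_sum (index_enum _) mK; congr (measurable_fun setT _).
  by apply/funext => x; rewrite -big_mkcond.
rewrite Rintegral_mkcond.
rewrite (@ae_eq_Rintegral _ _ (fun x => \sum_(K in TT) (h \_ K^t) x))//.
- have -> : \int[mu]_x (\sum_(K in TT) (h \_ K^t) x) = fine (\sum_(K in TT) \int[mu]_x ((h \_ K^t) x)%:E)%E.
    rewrite /Rintegral -(integral_sum measurableT (mu := mu) (f := fun (K : {set 'I_n}) (x : pt) => ((h \_ K^t) x)%:E)).
      by congr fine; apply: eq_integral => x _; rewrite sumEFin.
    by move=> K; exact: ip (measurable_interiorK K).
  rewrite -sum_fine; last first.
    by move=> K _; apply: integrable_fin_num => //; exact: ip (measurable_interiorK K).
  by apply: eq_bigr => K _; rewrite Rintegral_mkcond.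
- exact: mp.
- by have := partition_ae h; apply: filterS => x ->.
Qed.

End Geometry.

(** * The space H^2_0 *)

Lemma sqr_lin_le (R : realFieldType) (a p q : R) :
  (a * p + q) ^+ 2 <= (2 * a ^+ 2 + 2) * p ^+ 2 + (2 * a ^+ 2 + 2) * q ^+ 2.
Proof.
rewrite -subr_ge0.
have -> : (2 * a ^+ 2 + 2) * p ^+ 2 + (2 * a ^+ 2 + 2) * q ^+ 2 - (a * p + q) ^+ 2 =
  (a * p - q) ^+ 2 + 2 * p ^+ 2 + 2 * (a * q) ^+ 2 by ring.
have h1 := sqr_ge0 (a * p - q); have h2 := sqr_ge0 p; have h3 := sqr_ge0 (a * q).
by apply: addr_ge0; [apply: addr_ge0 => //|]; rewrite pmulr_rge0.
Qed.

Lemma half_sum_lt (R : realFieldType) (c e : R) (x y : \bar R) : 0 < c ->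
  (x < (e / (2 * c))%:E -> y < (e / (2 * c))%:E -> c%:E * x + c%:E * y < e%:E)%E.
Proof.
move=> c0 xe ye.
have E : c * (e / (2 * c)) + c * (e / (2 * c)) = e by field; rewrite gt_eqF.
rewrite -[in X in (_ < X)%E]E EFinD !(EFinM c).
by apply: lteD; rewrite lte_pmul2l.
Qed.

Section L2err.
Context {R : realType}.
Notation pt := (plane R).
Local Notation mu := (leb2 R).
Implicit Types (U W : set pt) (f g : L2 R).

Lemma l2err_ge0 U (f g : pt -> R) : (0 <= l2err U f g)%E.
Proof. exact: ge0_square_int. Qed.

Lemma l2err_sub U W f f' (phi : pt -> R) : measurable U -> measurable W -> W `<=` U ->
  measurable_fun U phi -> (\forall x \ae mu, W x -> f' x = f x) ->
  (l2err W f' phi <= l2err U f phi)%E.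
Proof.
move=> mU mW WU mphi ff.
have mf (h : L2 R) (A : set pt) : measurable_fun A phi ->
    measurable_fun A (fun x => ((h x - phi x) ^+ 2)%:E : \bar R).
  move=> mA; apply/measurable_EFinP; apply: measurable_funX; apply: measurable_funB => //.
  exact: measurable_funTS (L2_measurable h).
have mphiW : measurable_fun W phi by exact: measurable_funS mphi.
have -> : l2err W f' phi = l2err W f phi.
  apply: ae_eq_integral => //; [exact: mf|exact: mf|].
  by apply: filterS ff => x h Wx; rewrite h.
apply: ge0_subset_integral => //; first exact: mf.
by move=> x _; rewrite lee_fin sqr_ge0.
Qed.

Lemma cvg_l2err_sub U W f f' (phi : nat -> pt -> R) : measurable U -> measurable W -> W `<=` U ->
  (forall m, measurable_fun U (phi m)) -> (\forall x \ae mu, W x -> f' x = f x) ->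
  l2err U f (phi m) @[m --> \oo] --> 0%E -> l2err W f' (phi m) @[m --> \oo] --> 0%E.
Proof.
move=> mU mW WU mphi ff cv; apply: cvge0P; first by move=> m; exact: l2err_ge0.
move=> e e0; have := cvge0_lt cv e0; apply: filterS => m; apply: le_lt_trans.
exact: l2err_sub.
Qed.

Lemma cvg_l2err_lin U (a : R) f g (phi psi : nat -> pt -> R) : measurable U ->
  (forall m, measurable_fun U (phi m)) -> (forall m, measurable_fun U (psi m)) ->
  l2err U f (phi m) @[m --> \oo] --> 0%E -> l2err U g (psi m) @[m --> \oo] --> 0%E ->
  l2err U (a *: f + g : L2 R) (cst a * phi m + psi m) @[m --> \oo] --> 0%E.
Proof.
move=> mU mphi mpsi cf cg; apply: cvge0P; first by move=> m; exact: l2err_ge0.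
move=> e e0.
pose c := 2 * a ^+ 2 + 2; have c0 : 0 < c by rewrite /c ltr_wpDl// mulr_ge0// sqr_ge0.
have ec : 0 < e / (2 * c) by rewrite divr_gt0// mulr_gt0.
have H1 := cvge0_lt cf ec; have H2 := cvge0_lt cg ec.
apply: filterS2 H1 H2 => m H1 H2.
have mf (h : L2 R) (k : pt -> R) : measurable_fun U k ->
    measurable_fun U (fun x => (h x - k x) ^+ 2).
  move=> mA; apply: measurable_funX; apply: measurable_funB => //.
  exact: measurable_funTS (L2_measurable h).
have c0' := ltW c0.
pose F : L2 R := a *: f + g; pose Ph : pt -> R := cst a * phi m + psi m.
have B : (l2err U F Ph <= c%:E * l2err U f (phi m) + c%:E * l2err U g (psi m))%E.
  rewrite /l2err -ge0_integralZl_EFin//; last 2 first.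
  - by move=> x _; rewrite lee_fin sqr_ge0.
  - apply/measurable_EFinP; exact: mf.
  rewrite -ge0_integralZl_EFin//; last 2 first.
  - by move=> x _; rewrite lee_fin sqr_ge0.
  - apply/measurable_EFinP; exact: mf.
  rewrite -ge0_integralD//; last 4 first.
  - by move=> x _; rewrite mule_ge0// lee_fin sqr_ge0.
  - by apply/measurable_EFinP; apply: measurable_funM => //; exact: mf.
  - by move=> x _; rewrite mule_ge0// lee_fin sqr_ge0.
  - by apply/measurable_EFinP; apply: measurable_funM => //; exact: mf.
  rewrite [leLHS](@ae_eq_integral _ _ _ mu U (fun x => ((a * f x + g x - (a * phi m x + psi m x)) ^+ 2)%:E))//.
  - apply: ge0_le_integral => //.
    + by move=> x _; rewrite lee_fin sqr_ge0.
    + apply/measurable_EFinP; apply: measurable_funX; apply: measurable_funB.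
        apply: measurable_funD; last exact: measurable_funTS (L2_measurable g).
        by apply: measurable_funM => //; exact: measurable_funTS (L2_measurable f).
      by apply: measurable_funD => //; exact: measurable_funM.
    + apply: emeasurable_funD; apply/measurable_EFinP; apply: measurable_funM => //; exact: mf.
    move=> x _; rewrite -!EFinM -EFinD lee_fin.
    set p := f x - phi m x; set q := g x - psi m x.
    have -> : a * f x + g x - (a * phi m x + psi m x) = a * p + q by rewrite /p /q; ring.
    exact: sqr_lin_le.
  - apply/measurable_EFinP; apply: mf; apply: measurable_funD => //.
    by apply: measurable_funM => //; exact: measurable_cst.
  - apply/measurable_EFinP; apply: measurable_funX; apply: measurable_funB.
      apply: measurable_funD; last exact: measurable_funTS (L2_measurable g).
      by apply: measurable_funM => //; exact: measurable_funTS (L2_measurable f).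
    by apply: measurable_funD => //; exact: measurable_funM.
  - by have := L2_lin a f g; apply: filterS => x E _; rewrite E.
apply: (le_lt_trans B).
exact: half_sum_lt.
Qed.

Lemma testfun_measurable_on U W phi : testfun U phi -> measurable_fun W (phi : pt -> R).
Proof. by move=> tp; apply: measurable_funTS; exact: testfun_measurable tp. Qed.

Lemma testfun_lin U (a : R) phi psi : testfun U phi -> testfun U psi ->
  testfun U (cst a * phi + psi).
Proof. by move=> t1 t2; apply: testfunD => //; exact: testfunZ. Qed.

Lemma pd_lin i (a : R) (phi psi : pt -> R) : smooth phi -> smooth psi ->
  pd i (cst a * phi + psi) = cst a * pd i phi + pd i psi.
Proof.
move=> s1 s2; rewrite pdD.
- congr (_ + _); rewrite pdM.
  + by rewrite pd_cst; apply/funext => x; rewrite -[LHS]/(0 * phi x + a * pd i phi x) mul0r add0r.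
  + by move=> x; exact: derivable_cst.
  + by move=> x; exact: smooth_derivable.
- by move=> x; apply: smooth_derivable; apply: smoothM => //; exact: smooth_cst.
- by move=> x; exact: smooth_derivable.
Qed.

End L2err.

Section H20.
Context {R : realType} (Om : set (plane R)) {n : nat} (p : 'I_n -> plane R)
  (TT : {set {set 'I_n}}).
Notation pt := (plane R).
Local Notation mu := (leb2 R).
Notation "K ^t" := ((hull p K)°) (at level 2, format "K ^t").
Hypothesis dom : polygonal_lipschitz_domain Om.
Hypothesis tr : triangulation Om p TT.
Let oOm : open Om. Proof. exact: open_Om. Qed.
Let mOm : measurable Om. Proof. exact: measurable_Om. Qed.

Lemma V_lin (a : R) u v : V Om u -> V Om v -> V Om (a *: u + v).
Proof.
move=> [ou Hu [phi [tphi c0 c1 c2]]] [ov Hv [psi [tpsi d0 d1 d2]]].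
split; [exact: L2on_lin|exact: H2_lin|].
exists (fun m => cst a * phi m + psi m); split.
- by move=> m; exact: testfun_lin.
- apply: cvg_l2err_lin => //.
  + by move=> m; exact: testfun_measurable_on (tphi m).
  + by move=> m; exact: testfun_measurable_on (tpsi m).
- move=> i; rewrite wderiv_lin//; [|by case: Hu|by case: Hv].
  have -> : (fun m => l2err Om (a *: wderiv Om i u + wderiv Om i v : L2 R) (pd i (cst a * phi m + psi m))) =
    (fun m => l2err Om (a *: wderiv Om i u + wderiv Om i v : L2 R) (cst a * pd i (phi m) + pd i (psi m))).
    by apply/funext => m; rewrite pd_lin//; [exact: testfun_smooth (tphi m)|exact: testfun_smooth (tpsi m)].
  apply: cvg_l2err_lin => //.
  + by move=> m; exact: testfun_measurable_on (testfun_pd i (tphi m)).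
  + by move=> m; exact: testfun_measurable_on (testfun_pd i (tpsi m)).
- move=> i j; rewrite wderiv2_lin//.
  have -> : (fun m => l2err Om (a *: wderiv Om j (wderiv Om i u) + wderiv Om j (wderiv Om i v) : L2 R) (pd j (pd i (cst a * phi m + psi m)))) =
    (fun m => l2err Om (a *: wderiv Om j (wderiv Om i u) + wderiv Om j (wderiv Om i v) : L2 R) (cst a * pd j (pd i (phi m)) + pd j (pd i (psi m)))).
    apply/funext => m; rewrite !pd_lin//; try (by apply: smooth_pd; exact: testfun_smooth (tphi m));
    try (by apply: smooth_pd; exact: testfun_smooth (tpsi m)).
    + exact: testfun_smooth (tphi m).
    + exact: testfun_smooth (tpsi m).
  apply: cvg_l2err_lin => //.
  + by move=> m; exact: testfun_measurable_on (testfun_pd j (testfun_pd i (tphi m))).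
  + by move=> m; exact: testfun_measurable_on (testfun_pd j (testfun_pd i (tpsi m))).
Qed.

Lemma H2pw_lin (a : R) u v : H2pw Om p TT u -> H2pw Om p TT v -> H2pw Om p TT (a *: u + v).
Proof.
move=> [ou Hu] [ov Hv]; split; first exact: L2on_lin.
by move=> K KT; apply: H2_lin; [exact: open_interior|exact: Hu|exact: Hv].
Qed.

Lemma V_H2pw v : V Om v -> H2pw Om p TT v.
Proof.
move=> [ov Hv _]; split=> // K KT; apply: H2_sub Hv => //; first exact: open_interior.
exact: (interior_sub_Om tr dom).
Qed.

Lemma apw_lin (a : R) u v w : H2pw Om p TT u -> H2pw Om p TT v ->
  apw p TT (a *: u + v) w = a * apw p TT u w + apw p TT v w.
Proof.
move=> [_ Hu] [_ Hv]; rewrite /apw mulr_sumr -big_split; apply: eq_bigr => K KT /=.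
by apply: hess_lin_l; [exact: open_interior|exact: Hu|exact: Hv].
Qed.

Lemma apw_sym u v : apw p TT u v = apw p TT v u.
Proof. by apply: eq_bigr => K _; exact: hess_sym. Qed.

Lemma apw_ge0 u : 0 <= apw p TT u u.
Proof. by apply: sumr_ge0 => K _; exact: hess_ge0. Qed.

Lemma npw_ge0 u : 0 <= npw p TT u.
Proof. exact: sqrtr_ge0. Qed.

(** Weak derivatives on the domain restrict to those on the triangles, and the
    triangles cover the domain up to a null set. *)
Lemma aform_apw u v : V Om u -> V Om v -> aform Om u v = apw p TT u v.
Proof.
move=> [_ Hu _] [_ Hv _]; rewrite /aform /apw /hess [RHS]exchange_big; apply: eq_bigr => i _.
rewrite [RHS]exchange_big; apply: eq_bigr => j _ /=.
rewrite (Rintegral_partition tr dom); last exact: L2_mul_integrable.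
apply: eq_bigr => K KT; have mK := measurable_interiorK p K.
have KO := interior_sub_Om tr dom KT.
apply: ae_eq_Rintegral => //.
- by apply: measurable_funM; exact: measurable_funTS (L2_measurable _).
- by apply: measurable_funM; exact: measurable_funTS (L2_measurable _).
have Eu := wderiv2_sub i j (open_interior _) oOm KO Hu.
have Ev := wderiv2_sub i j (open_interior _) oOm KO Hv.
move: Eu Ev; apply: filterS2 => x Eux Evx Kx.
by congr (_ * _); apply/esym; [exact: Eux|exact: Evx].
Qed.

Lemma nV_npw u : V Om u -> nV Om u = npw p TT u.
Proof. by move=> Vu; rewrite /nV /npw aform_apw. Qed.

Definition H20approx (v : L2 R) (phi : nat -> pt -> R) :=
  [/\ forall m, testfun Om (phi m),
          l2err Om v (phi m) @[m --> \oo] --> 0%E,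
          forall i, l2err Om (wderiv Om i v) (pd i (phi m))
            @[m --> \oo] --> 0%E
        & forall i j, l2err Om (wderiv Om j (wderiv Om i v))
            (pd j (pd i (phi m))) @[m --> \oo] --> 0%E].

Lemma H20approx_H1approx v phi K i : H2 Om v -> H20approx v phi -> K \in TT ->
  H1approx K^t (wderiv K^t i v) (fun m => pd i (phi m)).
Proof.
move=> Hv [tphi c0 c1 c2] KT; have KO := interior_sub_Om tr dom KT.
have mK := measurable_interiorK p K.
have ff : \forall x \ae mu, K^t x -> v x = v x by exact: nearW.
split.
- by move=> m; apply: smooth_pd; exact: testfun_smooth (tphi m).
- apply: (cvg_l2err_sub mOm mK KO _ _ (c1 i)).
    by move=> m; exact: testfun_measurable_on (testfun_pd i (tphi m)).
  by have [_] := wderiv_sub i (open_interior _) oOm KO Hv.1 ff.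
- move=> j; apply: (cvg_l2err_sub mOm mK KO _ _ (c2 i j)).
    by move=> m; exact: testfun_measurable_on (testfun_pd j (testfun_pd i (tphi m))).
  exact: wderiv2_sub (open_interior _) oOm KO Hv.
Qed.

End H20.

(** * Continuity of the elements of H^2_0 *)

Section Sobolev.
Context {R : realType}.
Notation pt := (plane R).
Local Notation mu := (leb2 R).
Local Notation leb := (@lebesgue_measure R).

Lemma line_fst (x y : R) : (0, y) + x *: (1, 0) = (x, y) :> pt.
Proof. by apply: plane_eq; rewrite /= /GRing.scale /=; ring. Qed.

Lemma line_snd (x y : R) : (x, 0) + y *: (0, 1) = (x, y) :> pt.
Proof. by apply: plane_eq; rewrite /= /GRing.scale /=; ring. Qed.

Lemma FTC_fst (f : pt -> R) (s t y : R) : smooth f -> s <= t ->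
  \int[leb]_(x in `[s, t]) pd ord0 f (x, y) = f (t, y) - f (s, y).
Proof.
move=> sf st; have := FTC_line (0, y) (1, 0) sf st.
rewrite !line_fst => <-; apply: eq_Rintegral => x _; rewrite line_fst.
by rewrite /gradd mul1r mul0r addr0.
Qed.

Lemma FTC_snd (f : pt -> R) (s t x : R) : smooth f -> s <= t ->
  \int[leb]_(y in `[s, t]) pd ord_max f (x, y) = f (x, t) - f (x, s).
Proof.
move=> sf st; have := FTC_line (x, 0) (0, 1) sf st.
rewrite !line_snd => <-; apply: eq_Rintegral => y _; rewrite line_snd.
by rewrite /gradd mul1r mul0r add0r.
Qed.

Lemma continuous_fst_slice (f : pt -> R) (y : R) : continuous f -> continuous (fun x : R => f (x, y)).
Proof.
move=> cf.
have -> : (fun x : R => f (x, y)) = (fun x : R => f ((0, y) + x *: (1, 0))).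
  by apply/funext => x; rewrite line_fst.
exact: continuous_line.
Qed.

Lemma continuous_snd_slice (f : pt -> R) (x : R) : continuous f -> continuous (fun y : R => f (x, y)).
Proof.
move=> cf.
have -> : (fun y : R => f (x, y)) = (fun y : R => f ((x, 0) + y *: (0, 1))).
  by apply/funext => y; rewrite line_snd.
exact: continuous_line.
Qed.

(** Fubini and the fundamental theorem of calculus in each variable. When [f]
    vanishes on the two lines through the corner [(a, c)], it is an integral
    of its mixed second derivative. *)
Lemma FTC_mixed (f : pt -> R) (a c x y : R) : smooth f -> a <= x -> c <= y ->
  \int[mu]_(z in `[a, x] `*` `[c, y]) pd ord_max (pd ord0 f) z =
  f (x, y) - f (a, y) - (f (x, c) - f (a, c)).
Proof.
move=> sf ax cy; set g := pd ord_max (pd ord0 f).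
have sg : smooth g by do 2 apply: smooth_pd.
have cg := smooth_continuous sg.
have mQ : measurable (`[a, x] `*` `[c, y] : set pt).
  by apply: measurableX; exact: measurable_itv.
have Qb : `[a, x] `*` `[c, y] `<=` box (`|a| + `|x| + `|c| + `|y|).
  move=> z [] /=; rewrite !in_itv /= => /andP[? ?] /andP[? ?]; apply/boxP.
  have := ler_norm x; have := ler_norm y; have := ler_norm (- a); have := ler_norm (- c).
  have := normr_ge0 a; have := normr_ge0 x; have := normr_ge0 c; have := normr_ge0 y.
  by rewrite !normrN !ler_norml; lra.
have ig : mu.-integrable setT (EFin \o (g \_ (`[a, x] `*` `[c, y]))).
  rewrite -restrict_EFin; apply: (integrable_mkcond _ mQ).1.
  exact: (continuous_integrable mQ Qb cg).
pose h (s : R) := pd ord0 f (s, y) - pd ord0 f (s, c).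
have inner (s : R) : (fubini_F leb (EFin \o (g \_ (`[a, x] `*` `[c, y]))) s =
   ((h \_ `[a, x]) s)%:E)%E.
  rewrite /fubini_F patchE; case: ifPn => [/set_mem sax|]; last first.
    rewrite notin_setE => sax; rewrite integral0_eq// => t _ /=.
    by rewrite patchE memNset// => -[].
  have -> : (\int[leb]_t ((EFin \o (g \_ (`[a, x] `*` `[c, y]))) (s, t)) =
     \int[leb]_(t in `[c, y]) (g (s, t))%:E)%E.
    rewrite [RHS]integral_mkcond; apply: eq_integral => t _ /=; rewrite !patchE.
    have -> : ((s, t) \in `[a, x] `*` `[c, y]) = (t \in `[c, y]%classic).
      by apply/idP/idP => /set_mem H; apply/mem_set; [case: H|].
    by case: ifP.
  rewrite /h -FTC_snd//; last exact: smooth_pd.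
  rewrite /Rintegral fineK//; apply: integrable_fin_num => //.
  exact: (@continuous_itv_integrable R (fun t : R => g (s, t)) c y (@continuous_snd_slice g s cg)).
have c0 := smooth_continuous (smooth_pd ord0 sf).
rewrite Rintegral_mkcond.
have -> : \int[mu]_z (g \_ (`[a, x] `*` `[c, y])) z = \int[leb]_s (h \_ `[a, x]) s.
  rewrite /Rintegral /leb2 -integral12_prod_meas1//; congr fine.
  by apply: eq_integral => s _; rewrite -inner.
rewrite -Rintegral_mkcond /h RintegralB//.
- by rewrite !FTC_fst.
- exact: (@continuous_itv_integrable R (fun t : R => pd ord0 f (t, y)) a x (@continuous_fst_slice _ y c0)).
- exact: (@continuous_itv_integrable R (fun t : R => pd ord0 f (t, c)) a x (@continuous_fst_slice _ c c0)).
Qed.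

Lemma uniform_continuous_limit (f : pt -> R) (phi : nat -> pt -> R) :
  (forall m, continuous (phi m)) ->
  (forall e, 0 < e -> \forall m \near \oo, forall x, `|f x - phi m x| <= e) -> continuous f.
Proof.
move=> cphi unif x; apply/cvgrPdist_lt => e e0.
have e4 : 0 < e / 4 by rewrite divr_gt0.
have [N _ /(_ N (leqnn N)) HN] := unif _ e4.
have /cvgrPdist_lt /(_ (e / 4) e4) := cphi N x.
apply: filterS => y xy.
have H1 := HN x; have H2 := HN y.
have -> : f x - f y = (f x - phi N x) + (phi N x - phi N y) - (f y - phi N y) by ring.
apply: (le_lt_trans (ler_normB _ _)); apply: (le_lt_trans (lerD (ler_normD _ _) (lexx _))); lra.
Qed.

Lemma l2err_supp (Om B : set pt) (h : L2 R) (k : pt -> R) : measurable Om -> measurable B -> Om `<=` B ->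
  L2on Om h -> measurable_fun setT k -> (forall x, ~ Om x -> k x = 0) ->
  (l2err B h k = l2err Om h k)%E.
Proof.
move=> mOm mB OB oh mk k0; rewrite /l2err [LHS]integral_mkcond [RHS]integral_mkcond.
have mf (W : set pt) : measurable W ->
   measurable_fun setT ((fun x : pt => ((h x - k x) ^+ 2)%:E : \bar R) \_ W).
  move=> mW; apply/(measurable_restrictT _ mW); apply/measurable_EFinP.
  have mhk : measurable_fun W (fun x => h x - k x).
    by apply: measurable_funB; [exact: measurable_funTS (L2_measurable h)|exact: measurable_funTS mk].
  exact: measurable_funX.
apply: ae_eq_integral => //; [exact: mf|exact: mf|].
apply: filterS oh => x ox _; rewrite !patchE.
have [Ox|nOx] := pselect (Om x); first by rewrite !mem_set//; exact: OB.
by rewrite [x \in Om]memNset// ox// k0// subrr expr0n /=; case: ifP.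
Qed.

Variable (Om : set pt).
Hypothesis dom : polygonal_lipschitz_domain Om.
Let oOm : open Om. Proof. exact: open_Om. Qed.
Let mOm : measurable Om. Proof. exact: measurable_Om. Qed.

(** Test functions are integrals of their mixed second derivatives over
    quadrants, and these derivatives converge in L^2 on a bounded set. The
    limit is defined by the same integral. *)
Lemma H20_uniform (v : L2 R) phi : H2 Om v -> H20approx Om v phi ->
  exists f : pt -> R, (forall x, ~ Om x -> f x = 0) /\
   forall e, 0 < e -> \forall m \near \oo, forall x, `|f x - phi m x| <= e.
Proof.
move=> Hv [tphi _ _ c2].
have [r0 Or0] := Om_box dom; pose r := `|r0| + 1.
have rr0 : r0 < r by rewrite /r (le_lt_trans (ler_norm r0))// ltrDl.
have rp : 0 < r by rewrite /r ltr_wpDl.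
have nOm (x : pt) : r <= `|x.1| \/ r <= `|x.2| -> ~ Om x.
  by move=> xr /Or0 /boxP[x1 x2]; case: xr => h; [move: x1|move: x2]; rewrite leNgt (lt_le_trans rr0 h).
pose h := wderiv Om ord_max (wderiv Om ord0 v).
have oh : L2on Om h by have [] := wderivP ord_max (Hv.2 ord0).
pose hm m := pd ord_max (pd ord0 (phi m)).
have shm m : smooth (hm m) by do 2 apply: smooth_pd; exact: testfun_smooth (tphi m).
pose Q (x : pt) : set pt := `[- r, x.1] `*` `[- r, x.2].
have mQ x : measurable (Q x) by apply: measurableX; exact: measurable_itv.
have mB := @measurable_box R r.
exists (fun x => if pselect (Om x) then \int[mu]_(y in Q x) h y else 0); split.
  by move=> x nO; case: pselect.
move=> e e0.
pose I := fine (mu (box r)).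
have IE : (I%:E = mu (box r))%E by rewrite /I fineK// ge0_fin_numE// box_finite.
have I0 : 0 <= I by rewrite -lee_fin IE.
(* The weight in Young's inequality: [de * I] is at most [e / 2]. *)
pose de := e / 2 / (I + 1).
have de0 : 0 < de by rewrite !divr_gt0// ltr_wpDl.
have := cvge0_lt (c2 ord0 ord_max) (mulr_gt0 de0 (divr_gt0 e0 (ltr0n _ 2))).
apply: filterS => m Hm x.
case: pselect => [Ox|nO]; last by rewrite (testfun_out (tphi m) nO) subrr normr0 ltW.
have [x1 x2] : `|x.1| <= r /\ `|x.2| <= r.
  by have /boxP[x1 x2] := Or0 x Ox; split; exact: le_trans (ltW rr0).
have Qb : Q x `<=` box r.
  move=> y [] /=; rewrite !in_itv /= => /andP[y1 y1'] /andP[y2 y2']; apply/boxP.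
  split; rewrite ler_norml ?y1 ?y2 /=.
    exact: le_trans y1' (le_trans (ler_norm _) x1).
  exact: le_trans y2' (le_trans (ler_norm _) x2).
have x1' : - r <= x.1 by move: x1; rewrite ler_norml => /andP[].
have x2' : - r <= x.2 by move: x2; rewrite ler_norml => /andP[].
have pE : phi m x = \int[mu]_(y in Q x) hm m y.
  rewrite FTC_mixed//; last exact: testfun_smooth (tphi m).
  have z1 (t : R) : phi m (- r, t) = 0.
    by apply: (testfun_out (tphi m)); apply: nOm; left; rewrite /= normrN ger0_norm// ltW.
  have z2 (t : R) : phi m (t, - r) = 0.
    by apply: (testfun_out (tphi m)); apply: nOm; right; rewrite /= normrN ger0_norm// ltW.
  by rewrite !z1 z2 !subr0; case: (x).
rewrite pE -RintegralB//; last 2 first.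
- exact: (L2_integrable h (mQ x) Qb).
- exact: (continuous_integrable (mQ x) Qb (smooth_continuous (shm m))).
have mh A : measurable A -> measurable_fun A (fun y => h y - hm m y).
  move=> mA; apply: measurable_funB; first exact: measurable_funTS (L2_measurable h).
  by apply: measurable_funTS; apply: continuous_measurable_plane; exact: smooth_continuous.
have ih : mu.-integrable (Q x) (EFin \o (fun y => h y - hm m y)).
  have := integrableB (mQ x) (L2_integrable h (mQ x) Qb) (continuous_integrable (mQ x) Qb (smooth_continuous (shm m))).
  by apply: eq_integrable.
apply: (le_trans (le_normr_Rintegral (mQ x) ih)).
rewrite -lee_fin /Rintegral fineK; last first.
  by apply: integrable_fin_num => //; exact: (integrable_abse ih).
have Y : (\int[mu]_(y in Q x) `|(1 * (h y - hm m y))%:E| <=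
    de%:E * \int[mu]_(y in Q x) ((1 : R) ^+ 2)%:E + de^-1%:E * \int[mu]_(y in Q x) ((h y - hm m y) ^+ 2)%:E)%E.
  exact: (@young_integral _ _ _ mu (Q x) (mQ x) (cst 1) (fun y => h y - hm m y) de (measurable_cst _) (mh _ (mQ x)) de0).
have L1 : (\int[mu]_(y in Q x) ((1 : R) ^+ 2)%:E <= I%:E)%E.
  rewrite expr1n integral_cst//= mul1e IE; apply: le_measure; rewrite ?inE//.
have L2' : (\int[mu]_(y in Q x) ((h y - hm m y) ^+ 2)%:E <= (de * (e / 2))%:E)%E.
  apply: le_trans (ltW Hm); rewrite -(@l2err_supp Om (box r) h (hm m) mOm mB)//.
  - apply: ge0_subset_integral => //.
      by apply/measurable_EFinP; apply: measurable_funX; exact: mh.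
    by move=> y _; rewrite lee_fin sqr_ge0.
  - by move=> y /Or0 /boxP[y1 y2]; apply/boxP; split; exact: le_trans (ltW rr0).
  - by apply: continuous_measurable_plane; exact: smooth_continuous.
  - by move=> y nO; exact: testfun_pd_out (testfun_pd ord0 (tphi m)) nO.
have Y' : (\int[mu]_(y in Q x) (`|h y - hm m y|)%:E = \int[mu]_(y in Q x) `|(1 * (h y - hm m y))%:E|)%E.
  by apply: eq_integral => y _; rewrite mul1r abse_EFin.
rewrite Y'; apply: (le_trans Y).
have Z1 : (de%:E * \int[mu]_(y in Q x) ((1 : R) ^+ 2)%:E <= de%:E * I%:E)%E.
  by apply: lee_wpmul2l => //; rewrite lee_fin ltW.
have Z2 : (de^-1%:E * \int[mu]_(y in Q x) ((h y - hm m y) ^+ 2)%:E <= de^-1%:E * (de * (e / 2))%:E)%E.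
  by apply: lee_wpmul2l => //; rewrite lee_fin invr_ge0 ltW.
apply: (le_trans (leeD Z1 Z2)); rewrite -!EFinM -EFinD lee_fin.
rewrite mulKf ?gt_eqF//.
have deI : de * I <= e / 2.
  rewrite /de mulrAC ler_pdivrMr ?ltr_wpDl//.
  by apply: ler_wpM2l; [rewrite ltW// divr_gt0|rewrite lerDl].
by rewrite [leRHS]splitr lerD2r.
Qed.

(** The uniform limit of the approximating test functions is continuous; it
    represents [v] because both are the limit in L^2. *)
Lemma H20_continuous (v : L2 R) phi : L2on Om v -> H2 Om v -> H20approx Om v phi ->
  exists f : pt -> R, [/\ continuous f, forall x, ~ Om x -> f x = 0,
    forall x, phi m x @[m --> \oo] --> f x & \forall x \ae mu, v x = f x].
Proof.
move=> ov Hv Hphi; have [tphi cv _ _] := Hphi.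
have [f [f0 unif]] := H20_uniform Hv Hphi.
have cphi m : continuous (phi m) by exact: smooth_continuous (testfun_smooth (tphi m)).
have cf := uniform_continuous_limit cphi unif.
exists f; split => //.
  move=> x; apply/cvgrPdist_le => e e0; have := unif e e0.
  by apply: filterS => m; apply.
have [r Or] := Om_box dom.
have [C _ HC] := continuous_bounded_on cf Or.
have mf : measurable_fun Om f by apply: measurable_funTS; exact: continuous_measurable_plane.
have [F [FE oF]] := L2_of_bounded mOm Or mf HC.
have Ferr : l2err Om F (phi m) @[m --> \oo] --> 0%E.
  apply: cvge0P; first by move=> m; exact: l2err_ge0.
  move=> e e0; pose I := fine (mu Om).
  have IE : (I%:E = mu Om)%E by rewrite /I fineK// ge0_fin_numE// (sub_box_finite mOm Or).
  have I0 : 0 <= I by rewrite -lee_fin IE.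
  pose d := Num.min 1 (e / (2 * (I + 1))).
  have d0 : 0 < d by rewrite lt_min ltr01 divr_gt0// mulr_gt0//; lra.
  have := unif d d0; apply: filterS => m Hm.
  have -> : l2err Om F (phi m) = l2err Om f (phi m).
    apply: ae_eq_integral => //.
    - apply/measurable_EFinP; apply: measurable_funX; apply: measurable_funB.
        exact: measurable_funTS (L2_measurable F).
      by apply: measurable_funTS; exact: continuous_measurable_plane.
    - apply/measurable_EFinP; apply: measurable_funX; apply: measurable_funB => //.
      by apply: measurable_funTS; exact: continuous_measurable_plane.
    - by apply: filterS FE => x E Ox; rewrite E.
  apply: (@le_lt_trans _ _ (\int[mu]_(x in Om) (cst d%:E x))%E).
    apply: ge0_le_integral => //.
    - by move=> x _; rewrite lee_fin sqr_ge0.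
    - apply/measurable_EFinP; apply: measurable_funX; apply: measurable_funB => //.
      by apply: measurable_funTS; exact: continuous_measurable_plane.
    move=> x _; rewrite lee_fin -real_normK ?num_real//.
    apply: (@le_trans _ _ (d ^+ 2)); first by apply: lerXn2r; rewrite ?nnegrE ?(ltW d0)//.
    by rewrite expr2 ler_piMl ?(ltW d0)// /d ge_min lexx.
  rewrite integral_cst// -IE -EFinM lte_fin.
  apply: (@le_lt_trans _ _ (e / (2 * (I + 1)) * I)).
    by apply: ler_wpM2r => //; rewrite /d ge_min lexx orbT.
  rewrite mulrAC ltr_pdivrMr ?mulr_gt0//; last lra.
  by rewrite ltr_pM2l//; lra.
have H : \forall x \ae mu, Om x -> ((- 1) *: F + v : L2 R) x = 0.
  apply: fundamental_lemma => // psi tpsi.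
  have cpsi := smooth_continuous (testfun_smooth tpsi).
  rewrite Rintegral_L2_lin//; do ?[exact: L2_testfun_integrable tpsi|exact: measurable_funTS (testfun_measurable tpsi)].
  have A1 := cvg_l2err_pairing mOm Or cphi cpsi Ferr.
  have A2 := cvg_l2err_pairing mOm Or cphi cpsi cv.
  have E (g : L2 R) : \int[mu]_(x in Om) (g x * psi x) = \int[mu]_(x in Om) (psi x * g x).
    by apply: eq_Rintegral => x _; exact: mulrC.
  rewrite !E -(cvg_lim _ A1)// (cvg_lim _ A2)//; ring.
have Hl := L2_lin (- 1) F v.
have H3 : \forall x \ae mu, Om x -> v x = f x.
  apply: filterS3 H Hl FE => x H Hl FE Ox.
  have := H Ox; rewrite Hl FE// mulN1r => /eqP; rewrite addrC subr_eq0 => /eqP -> //.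
apply: filterS2 H3 ov => x H3 ov3.
have [Ox|nO] := pselect (Om x); first exact: H3.
by rewrite f0// ov3.
Qed.

End Sobolev.

(** * Restriction to lines *)

Section TraceExistence.
Context {R : realType}.
Notation pt := (plane R).
Local Notation mu := (leb2 R).
Local Notation leb := (@lebesgue_measure R).

(** Tonelli's theorem for the positive and the negative part. *)
Lemma measurable_section_integral (k : pt -> R) : measurable_fun setT k ->
  measurable_fun setT (fun t : measurableTypeR R => (\int[leb]_s (k (t, s))%:E)%E).
Proof.
move=> mk; have mE : measurable_fun setT (EFin \o k) by exact/measurable_EFinP.
have mp := measurable_funepos mE; have mn := measurable_funeneg mE.
have mF1 := @measurable_fun_fubini_tonelli_F _ _ _ _ R leb (EFin \o k)^\+%E mp (@funepos_ge0 _ _ _).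
have mF2 := @measurable_fun_fubini_tonelli_F _ _ _ _ R leb (EFin \o k)^\-%E mn (@funeneg_ge0 _ _ _).
have mB := emeasurable_funB mF1 mF2.
apply: eq_measurable_fun mB => t _ /=.
rewrite [RHS]integralE; congr (_ - _)%E; apply: eq_integral => s _; by rewrite ?funeposE ?funenegE.
Qed.

(** The variance of [f] over an interval is nonnegative. *)
Lemma square_mean_le (f : R -> R) (S : R) : 0 < S -> measurable_fun `[0, S] f ->
  (\int[leb]_(s in `[0%R, S]) ((f s) ^+ 2)%:E < +oo)%E ->
  leb.-integrable `[0, S] (EFin \o f) /\
  (((\int[leb]_(s in `[0, S]) f s) ^+ 2)%:E <= S%:E * \int[leb]_(s in `[0%R, S]) ((f s) ^+ 2)%:E)%E.
Proof.
move=> S0 mf ff.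
have mS : measurable (`[0, S] : set (measurableTypeR R)) by exact: measurable_itv.
have lS : leb (`[0, S] : set R) = S%:E by rewrite lebesgue_measure_itv/= lte_fin S0 sube0.
have lS' : leb (`[0, S] : set (measurableTypeR R)) = S%:E by [].
have i1 : leb.-integrable `[0, S] (EFin \o f).
  have : leb.-integrable (`[0, S] : set (measurableTypeR R)) (fun s => ((1 : R) * f s)%:E).
    apply: integrable_square_mul => //; under eq_integral do rewrite expr1n.
    by rewrite integral_cst// mul1e [X in (X < _)%E]lS' ltry.
  by apply: eq_integrable => // s _; rewrite mul1r.
split=> //; set m := \int[leb]_(s in `[0, S]) f s.
have i2 : leb.-integrable `[0, S] (fun s => ((f s) ^+ 2)%:E).
  have : leb.-integrable (`[0, S] : set (measurableTypeR R)) (fun s => (f s * f s)%:E).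
    exact: integrable_square_mul.
  by apply: eq_integrable => // s _; rewrite expr2.
have ic (c : R) : leb.-integrable (`[0, S] : set (measurableTypeR R)) (EFin \o cst c).
  apply: (@continuous_itv_integrable R (cst c) 0 S); exact: cst_continuous.
have nS : S != 0 by rewrite gt_eqF.
have E : (\int[leb]_(s in `[0%R, S]) (((f s) ^+ 2)%:E) = (\int[leb]_(s in `[0, S]) (f s ^+ 2))%:E)%E.
  by rewrite /Rintegral fineK//; exact: integrable_fin_num.
rewrite E -EFinM lee_fin.
have : 0 <= \int[leb]_(s in `[0, S]) ((f s - m / S) ^+ 2).
  by apply: Rintegral_ge0 => s _; exact: sqr_ge0.
have -> : \int[leb]_(s in `[0, S]) ((f s - m / S) ^+ 2) =
  \int[leb]_(s in `[0, S]) (f s ^+ 2 + ((- (2 * (m / S))) * f s + (m / S) ^+ 2)).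
  by apply: eq_Rintegral => s _; ring.
have i3 : leb.-integrable `[0, S] (EFin \o (fun s => (- (2 * (m / S))) * f s)).
  by have := integrableZl mS (- (2 * (m / S))) i1; apply: eq_integrable.
have i4 : leb.-integrable `[0, S] (EFin \o (fun s => (- (2 * (m / S))) * f s + (m / S) ^+ 2)).
  by have := integrableD mS i3 (ic ((m / S) ^+ 2)); apply: eq_integrable.
rewrite RintegralD// (@RintegralD _ _ _ leb `[0, S] (fun s => (- (2 * (m / S))) * f s) (cst ((m / S) ^+ 2)))//.
rewrite RintegralZl// Rintegral_cst// [X in fine X]lS' /=.
set Q := \int[leb]_(s in _) _ ^+ 2 => H.
have : 0 <= S * (Q + (- (2 * (m / S)) * m + (m / S) ^+ 2 * S)) by rewrite mulr_ge0// ltW.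
have -> : S * (Q + (- (2 * (m / S)) * m + (m / S) ^+ 2 * S)) = S * Q - m ^+ 2 by field.
by rewrite subr_ge0.
Qed.

Lemma gradd_unitv (j : 'I_2) (f : pt -> R) : gradd (unitv j) f = pd j f.
Proof.
apply/funext => x; rewrite /gradd /unitv; case: (altP (j =P ord0)) => [->|j0] /=.
  by rewrite mul1r mul0r addr0.
have -> : j = ord_max by apply: val_inj; case: j j0 => -[|[|]].
by rewrite mul1r mul0r add0r.
Qed.

Variables (Om : set pt) (r : R).
Hypothesis mOm : measurable Om.
Hypothesis Or : Om `<=` box r.

(** A smooth function vanishing outside a bounded set is, on the line, minus
    the integral of its derivative over a transversal segment that leaves the
    set. Mean-square convergence of the derivatives in the plane then gives
    convergence on the line, with the corresponding integral of the limit [h]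
    as the limit: this constructs traces. *)
Lemma line_restriction_cvg (P l : pt) (j : 'I_2) (h : L2 R) (psi : nat -> pt -> R) :
  det2 l (unitv j) != 0 -> L2on Om h -> (forall m, smooth (psi m)) ->
  (forall m x, ~ Om x -> psi m x = 0 /\ pd j (psi m) x = 0) ->
  l2err Om h (pd j (psi m)) @[m --> \oo] --> 0%E ->
  exists2 g : R -> R, measurable_fun (`[0, 1] : set R) g &
   (\int[leb]_(t in `[0%R, 1%R])
           ((g t - psi m (P + t *: l)) ^+ 2)%:E)%E @[m --> \oo] --> 0%E.
Proof.
move=> d0 oh spsi psi0 cv.
(* [S] is so large that the points of the line, moved by [S *: unitv j], leave
   the box. *)
pose S := `|r| + `|Defs.coord j P| + `|Defs.coord j l| + 1.
have S0 : 0 < S by rewrite /S ltr_wpDl// !addr_ge0.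
have far (t : R) : 0 <= t <= 1 -> ~ Om (P + t *: l + S *: unitv j).
  move=> /andP[t0 t1] /Or /boxP[b1 b2].
  have : `|Defs.coord j (P + t *: l + S *: unitv j)| <= r.
    by rewrite /Defs.coord; case: ifP.
  have -> : Defs.coord j (P + t *: l + S *: unitv j) = Defs.coord j P + t * Defs.coord j l + S.
    rewrite !coordD !coordZ coord_unitv eqxx mulr1//.
  have H1 := ler_norm (- Defs.coord j P); have H2 := ler_norm r; rewrite normrN in H1.
  have H3 : - `|Defs.coord j l| <= t * Defs.coord j l.
    have : `|t * Defs.coord j l| <= `|Defs.coord j l| by rewrite normrM ger0_norm// ler_piMl.
    by rewrite ler_norml => /andP[].
  move=> H; have := le_trans (ler_norm _) H; rewrite /S leNgt => /negP; apply.
  move: H1 H2 H3; set a := `|_|; set b := `|_|; set c := `|_|; set e := t * _; move=> H1 H2 H3.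
  by clear -H1 H2 H3; lra.
pose A := affine_map P l (unitv j).
have mA : measurable_fun setT A by exact: measurable_affine_map.
pose H (z : pt) : R := L2fun h (A z).
have mH : measurable_fun setT H by apply: measurableT_comp => //; exact: L2_measurable.
have mS : measurable (`[0, S] : set (measurableTypeR R)) by exact: measurable_itv.
pose k := H \_ (setT `*` `[0, S]).
have mk : measurable_fun setT k.
  have mQ : measurable (setT `*` `[0, S] : set pt) by exact: measurableX.
  by apply/(measurable_restrictT _ mQ); exact: measurable_funTS.
have kE (t : R) : (\int[leb]_s (k (t, s))%:E = \int[leb]_(s in `[0%R, S]) (H (t, s))%:E)%E.
  rewrite [RHS]integral_mkcond; apply: eq_integral => s _; rewrite /k !patchE.
  have -> : ((t, s) \in setT `*` `[0, S]) = (s \in `[0, S]%classic).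
    by apply/idP/idP => /set_mem E; apply/mem_set; [case: E|].
  by case: ifP.
exists (fun t => - fine (\int[leb]_s (k (t, s))%:E)%E).
  apply: measurableT_comp => //; apply: measurable_funTS.
  by apply: measurableT_comp => //; exact: measurable_section_integral.
have mpsi m : measurable_fun setT (pd j (psi m)).
  by apply: continuous_measurable_plane; apply: smooth_continuous; exact: smooth_pd.
pose D m (z : pt) : R := H z - pd j (psi m) (A z).
have mD m : measurable_fun setT (D m).
  by apply: measurable_funB => //; exact: measurableT_comp.
have mDs m (t : R) : measurable_fun setT (fun s : measurableTypeR R => D m (t, s)).
  exact: measurableT_comp (mD m) (measurable_pair1 t).
pose ld := `|det2 l (unitv j)|.
have ld0 : 0 < ld by rewrite normr_gt0.
have DI m : (\int[mu]_z ((D m z) ^+ 2)%:E = (ld^-1)%:E * l2err Om h (pd j (psi m)))%E.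
  have mX : measurable_fun setT (fun x : pt => ((h x - pd j (psi m) x) ^+ 2)%:E).
    have m1 : measurable_fun setT (fun x => h x - pd j (psi m) x).
      exact: measurable_funB (L2_measurable h) (mpsi m).
    by apply/measurable_EFinP; exact: measurable_funX.
  have X0 (x : pt) : (0 <= ((h x - pd j (psi m) x) ^+ 2)%:E)%E by rewrite lee_fin sqr_ge0.
  have L : l2err setT h (pd j (psi m)) = (ld%:E * \int[mu]_z ((D m z) ^+ 2)%:E)%E.
    exact: (@ge0_integral_linear R P l (unitv j) _ d0 mX X0).
  have z0 (x : pt) : ~ Om x -> pd j (psi m) x = 0 by move=> /(psi0 m)[].
  rewrite -(@l2err_supp _ Om setT h _ mOm measurableT (@subsetT _ _) oh (mpsi m) z0) L.
  by rewrite muleA -EFinM mulVf ?mul1e// gt_eqF.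
pose I m (t : R) : \bar R := (\int[leb]_(s in `[0%R, S]) ((D m (t, s)) ^+ 2)%:E)%E.
have ptw m (t : R) : 0 <= t <= 1 ->
  (((- fine (\int[leb]_s (k (t, s))%:E)%E - psi m (P + t *: l)) ^+ 2)%:E <=
    S%:E * \int[leb]_s ((D m (t, s)) ^+ 2)%:E)%E.
  move=> t01.
  have sub : (I m t <= \int[leb]_s ((D m (t, s)) ^+ 2)%:E)%E.
    apply: ge0_subset_integral => //; last by move=> s _; rewrite lee_fin sqr_ge0.
    by apply/measurable_EFinP; exact: measurable_funX.
  apply: (@le_trans _ _ (S%:E * I m t)%E); last first.
    by apply: lee_wpmul2l => //; rewrite lee_fin ltW.
  have [fin|] := ltP (I m t) +oo%E; last first.
    by rewrite leye_eq => /eqP ->; rewrite gt0_muley ?lte_fin// leey.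
  have [iD] := square_mean_le S0 (measurable_funTS (mDs m t)) fin.
  apply: le_trans; rewrite lee_fin.
  have cp : continuous (fun s : R => pd j (psi m) (P + t *: l + s *: unitv j)).
    by apply: continuous_line; apply: smooth_continuous; exact: smooth_pd.
  have ip := @continuous_itv_integrable R _ 0 S cp.
  have iH : leb.-integrable `[0, S] (fun s => (H (t, s))%:E).
    have := integrableD mS iD ip; apply: eq_integrable => // s _ /=.
    by rewrite -EFinD /D /A affine_mapE subrK.
  have -> : psi m (P + t *: l) = - \int[leb]_(s in `[0, S]) pd j (psi m) (P + t *: l + s *: unitv j).
    rewrite -gradd_unitv FTC_line ?ltW// scale0r addr0.
    by rewrite (psi0 m _ (far t t01)).1 sub0r opprK.
  have E2 : \int[leb]_(s in `[0, S]) (H (t, s)) - \int[leb]_(s in `[0, S]) pd j (psi m) (P + t *: l + s *: unitv j) =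
      \int[leb]_(s in `[0, S]) D m (t, s).
    by rewrite -RintegralB//; apply: eq_Rintegral => s _; rewrite /D /A affine_mapE.
  rewrite -E2 kE -/(Rintegral _ _ _) opprK addrC -opprB sqrrN.
  exact: lexx.
have mD2 m : measurable_fun setT (fun z : pt => ((D m z) ^+ 2)%:E).
  by apply/measurable_EFinP; exact: measurable_funX.
have D20 m (z : pt) : (0 <= ((D m z) ^+ 2)%:E)%E by rewrite lee_fin sqr_ge0.
apply: cvge0P; first by move=> m; exact: ge0_square_int.
move=> e e0; have := cvge0_lt cv (mulr_gt0 e0 (divr_gt0 ld0 S0)).
apply: filterS => m Hm.
have mG : measurable_fun setT (fun t : measurableTypeR R => \int[leb]_s ((D m (t, s)) ^+ 2)%:E)%E.
  exact: (@measurable_fun_fubini_tonelli_F _ _ _ _ R leb (fun z : pt => ((D m z) ^+ 2)%:E)).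
have G0 (t : R) : (0 <= \int[leb]_s ((D m (t, s)) ^+ 2)%:E)%E by exact: integral_ge0.
apply: (@le_lt_trans _ _ (\int[leb]_(t in `[0%R, 1%R]) (S%:E * \int[leb]_s ((D m (t, s)) ^+ 2)%:E))%E).
  apply: ge0_le_integral => //.
  - by move=> t _; rewrite lee_fin sqr_ge0.
  - apply/measurable_EFinP; apply: measurable_funX; apply: measurable_funTS; apply: measurable_funB.
      by apply: measurableT_comp => //; apply: measurableT_comp => //; exact: measurable_section_integral.
    by apply: continuous_measurable_fun; apply: continuous_line; exact: smooth_continuous.
  - by apply: measurable_funTS; exact: measurable_funeM.
  - by move=> t; rewrite /= in_itv /= => /ptw; apply.
apply: (@le_lt_trans _ _ (S%:E * \int[leb]_t \int[leb]_s ((D m (t, s)) ^+ 2)%:E)%E).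
  rewrite ge0_integralZl//; [|exact: measurable_funTS|by rewrite lee_fin ltW].
  apply: lee_wpmul2l; first by rewrite lee_fin ltW.
  exact: ge0_subset_integral.
rewrite -(@fubini_tonelli1 _ _ _ _ R leb leb (fun z : pt => ((D m z) ^+ 2)%:E))// DI.
have Sl : 0 < S * ld^-1 by rewrite mulr_gt0// invr_gt0.
rewrite muleA -EFinM -lte_pdivlMl//.
apply: (lt_le_trans Hm); rewrite -EFinM lee_fin.
by rewrite invfM invrK mulrC [ld / S]mulrC.
Qed.

End TraceExistence.

(** * Point values and piecewise polynomials *)

Section PointValues.
Context {R : realType}.
Notation pt := (plane R).
Local Notation mu := (leb2 R).
Local Notation leb := (@lebesgue_measure R).

Lemma open_ae_point (W : set pt) (x0 : pt) (Q : pt -> Prop) : open W -> W x0 ->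
  (\forall x \ae mu, Q x) -> exists2 x, W x & Q x.
Proof.
move=> oW Wx [N [mN N0 HN]]; apply: contrapT => nex.
have [a [b [c [d [/rectP[/andP[ax xb] /andP[cx xd]] sub]]]]] := in_rat_rect oW Wx.
have WN : `[ratr a, ratr b] `*` `[ratr c, ratr d] `<=` N.
  by move=> x /sub Wx'; apply: HN => Qx; apply: nex; exists x.
have mab : measurable (`[ratr a, ratr b] : set (measurableTypeR R)) by exact: measurable_itv.
have mcd : measurable (`[ratr c, ratr d] : set (measurableTypeR R)) by exact: measurable_itv.
have : (mu (`[ratr a, ratr b] `*` `[ratr c, ratr d]) <= 0)%E.
  by rewrite -N0; apply: le_measure; rewrite ?inE//; exact: measurableX.
have -> : mu (`[ratr a, ratr b] `*` `[ratr c, ratr d]) =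
    (leb (`[ratr a, ratr b] : set (measurableTypeR R)) * leb (`[ratr c, ratr d] : set (measurableTypeR R)))%E.
  exact: product_measure1E.
have lab : leb (`[ratr a, ratr b] : set (measurableTypeR R)) = (ratr b - ratr a)%:E.
  by have := @lebesgue_measure_itv R `[ratr a, ratr b]; rewrite /= lte_fin (lt_trans ax xb) -EFinD.
have lcd : leb (`[ratr c, ratr d] : set (measurableTypeR R)) = (ratr d - ratr c)%:E.
  by have := @lebesgue_measure_itv R `[ratr c, ratr d]; rewrite /= lte_fin (lt_trans cx xd) -EFinD.
apply/negP; rewrite -ltNge lab lcd -EFinM lte_fin.
by rewrite mulr_gt0// subr_gt0; [exact: lt_trans ax xb|exact: lt_trans cx xd].
Qed.

(** Move from [z] a little towards the centroid. *)
Lemma itri_dense (A B C z : pt) (U : set pt) : det2 (B - A) (C - A) != 0 ->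
  tri A B C z -> nbhs z U -> itri A B C `&` U° !=set0.
Proof.
move=> d0 [zB zC zBC] Uz.
pose c0 := affine_map A (B - A) (C - A) (3^-1, 3^-1); pose v := c0 - z.
have [cB cC] := bary_affine d0 (3^-1, 3^-1); rewrite -/c0 /= in cB cC.
have zv : c0 = z + 1 *: v by rewrite scale1r /v addrC subrK.
have vB : det2 v (C - A) / det2 (B - A) (C - A) = 3^-1 - baryB A B C z.
  by apply/esym/eqP; rewrite subr_eq addrC -cB zv baryB_line mul1r.
have vC : det2 (B - A) v / det2 (B - A) (C - A) = 3^-1 - baryC A B C z.
  by apply/esym/eqP; rewrite subr_eq addrC -cC zv baryC_line mul1r.
have cl : (fun t : R => z + t *: v) @ 0 --> z + 0 *: v.
  by apply: cvgD; [exact: cvg_cst|exact: scalel_continuous].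
have : nbhs (z + 0 *: v) U° by rewrite scale0r addr0; exact: nbhs_interior.
move/cl => /nbhs_ballP[e /= e0 He].
pose s := Num.min 2^-1 (e / 2).
have s0 : 0 < s by rewrite lt_min invr_gt0 ltr0n divr_gt0.
have s1 : s < 1 by rewrite gt_min invf_lt1// ltr1n.
exists (z + s *: v); split.
  have third (b t : R) : 0 <= b -> 0 < t -> t < 1 -> 0 < b + t * (3^-1 - b) by move=> *; nra.
  rewrite /itri /= baryB_line baryC_line vB vC; split; [exact: third|exact: third|].
  move: zBC s0 s1; set b := baryB _ _ _ _; set c := baryC _ _ _ _.
  clear; move=> ? ? ?; nra.
apply: He; rewrite /ball /= sub0r normrN gtr0_norm//.
by rewrite gt_min [e / 2 < e]ltr_pdivrMr ?ltr_pMr ?ltr1n ?orbT.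
Qed.

(** Two continuous representatives that agree almost everywhere on [S] agree
    at [z], because every neighbourhood of a point of a triangle meets the
    open triangle in a set of positive measure. *)
Lemma ptval_tri (A B C z : pt) (S : set pt) (v : L2 R) (f : pt -> R) :
  det2 (B - A) (C - A) != 0 -> tri A B C `<=` S -> tri A B C z ->
  continuous f -> (\forall x \ae mu, S x -> v x = f x) -> ptval S v z = f z.
Proof.
move=> d0 TS Tz cf vf; apply: xget_unique.
  by exists f; split => //; exact: continuous_subspaceT.
move=> y [g [cg vg ->]]; apply: contrapT => /eqP gf.
pose e := `|g z - f z| / 2; have e0 : 0 < e by rewrite divr_gt0// normr_gt0 subr_eq0.
have Sz := TS z Tz.
have /cvgrPdist_lt /(_ e e0) fe := cf z.
have ge : nbhs z (fun x => S x -> `|g z - g x| < e).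
  have /cvgrPdist_lt /(_ e e0) H := cg z.
  have H' : nbhs (z : subspace S) (fun x => `|g z - g x| < e) by exact: H.
  suff : within S (nbhs z) (fun x => `|g z - g x| < e) by [].
  by rewrite nbhs_subspace_in.
have [x0 [ix0 Ux0]] := itri_dense d0 Tz (filterI fe ge).
have oW : open (itri A B C `&` [set x | `|f z - f x| < e /\ (S x -> `|g z - g x| < e)]°).
  by apply: openI; [exact: open_itri|exact: open_interior].
have H : \forall x \ae mu, S x -> v x = f x /\ v x = g x.
  by apply: filterS2 vf vg => x E1 E2 Sx; split; [exact: E1|exact: E2].
have [x [ix /interior_subset[fx gx]] Hx] := open_ae_point oW (conj ix0 Ux0) H.
have Sx : S x by apply: TS; exact: itri_sub.
have [E1 E2] := Hx Sx; have {}gx := gx Sx; rewrite -E2 E1 in gx.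
have : `|g z - f z| < e + e.
  have -> : g z - f z = (g z - f x) - (f z - f x) by ring.
  by apply: le_lt_trans (ler_normB _ _) _; exact: ltrD.
by rewrite /e -splitr ltxx.
Qed.

(** Polynomials of degree at most [k], described by their derivatives of order
    [k] being constant. The description is closed under differentiation, and
    constant Hessians and affine gradients are immediate from it. *)
Fixpoint poly_le (k : nat) (f : pt -> R) : Prop :=
  if k is k'.+1 then smooth f /\ forall i, poly_le k' (pd i f)
  else exists c, f = cst c.

Lemma poly_le_smooth k f : poly_le k f -> smooth f.
Proof. by case: k => [[c ->]|k []//]; exact: smooth_cst. Qed.

Lemma poly_le_cst k c : poly_le k (cst c).
Proof.
elim: k c => [|k IH] c; first by exists c.
by split=> [|i]; [exact: smooth_cst|rewrite pd_cst; exact: IH].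
Qed.

Lemma poly_leW k f : poly_le k f -> poly_le k.+1 f.
Proof.
elim: k f => [|k IH] f; first by move=> [c ->]; exact: poly_le_cst.
by move=> [sf H]; split=> // i; apply: IH; exact: H.
Qed.

Lemma poly_le_mon m k f : (m <= k)%N -> poly_le m f -> poly_le k f.
Proof.
move=> mk mf; rewrite -(subnKC mk); elim: (k - m)%N => [|d IH]; first by rewrite addn0.
by rewrite addnS; exact: poly_leW.
Qed.

Lemma poly_leD k f g : poly_le k f -> poly_le k g -> poly_le k (f + g).
Proof.
elim: k f g => [|k IH] f g.
  by move=> [c ->] [d ->]; exists (c + d).
move=> [sf Hf] [sg Hg]; split; first exact: smoothD.
move=> i; rewrite pdD; [by apply: IH; [exact: Hf|exact: Hg]|by move=> x; exact: smooth_derivable..].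
Qed.

Lemma smooth_coord i : smooth (@Defs.coord R i).
Proof.
have -> : @Defs.coord R i = fun x => Defs.coord i x ^+ 1 by apply/funext => x; rewrite expr1.
exact: smooth_coordX.
Qed.

Lemma pd_coord i j : pd j (@Defs.coord R i) = cst (i == j)%:R.
Proof.
apply/funext => x; have H := @is_derive_lift R id (cst 1) i j 1 0 x (fun t => is_derive_id t 1).
have E : (fun y : pt => id (1 * Defs.coord i y + 0)) = @Defs.coord R i.
  by apply/funext => y; rewrite mul1r addr0.
by rewrite E in H; have := @derive_val _ _ _ _ _ _ _ H; rewrite !mulr1.
Qed.

Lemma poly_leZ k c f : poly_le k f -> poly_le k (cst c * f).
Proof.
elim: k f => [|k IH] f; first by move=> [d ->]; exists (c * d).
move=> [sf H]; split; first by apply: smoothM => //; exact: smooth_cst.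
move=> i; rewrite pdM; last 2 first.
- by move=> x; apply: smooth_derivable; exact: smooth_cst.
- by move=> x; exact: smooth_derivable.
rewrite pd_cst; rewrite (_ : cst 0 * f = cst 0); last first.
  by apply/funext => x; rewrite -[LHS]/(0 * f x) mul0r.
apply: poly_leD; [exact: poly_le_cst|by apply: IH; exact: H].
Qed.

(** By Leibniz, a derivative of the product is the sum of a constant multiple
    of [f] and of the coordinate times a derivative of [f], whose degree is
    smaller by one. *)
Lemma poly_le_coordM k i f : poly_le k f -> poly_le k.+1 (@Defs.coord R i * f).
Proof.
elim: k f => [|k IH] f Hf; have sf := poly_le_smooth Hf.
all: split; first by apply: smoothM => //; exact: smooth_coord.
all: move=> j; rewrite pdM ?pd_coord;
  [|by move=> x; apply: smooth_derivable; exact: smooth_coord|by move=> x; exact: smooth_derivable].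
  move: Hf => [c ->]; rewrite pd_cst; exists ((i == j)%:R * c).
  by apply/funext => x; rewrite -[LHS]/((i == j)%:R * c + Defs.coord i x * 0) mulr0 addr0.
by apply: poly_leD; [exact: poly_leZ|apply: IH; exact: Hf.2].
Qed.

Lemma poly_le_sum k (I : Type) (s : seq I) (Q : pred I) (F : I -> pt -> R) :
  (forall i, Q i -> poly_le k (F i)) -> poly_le k (fun x => \sum_(i <- s | Q i) F i x).
Proof.
move=> HF; have -> : (fun x => \sum_(i <- s | Q i) F i x) = \sum_(i <- s | Q i) F i.
  by apply/funext => x; rewrite fct_sumE.
apply: (big_ind (poly_le k)) => //; last by move=> f g; exact: poly_leD.
exact: (poly_le_cst k 0).
Qed.

Lemma poly2_le k f : poly2 k f -> poly_le k f.
Proof.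
move=> [c fE]; rewrite (_ : f = fun x => \sum_(i < k.+1) \sum_(j < k.+1 | (i + j <= k)%N)
            c i j * Defs.coord ord0 x ^+ i * Defs.coord ord_max x ^+ j); last exact/funext.
apply: poly_le_sum => i _; apply: poly_le_sum => j ij.
apply: (poly_le_mon ij).
rewrite (_ : (fun x => _) = cst (c i j) * (fun x : pt => Defs.coord ord0 x ^+ i * Defs.coord ord_max x ^+ j)); last first.
  by apply/funext => x; rewrite -mulrA.
apply: poly_leZ; elim: (nat_of_ord i) => [|a IH].
  rewrite add0n; elim: (nat_of_ord j) => [|b IH].
    by exists 1; apply/funext => x; rewrite !expr0 mulr1.
  rewrite (_ : (fun x => _) = @Defs.coord R ord_max * (fun x : pt => Defs.coord ord0 x ^+ 0 * Defs.coord ord_max x ^+ b)).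
    exact: poly_le_coordM.
  by apply/funext => x; rewrite -[RHS]/(_ * (_ * _)) !expr0 !mul1r exprS.
rewrite addSn (_ : (fun x => _) = @Defs.coord R ord0 * (fun x : pt => Defs.coord ord0 x ^+ a * Defs.coord ord_max x ^+ j)).
  exact: poly_le_coordM.
by apply/funext => x; rewrite -[RHS]/(_ * (_ * _)) exprS mulrA.
Qed.

Lemma quadratic_hessian f : poly_le 2%N f -> exists c : 'I_2 -> 'I_2 -> R,
  forall i j, pd j (pd i f) = cst (c i j).
Proof.
move=> [_ H].
have H2 (ij : 'I_2 * 'I_2) : exists c, pd ij.2 (pd ij.1 f) = cst c.
  by have [_ /(_ ij.2)[c E]] := H ij.1; exists c.
have [c Hc] := boolp.choice H2.
by exists (fun i j => c (i, j)) => i j; exact: (Hc (i, j)).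
Qed.

(** The mean of an affine function over a segment does not change under
    reversal, and the sum of its values at two mirror points is constant. *)
Lemma seg_avg_affine f P Q : poly_le 1%N f -> seg_avg f P Q = f (2^-1 *: (P + Q)).
Proof.
move=> [sf H]; have [c Hc] := boolp.choice H.
pose d := (Q - P).1 * c ord0 + (Q - P).2 * c ord_max.
have lin (t : R) : f (P + t *: (Q - P)) = f P + d * t.
  have dv x := C1_derive x (Q - P) (sf 1%N).
  have [s _ E] := @mean_value _ f (Q - P) P t (fun x => @ex_derive _ _ _ _ _ _ _ (dv x)).
  have E2 := @derive_val _ _ _ _ _ _ _ (dv (P + (s * t) *: (Q - P))).
  rewrite E2 /gradd !Hc /= -/d in E.
  by rewrite -[LHS](subrK (f P)) E addrC mulrC.
have mean2 : seg_avg f P Q + seg_avg f Q P = 2 * f P + d.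
  have cf := smooth_continuous sf.
  have cl := @continuous_line _ f P (Q - P) cf; have cl' := @continuous_line _ f Q (P - Q) cf.
  rewrite /seg_avg -RintegralD//; [|exact: continuous_itv_integrable..].
  rewrite (_ : \int[leb]_(t in _) _ = \int[leb]_(t in `[0%R, 1%R]) cst (2 * f P + d) t).
    rewrite Rintegral_cst//; have := @lebesgue_measure_itv R `[0%R, 1%R]; rewrite /= lte_fin ltr01 sube0 => ->.
    by rewrite mulr1.
  apply: eq_Rintegral => t _; rewrite lin.
  have -> : Q + t *: (P - Q) = P + (1 - t) *: (Q - P) by apply: plane_eq; rewrite /= /GRing.scale /=; ring.
  by rewrite lin /cst; ring.
have -> : 2^-1 *: (P + Q) = P + 2^-1 *: (Q - P) by apply: plane_eq; rewrite /= /GRing.scale /=; field.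
rewrite lin; move: mean2; rewrite -[seg_avg f Q P]seg_avg_sym; last exact: smooth_continuous.
by move=> m2; lra.
Qed.

End PointValues.

(** * Vertex values and normal fluxes determine the mean Hessian *)

(** For a unit vector [(a, b)] orthogonal to [(c, d)], the square of the
    determinant is [c * c + d * d]. *)
Lemma dual_frame (R : realFieldType) (a b c d x y : R) :
  a * a + b * b = 1 -> a * c + b * d = 0 -> (c != 0) || (d != 0) ->
  a * x + b * y = 0 -> c * x + d * y = 0 -> x = 0 /\ y = 0.
Proof.
move=> n1 n0 cd ex ey; pose D := a * d - b * c.
have D0 : D != 0.
  have DD : D * D = c * c + d * d.
    have -> : D * D = (a * a + b * b) * (c * c + d * d) - (a * c + b * d) * (a * c + b * d) by rewrite /D; ring.
    by rewrite n1 n0 mul1r mul0r subr0.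
  apply/eqP => D0; move/eqP: DD; rewrite D0 mul0r eq_sym paddr_eq0; [|by rewrite -expr2 sqr_ge0..].
  by rewrite !mulf_eq0 !orbb => /andP[/eqP c0 /eqP d0]; move: cd; rewrite c0 d0 eqxx.
have xD : x * D = 0.
  have -> : x * D = d * (a * x + b * y) - b * (c * x + d * y) by rewrite /D; ring.
  by rewrite ex ey !mulr0 subrr.
have yD : y * D = 0.
  have -> : y * D = a * (c * x + d * y) - c * (a * x + b * y) by rewrite /D; ring.
  by rewrite ex ey !mulr0 subrr.
by split; apply/eqP; [move/eqP: xD|move/eqP: yD]; rewrite mulf_eq0 (negbTE D0) orbF.
Qed.

Lemma Rintegral_comb (R : realType) (c : 'I_2 -> R) (t : 'I_2 -> R -> R) :
  (forall i, (@lebesgue_measure R).-integrable `[0, 1] (EFin \o t i)) ->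
  \int[lebesgue_measure]_(x in `[0, 1]) (\sum_(i < 2) c i * t i x) =
  \sum_(i < 2) c i * \int[lebesgue_measure]_(x in `[0, 1]) t i x.
Proof.
move=> it.
have m01 : measurable (`[0, 1] : set (measurableTypeR R)) by exact: measurable_itv.
have iz i : (@lebesgue_measure R).-integrable `[0, 1] (EFin \o (fun x => c i * t i x)).
  by have := integrableZl m01 (c i) (it i); apply: eq_integrable.
rewrite big_ord_recl big_ord1; under eq_Rintegral do rewrite big_ord_recl big_ord1.
rewrite RintegralD//; [|exact: iz..].
by rewrite !RintegralZl//; exact: it.
Qed.

Lemma scaled_diff_lim (R : realType) (D S T X X' : R) (s t s' t' : nat -> R) :
  s m @[m --> \oo] --> S -> t m @[m --> \oo] --> T ->
  s' m @[m --> \oo] --> S -> t' m @[m --> \oo] --> T ->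
  D * (s m - t m) @[m --> \oo] --> X -> D * (s' m - t' m) @[m --> \oo] --> X' -> X = X'.
Proof.
move=> cs ct cs' ct' cX cX'.
have c1 : D * (s m - t m) @[m --> \oo] --> D * (S - T) by apply: cvgM; [exact: cvg_cst|exact: cvgB].
have c2 : D * (s' m - t' m) @[m --> \oo] --> D * (S - T) by apply: cvgM; [exact: cvg_cst|exact: cvgB].
by rewrite -(cvg_lim _ cX)// -(cvg_lim _ cX')// (cvg_lim _ c1)// (cvg_lim _ c2).
Qed.

Lemma seg_avg_cvg_sym (R : realType) (psi : nat -> plane R -> R) (P Q : plane R) (T : R) :
  (forall m, smooth (psi m)) -> seg_avg (psi m) P Q @[m --> \oo] --> T ->
  seg_avg (psi m) Q P @[m --> \oo] --> T.
Proof.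
move=> spsi; have -> // : (fun m => seg_avg (psi m) P Q) = (fun m => seg_avg (psi m) Q P).
by apply/funext => m; apply: seg_avg_sym; exact: smooth_continuous.
Qed.

Lemma frame_solve (R : realType) (l m : plane R) (X X' : 'I_2 -> R) : det2 l m != 0 ->
  \sum_(j < 2) Defs.coord j l * X j = \sum_(j < 2) Defs.coord j l * X' j ->
  \sum_(j < 2) Defs.coord j m * X j = \sum_(j < 2) Defs.coord j m * X' j ->
  forall j, X j = X' j.
Proof.
move=> d0; have lmax : lift ord0 ord0 = ord_max :> 'I_2 by exact: val_inj.
rewrite !big_ord_recl !big_ord0 !lmax !addr0 /Defs.coord /= => el em.
have x0 : det2 l m * (X ord0 - X' ord0) = 0.
  have -> : det2 l m * (X ord0 - X' ord0) =
    m.2 * (l.1 * X ord0 + l.2 * X ord_max - (l.1 * X' ord0 + l.2 * X' ord_max)) -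
    l.2 * (m.1 * X ord0 + m.2 * X ord_max - (m.1 * X' ord0 + m.2 * X' ord_max)) by rewrite /det2; ring.
  by rewrite el em !subrr !mulr0 subrr.
have x1 : det2 l m * (X ord_max - X' ord_max) = 0.
  have -> : det2 l m * (X ord_max - X' ord_max) =
    l.1 * (m.1 * X ord0 + m.2 * X ord_max - (m.1 * X' ord0 + m.2 * X' ord_max)) -
    m.1 * (l.1 * X ord0 + l.2 * X ord_max - (l.1 * X' ord0 + l.2 * X' ord_max)) by rewrite /det2; ring.
  by rewrite el em !subrr !mulr0 subrr.
move=> j; have [->|->] : j = ord0 \/ j = ord_max.
  by case: j => [[|[|//]] ?]; [left|right]; exact: val_inj.
  by move/eqP: x0; rewrite mulf_eq0 (negbTE d0) subr_eq0 => /eqP.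
by move/eqP: x1; rewrite mulf_eq0 (negbTE d0) subr_eq0 => /eqP.
Qed.

Section LocalData.
Context {R : realType} (Om : set (plane R)) {n : nat} (p : 'I_n -> plane R)
  (TT : {set {set 'I_n}}) (nu : {set 'I_n} -> plane R).
Notation pt := (plane R).
Local Notation mu := (leb2 R).
Local Notation leb := (@lebesgue_measure R).
Notation "K ^t" := ((hull p K)°) (at level 2, format "K ^t").
Hypothesis dom : polygonal_lipschitz_domain Om.
Hypothesis tr : triangulation Om p TT.
Hypothesis nuP : unit_normals p TT nu.
Let oOm : open Om. Proof. exact: open_Om. Qed.
Let mOm : measurable Om. Proof. exact: measurable_Om. Qed.

(** What elements of H^2_0, approximated by test functions, and piecewise
    polynomials, approximated by a constant sequence, have in common; it
    suffices for comparing two functions on one triangle. *)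
Definition H2lim K (v : L2 R) (phi : nat -> pt -> R) (f : pt -> R) :=
  [/\ forall m, smooth (phi m),
      forall i, H1approx K^t (wderiv K^t i v) (fun m => pd i (phi m)),
      forall z, phi m (p z) @[m --> \oo] --> f (p z)
    & forall i P Q, P != Q ->
      is_trace K^t P Q (wderiv K^t i v) (trace K^t P Q (wderiv K^t i v))].

Lemma hull_interior_ae K : K \in TT -> \forall x \ae mu, hull p K x -> K^t x.
Proof.
move=> /(triangleP tr)[i [j [k [-> d0]]]].
by have := hull_ae d0; apply: filterS => x H /H[].
Qed.

Lemma hull_in_box K : K \in TT -> exists r, hull p K `<=` box r.
Proof.
move=> /(triangleP tr)[i [j [k [-> d0]]]]; rewrite hull_tri//.
by have [r Hr] := tri_box d0; exists r.
Qed.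

(** One sequence of test functions and one continuous representative serve all
    triangles. This is what makes the vertex values and normal fluxes of an
    element of [V] the same from all sides. *)
Lemma V_H2lim v : V Om v -> exists phi f,
  [/\ continuous f, forall x, ~ Om x -> f x = 0, \forall x \ae mu, v x = f x,
      forall m, testfun Om (phi m) & forall K, K \in TT -> H2lim K v phi f].
Proof.
move=> [ov Hv [phi Hphi]].
have Hphi' : H20approx Om v phi by [].
have [f [cf f0 phif vf]] := H20_continuous dom ov Hv Hphi'.
have [tphi _ _ c2] := Hphi.
exists phi, f; split=> // K KT; split=> //.
- by move=> m; exact: testfun_smooth (tphi m).
- by move=> i; exact: (H20approx_H1approx dom tr i Hv Hphi' KT).
move=> i P Q PQ; apply: xgetPex.
have [r Or] := Om_box dom.
have [j dj] : exists j, det2 (Q - P) (unitv j) != 0.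
  have : Q - P != 0 by rewrite subr_eq0 eq_sym.
  have [l1|l1 l0] := eqVneq (Q - P).1 0; last first.
    by exists ord_max; rewrite /det2 /= mulr1 mulr0 subr0.
  move=> l0; exists ord0; rewrite /det2 /= mulr0 mulr1 sub0r oppr_eq0.
  by apply: contraNneq l0 => l2; apply/eqP; apply: plane_eq.
have [||||g mg cg] := @line_restriction_cvg R Om r mOm Or P (Q - P) j
  (wderiv Om j (wderiv Om i v)) (fun m => pd i (phi m)) dj.
- by have [] := wderivP j (Hv.2 i).
- by move=> m; apply: smooth_pd; exact: testfun_smooth (tphi m).
- by move=> m x nO; split; [exact: testfun_pd_out (tphi m) nO|exact: testfun_pd_out (testfun_pd i (tphi m)) nO].
- exact: c2.
exists g; split=> //; exists (fun m => pd i (phi m)).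
by have [s1 s2 s3] := H20approx_H1approx dom tr i Hv Hphi' KT.
Qed.

Lemma l2err_ae0 (W : set pt) (w : L2 R) (k : pt -> R) : measurable W -> continuous k ->
  (\forall x \ae mu, W x -> w x = k x) -> l2err W w k = 0%E.
Proof.
move=> mW ck wk; transitivity (\int[mu]_(x in W) cst 0 x)%E; last exact: integral0.
apply: ae_eq_integral => //.
- have m1 : measurable_fun W (fun x => w x - k x).
    by apply: measurable_funB; apply: measurable_funTS; [exact: L2_measurable|exact: continuous_measurable_plane].
  by apply/measurable_EFinP; exact: measurable_funX.
- by apply: filterS wk => x E Wx; rewrite E// subrr expr0n.
Qed.

Lemma poly_wderiv K (v : L2 R) (q : pt -> R) i : K \in TT -> smooth q ->
  (\forall x \ae mu, hull p K x -> v x = q x) ->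
  \forall x \ae mu, hull p K x -> wderiv K^t i v x = pd i q x.
Proof.
move=> KT sq vq; have [r Kr] := hull_in_box KT.
have vq' : \forall x \ae mu, K^t x -> v x = q x.
  by apply: filterS vq => x H /interior_subset; exact: H.
have Kr' : K^t `<=` box r by apply: subset_trans Kr; exact: interior_subset.
have [_ H] := smooth_wderiv i (open_interior _) Kr' sq vq'.
have Hi := hull_interior_ae KT.
by apply: filterS2 H Hi => x H Hi /Hi; exact: H.
Qed.

Lemma poly_wderiv2 K (v : L2 R) (q : pt -> R) i j : K \in TT -> smooth q ->
  (\forall x \ae mu, hull p K x -> v x = q x) ->
  \forall x \ae mu, K^t x -> wderiv K^t j (wderiv K^t i v) x = pd j (pd i q) x.
Proof.
move=> KT sq vq; have [r Kr] := hull_in_box KT.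
have vq' : \forall x \ae mu, K^t x -> v x = q x.
  by apply: filterS vq => x H /interior_subset; exact: H.
have Kr' : K^t `<=` box r by apply: subset_trans Kr; exact: interior_subset.
exact: smooth_wderiv2 (open_interior _) Kr' sq vq'.
Qed.

Lemma poly_H2lim K (v : L2 R) (q : pt -> R) : K \in TT -> smooth q ->
  (\forall x \ae mu, hull p K x -> v x = q x) -> H2lim K v (fun=> q) q.
Proof.
move=> KT sq vq; have mK := measurable_interiorK p K.
have w1 i : \forall x \ae mu, K^t x -> wderiv K^t i v x = pd i q x.
  have := poly_wderiv i KT sq vq; apply: filterS => x H /interior_subset; exact: H.
have e1 i : l2err K^t (wderiv K^t i v) (pd i q) = 0%E.
  by apply: l2err_ae0 (w1 i) => //; apply: smooth_continuous; exact: smooth_pd.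
have e2 i j : l2err K^t (wderiv K^t j (wderiv K^t i v)) (pd j (pd i q)) = 0%E.
  apply: l2err_ae0 (poly_wderiv2 i j KT sq vq) => //.
  by apply: smooth_continuous; do 2 apply: smooth_pd.
split=> //.
- move=> i; split.
  + by move=> _; exact: smooth_pd.
  + by rewrite e1; exact: cvg_cst.
  + by move=> j; rewrite e2; exact: cvg_cst.
- by move=> z; exact: cvg_cst.
move=> i P Q PQ; apply: xgetPex; exists (fun t => pd i q (P + t *: (Q - P))); split.
  apply: measurable_funTS; apply: continuous_measurable_fun; apply: continuous_line.
  by apply: smooth_continuous; exact: smooth_pd.
exists (fun=> pd i q); split.
- by move=> _; exact: smooth_pd.
- by rewrite e1; exact: cvg_cst.
- by move=> j; rewrite e2; exact: cvg_cst.
- rewrite (_ : (fun=> _) = cst 0%E); first exact: cvg_cst.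
  apply/funext => m /=; rewrite integral0_eq// => t _; by rewrite subrr expr0n.
Qed.

Lemma third_vertex K x y : K \in TT -> x \in K -> y \in K -> x != y ->
  exists z, K = [set z; x; y]%SET /\ det2 (p x - p z) (p y - p z) != 0.
Proof.
move=> /(triangleP tr)[i [j [k [-> d0]]]].
have rot a b c : det2 (p b - p a) (p c - p a) != 0 -> det2 (p c - p b) (p a - p b) != 0.
  by congr (_ != 0); rewrite /det2 /=; ring.
have swp a b c : det2 (p b - p a) (p c - p a) != 0 -> det2 (p c - p a) (p b - p a) != 0.
  by rewrite -oppr_eq0; congr (_ != 0); rewrite /det2 /=; ring.
have set3 (a b c a' b' c' : 'I_n) : (forall w, (w == a) || (w == b) || (w == c) = ((w == a') || (w == b') || (w == c'))) ->
    [set a; b; c]%SET = [set a'; b'; c']%SET.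
  by move=> H; apply/setP => w; rewrite !inE.
rewrite !inE => /orP[/orP[]|] /eqP-> /orP[/orP[]|] /eqP->; rewrite ?eqxx// => _.
- exists k; split; last by apply: (rot j k i); apply: (rot i j k).
  by apply: set3 => w; case: (w == i); case: (w == j); case: (w == k).
- exists j; split; last by apply: (swp j k i); apply: (rot i j k).
  by apply: set3 => w; case: (w == i); case: (w == j); case: (w == k).
- exists k; split; last by apply: (swp k i j); apply: (rot j k i); apply: (rot i j k).
  by apply: set3 => w; case: (w == i); case: (w == j); case: (w == k).
- by exists i.
- exists j; split; last by apply: (rot i j k).
  by apply: set3 => w; case: (w == i); case: (w == j); case: (w == k).
- exists i; split; last by apply: (swp i j k).
  by apply: set3 => w; case: (w == i); case: (w == j); case: (w == k).
Qed.

Lemma edge_ends E : E \in edges TT -> exists a b,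
  [/\ a != b, E = [set a; b]%SET, edge_a p E = p a & edge_b p E = p b].
Proof.
rewrite inE => /andP[/eqP E2 _]; have := enum_uniq E.
have : size (enum E) = 2%N by rewrite -cardE.
case EE : (enum E) => [|a [|b []]]//= _; rewrite inE andbT => ab.
exists a, b; rewrite /edge_a /edge_b EE; split=> //.
by apply/setP => z; rewrite !inE -(mem_enum E) EE !inE.
Qed.

(** The integral of a trace over an edge is the limit of the edge means of the
    approximating functions, for any trace, so that the choice made in [flux]
    is immaterial. *)
Lemma flux_lim K E v phi f : K \in TT -> E \in edges TT -> E \subset K -> H2lim K v phi f ->
  exists T : 'I_2 -> R,
   (forall i, seg_avg (pd i (phi m)) (edge_a p E) (edge_b p E) @[m --> \oo] --> T i) /\
   flux p nu K E v = enorm (edge_b p E - edge_a p E) * \sum_(i < 2) Defs.coord i (nu E) * T i.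
Proof.
move=> KT EE EK [sphi Hw _ Htr]; have [a [b [ab Eab ea eb]]] := edge_ends EE.
have aK : a \in K by apply: (fintype.subsetP EK); rewrite Eab !inE eqxx.
have bK : b \in K by apply: (fintype.subsetP EK); rewrite Eab !inE eqxx orbT.
have [z [KE d0]] := third_vertex KT aK bK ab.
have i1 : itri (p z) (p a) (p b) `<=` K^t by rewrite KE; exact: itri_interior.
have i2 : K^t `<=` tri (p z) (p a) (p b) by rewrite KE; exact: interior_tri.
have pab : p a != p b by apply: contra_neq ab => E0; case: tr => inj _ _ _ _; exact: inj.
exists (fun i => edge_mean K^t (p z) (p a) (p b) (wderiv K^t i v)); split.
  by move=> i; rewrite ea eb; apply: (seg_avg_cvg (open_interior _) i1 i2 d0 (Hw i)).
rewrite /flux ea eb; congr (_ * _).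
have tm i := trace_mean (open_interior _) i1 i2 d0 (Htr i _ _ pab).
rewrite (Rintegral_comb _ (fun i => (tm i).1)).
by apply: eq_bigr => i _; congr (_ * _); exact: (tm i).2.
Qed.

Lemma seg_avg_gradd_sum (f : pt -> R) (v P Q : pt) : smooth f ->
  seg_avg (gradd v f) P Q = v.1 * seg_avg (pd ord0 f) P Q + v.2 * seg_avg (pd ord_max f) P Q.
Proof.
move=> sf; have c0 := smooth_continuous (smooth_pd ord0 sf); have c1 := smooth_continuous (smooth_pd ord_max sf).
have -> : gradd v f = cst v.1 * pd ord0 f + (cst v.2 * pd ord_max f + cst 0).
  by apply/funext => x; rewrite -[RHS]/(v.1 * pd ord0 f x + (v.2 * pd ord_max f x + 0)) addr0.
have c2 := smooth_continuous (smoothD (smoothM (@smooth_cst R v.2) (smooth_pd ord_max sf)) (@smooth_cst R 0)).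
rewrite (seg_avg_lin _ _ _ c0 c2) (seg_avg_lin _ _ _ c1 (@cst_continuous _ _ _)).
have -> : seg_avg (cst 0) P Q = 0 by rewrite /seg_avg /Rintegral integral0_eq.
by congr (_ + _); exact: addr0.
Qed.

(** The tangential part of the mean gradient over an edge is the difference of
    the values at its ends. *)
Lemma edge_gradient_lim E v phi f K T : E \in edges TT -> H2lim K v phi f ->
  (forall i, seg_avg (pd i (phi m)) (edge_a p E) (edge_b p E) @[m --> \oo] --> T i) ->
  (edge_b p E - edge_a p E).1 * T ord0 + (edge_b p E - edge_a p E).2 * T ord_max =
  f (edge_b p E) - f (edge_a p E).
Proof.
move=> EE [sphi _ cf _] cT; have [a [b [ab Eab ea eb]]] := edge_ends EE.
set l := edge_b p E - edge_a p E.
have c1 : l.1 * seg_avg (pd ord0 (phi m)) (edge_a p E) (edge_b p E) +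
    l.2 * seg_avg (pd ord_max (phi m)) (edge_a p E) (edge_b p E) @[m --> \oo] -->
    l.1 * T ord0 + l.2 * T ord_max.
  by apply: cvgD; apply: cvgM => //; exact: cvg_cst.
have c2 : phi m (edge_b p E) - phi m (edge_a p E) @[m --> \oo] --> f (edge_b p E) - f (edge_a p E).
  by rewrite ea eb; apply: cvgB; exact: cf.
have E12 : (fun m => l.1 * seg_avg (pd ord0 (phi m)) (edge_a p E) (edge_b p E) +
    l.2 * seg_avg (pd ord_max (phi m)) (edge_a p E) (edge_b p E)) =
    (fun m => phi m (edge_b p E) - phi m (edge_a p E)).
  by apply/funext => m; rewrite -seg_avg_gradd_sum// seg_avg_gradd.
by rewrite E12 in c1; rewrite -(cvg_lim _ c1)// (cvg_lim _ c2).
Qed.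

Section SameData.
Variables (K : {set 'I_n}) (v v' : L2 R) (phi phi' : nat -> pt -> R) (f f' : pt -> R).
Hypothesis KT : K \in TT.
Hypothesis Hv : H2lim K v phi f.
Hypothesis Hv' : H2lim K v' phi' f'.
Hypothesis same_val : forall z, z \in K -> f (p z) = f' (p z).
Hypothesis same_flux : forall E, E \in edges TT -> E \subset K -> flux p nu K E v = flux p nu K E v'.

(** The flux gives the normal part of the mean gradient over the edge and the
    vertex values give its tangential part. *)
Lemma same_edge_lim x y i : x \in K -> y \in K -> x != y -> exists T : R,
  seg_avg (pd i (phi m)) (p x) (p y) @[m --> \oo] --> T /\
  seg_avg (pd i (phi' m)) (p x) (p y) @[m --> \oo] --> T.
Proof.
move=> xK yK xy; pose E := [set x; y]%SET.
have EK : E \subset K by apply/fintype.subsetP => z; rewrite !inE => /orP[] /eqP ->.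
have EE : E \in edges TT.
  by rewrite inE cards2 xy eqxx /=; apply/existsP; exists K; rewrite KT.
have [a [b [ab Eab ea eb]]] := edge_ends EE.
have aK : a \in K by apply: (fintype.subsetP EK); rewrite Eab !inE eqxx.
have bK : b \in K by apply: (fintype.subsetP EK); rewrite Eab !inE eqxx orbT.
have [T [cT fT]] := flux_lim KT EE EK Hv; have [T' [cT' fT']] := flux_lim KT EE EK Hv'.
have gT := edge_gradient_lim EE Hv cT; have gT' := edge_gradient_lim EE Hv' cT'.
have [n1 n0] := nuP EE.
have pab : p a != p b by apply: contra_neq ab => E0; case: tr => inj _ _ _ _; exact: inj.
have l0 : ((edge_b p E - edge_a p E).1 != 0) || ((edge_b p E - edge_a p E).2 != 0).
  rewrite -negb_and; apply: contra pab => /andP[/eqP l1 /eqP l2].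
  by rewrite eq_sym -subr_eq0 -ea -eb; apply/eqP; exact: plane_eq.
have en0 : enorm (edge_b p E - edge_a p E) != 0.
  rewrite /enorm sqrtr_eq0 -ltNge dotE lt_def addr_ge0 -?expr2 ?sqr_ge0// andbT.
  by rewrite paddr_eq0 ?sqr_ge0// !sqrf_eq0 negb_and.
have sf : \sum_(j < 2) Defs.coord j (nu E) * T j = \sum_(j < 2) Defs.coord j (nu E) * T' j.
  by apply: (mulfI en0); rewrite -fT -fT'; exact: same_flux.
move: n1 n0; rewrite !dotE => n1 n0.
have lmax : lift ord0 ord0 = ord_max :> 'I_2 by exact: val_inj.
have e1 : (nu E).1 * (T ord0 - T' ord0) + (nu E).2 * (T ord_max - T' ord_max) = 0.
  move: sf; rewrite !big_ord_recl !big_ord0 !lmax !addr0 /Defs.coord /= => sf.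
  by apply/eqP; rewrite !mulrBr addrACA -opprD subr_eq0; apply/eqP.
have e2 : (edge_b p E - edge_a p E).1 * (T ord0 - T' ord0) +
   (edge_b p E - edge_a p E).2 * (T ord_max - T' ord_max) = 0.
  by apply/eqP; rewrite !mulrBr addrACA -opprD gT gT' ea eb !same_val// subrr.
have [t0 t1] := dual_frame n1 n0 l0 e1 e2.
have TT' j : T j = T' j.
  have [->|->] : j = ord0 \/ j = ord_max.
    by case: j => [[|[|//]] ?]; [left|right]; exact: val_inj.
    by apply/eqP; rewrite -subr_eq0 t0.
  by apply/eqP; rewrite -subr_eq0 t1.
have := cT i; have := cT' i; rewrite -TT' ea eb => c' c.
have [xa|xb] : (x = a /\ y = b) \/ (x = b /\ y = a).
- have : x \in E by rewrite !inE eqxx.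
  have : y \in E by rewrite !inE eqxx orbT.
  rewrite Eab !inE => /orP[] /eqP ya /orP[] /eqP xa; rewrite ?ya ?xa; [|by right|by left|].
  + by move: xy; rewrite xa ya eqxx.
  + by move: xy; rewrite xa ya eqxx.
- by exists (T i); rewrite xa.1 xa.2.
- exists (T i); rewrite xb.1 xb.2.
  have [sp _ _ _] := Hv; have [sp' _ _ _] := Hv'.
  by split; apply: seg_avg_cvg_sym => // m; exact: smooth_pd.
Qed.

Let dI (w : L2 R) i j := \int[mu]_(x in K^t) wderiv K^t j (wderiv K^t i w) x.

Lemma same_divergence a b c i : K = [set a; b; c]%SET ->
  det2 (p b - p a) (p c - p a) != 0 ->
  \sum_(j < 2) Defs.coord j (p b - p a) * dI v i j =
  \sum_(j < 2) Defs.coord j (p b - p a) * dI v' i j.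
Proof.
move=> KE d0; have [ab ac bc] := det2_distinct d0.
have aK : a \in K by rewrite KE !inE eqxx.
have bK : b \in K by rewrite KE !inE eqxx ?orbT.
have cK : c \in K by rewrite KE !inE eqxx ?orbT.
have i1 : itri (p a) (p b) (p c) `<=` K^t by rewrite KE; exact: itri_interior.
have i2 : K^t `<=` tri (p a) (p b) (p c) by rewrite KE; exact: interior_tri.
have [_ Hw _ _] := Hv; have [_ Hw' _ _] := Hv'.
have c1 := divergence_cvg (open_interior _) i1 i2 d0 (Hw i).
have c1' := divergence_cvg (open_interior _) i1 i2 d0 (Hw' i).
have [T [cT cT']] := same_edge_lim i bK cK bc.
have [S [cS cS']] := same_edge_lim i aK cK ac.
exact: (scaled_diff_lim cT cS cT' cS' c1 c1').
Qed.

(** By the divergence theorem, the integral of a derivative of the gradient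
    over [K] is determined by the means of the gradient over the edges; two
    edge directions span the plane. *)
Lemma same_mean_hessian i j :
  \int[mu]_(x in K^t) wderiv K^t j (wderiv K^t i v) x =
  \int[mu]_(x in K^t) wderiv K^t j (wderiv K^t i v') x.
Proof.
have [a [b [c [KE d0]]]] := triangleP tr KT.
have KE' : K = [set a; c; b]%SET by rewrite KE; apply/setP => z; rewrite !inE orbAC.
have d0' : det2 (p c - p a) (p b - p a) != 0.
  by rewrite -oppr_eq0; move: d0; congr (_ != 0); rewrite /det2 /=; ring.
exact: (frame_solve d0 (same_divergence i KE d0) (same_divergence i KE' d0')).
Qed.

End SameData.

End LocalData.

(** * Galerkin orthogonalities *)

Section MorleySpace.
Context {R : realType} (Om : set (plane R)) {n : nat} (p : 'I_n -> plane R)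
  (TT : {set {set 'I_n}}) (nu : {set 'I_n} -> plane R).
Notation pt := (plane R).
Local Notation mu := (leb2 R).
Local Notation leb := (@lebesgue_measure R).
Notation "K ^t" := ((hull p K)°) (at level 2, format "K ^t").
Hypothesis dom : polygonal_lipschitz_domain Om.
Hypothesis tr : triangulation Om p TT.
Hypothesis nuP : unit_normals p TT nu.
Let oOm : open Om. Proof. exact: open_Om. Qed.

Lemma vertex_in_hull (S : {set 'I_n}) z : z \in S -> hull p S (p z).
Proof.
move=> zS; exists (fun y => (y == z)%:R); split.
- by move=> i; exact: ler0n.
- by move=> i iS; rewrite (_ : i == z = false)//; apply: contraNF iS => /eqP ->.
- by rewrite (bigD1 z)//= eqxx big1 ?addr0// => i /negbTE ->.
- by rewrite (bigD1 z)//= eqxx scale1r big1 ?addr0// => i /negbTE ->; rewrite scale0r.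
Qed.

Lemma segment_in_hull (a b : 'I_n) t : a != b -> 0 <= t <= 1 ->
  hull p [set a; b]%SET (p a + t *: (p b - p a)).
Proof.
move=> ab /andP[t0 t1]; have ba : b == a = false by rewrite eq_sym (negbTE ab).
exists (fun y => if y == a then 1 - t else if y == b then t else 0); split.
- by move=> i; case: ifP => _; [rewrite subr_ge0|case: ifP].
- by move=> i; rewrite !inE negb_or => /andP[/negbTE -> /negbTE ->].
- rewrite (bigD1 a)//= eqxx (bigD1 b) ?ba//= eqxx big1 ?addr0 ?subrK//.
  by move=> i /andP[/negbTE -> /negbTE ->].
- rewrite (bigD1 a)//= eqxx (bigD1 b) ?ba//= eqxx big1 ?addr0.
    by apply: plane_eq; rewrite /= /GRing.scale /=; ring.
  by move=> i /andP[/negbTE -> /negbTE ->]; rewrite scale0r.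
Qed.

Lemma hull_mono (S S' : {set 'I_n}) : S \subset S' -> hull p S `<=` hull p S'.
Proof.
move=> SS x [l [l0 lS l1 lx]]; exists l; split=> // i iS; apply: lS.
by apply: contra iS; exact: (fintype.subsetP SS).
Qed.

Lemma mid_edge (a b : 'I_n) : a != b -> mid p [set a; b]%SET = 2^-1 *: (p a + p b).
Proof. by move=> ab; rewrite /mid cards2 ab big_setU1 ?inE//= big_set1. Qed.

Lemma ptval_hull K (S : set pt) (v : L2 R) (f : pt -> R) z : K \in TT ->
  hull p K `<=` S -> hull p K z -> continuous f ->
  (\forall x \ae mu, S x -> v x = f x) -> ptval S v z = f z.
Proof.
move=> /(triangleP tr)[i [j [k [-> d0]]]]; rewrite hull_tri// => TS Tz.
exact: (ptval_tri d0 TS Tz).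
Qed.

Lemma Morley_poly (q : L2 R) K : Ppw Om p TT 2%N q -> K \in TT ->
  exists2 f, poly_le 2%N f & \forall x \ae mu, hull p K x -> q x = f x.
Proof. by move=> [_ H] /H [f f2 qf]; exists f => //; exact: poly2_le. Qed.

Lemma Ppw_H2pw q : Ppw Om p TT 2%N q -> H2pw Om p TT q.
Proof.
move=> Pq; split; first by case: Pq.
move=> K KT; have [f f2 qf] := Morley_poly Pq KT.
have [r Kr] := hull_in_box tr KT.
apply: (@smooth_H2 _ K^t r f) => //.
- exact: open_interior.
- by apply: subset_trans Kr; exact: interior_subset.
- exact: poly_le_smooth f2.
- by apply: filterS qf => x H /interior_subset; exact: H.
Qed.

Lemma Morley_H2pw q : Morley Om p TT nu q -> H2pw Om p TT q.
Proof. by move=> [Pq _ _ _ _]; exact: Ppw_H2pw. Qed.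

Lemma Morley0 : Morley Om p TT nu 0.
Proof.
have z0 (S : set pt) : \forall x \ae mu, S x -> (0 : L2 R) x = cst 0 x.
  by have := @L20E R; apply: filterS => x ->.
have v0 K (z : pt) : K \in TT -> hull p K z -> ptval (hull p K) 0 z = 0.
  move=> KT Kz; rewrite (@ptval_hull K (hull p K) 0 (cst 0))//.
  exact: cst_continuous.
have d0 K i (z : pt) : K \in TT -> hull p K z -> ptval (hull p K) (wderiv K^t i 0) z = 0.
  move=> KT Kz; have := poly_wderiv tr i KT (@smooth_cst R 0) (z0 (hull p K)).
  rewrite pd_cst => H; rewrite (@ptval_hull K (hull p K) _ (cst 0))//.
  exact: cst_continuous.
have dn K E : E \in edges TT -> K \in Tedge TT E -> dnu_at p nu K E 0 (mid p E) = 0.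
  move=> EE; rewrite inE => /andP[KT EK]; have [a [b [ab Eab _ _]]] := edge_ends p EE.
  rewrite /dnu_at big1// => i _; rewrite d0 ?mulr0//.
  apply: (hull_mono EK); rewrite Eab mid_edge//.
  have -> : 2^-1 *: (p a + p b) = p a + 2^-1 *: (p b - p a).
    by apply: plane_eq; rewrite /= /GRing.scale /=; field.
  by apply: segment_in_hull => //; rewrite invr_ge0 ler0n invf_le1 ?ler1n.
have vz z K : K \in Tvertex TT z -> ptval (hull p K) 0 (p z) = 0.
  by rewrite inE => /andP[KT zK]; rewrite v0//; exact: vertex_in_hull.
split.
- split; first exact: L2on0.
  move=> K KT; exists (cst 0); last exact: z0.
  exists (fun _ _ => 0) => x; rewrite big1// => i _; rewrite big1// => j _.
  by rewrite !mul0r.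
- by move=> z _ K K' KT K'T; rewrite !vz.
- by move=> z _ K KT; rewrite vz.
- by move=> E EE _ K K' KE K'E; rewrite !dn.
- by move=> E EE _ K KE; rewrite dn.
Qed.

(** The normal derivative of a quadratic polynomial is affine on the edge, so
    that its mean is its value at the midpoint. *)
Lemma Morley_flux_bdry q E K : Morley Om p TT nu q -> E \in edges TT -> K \in Tedge TT E ->
  bdry_edge Om p E -> flux p nu K E q = 0.
Proof.
move=> [Pq _ _ _ Hb] EE KE bE; have := Hb E EE bE K KE; move: KE; rewrite inE => /andP[KT EK].
have [f f2 qf] := Morley_poly Pq KT; have sf := poly_le_smooth f2.
have [T [cT ->]] := flux_lim nu tr KT EE EK (poly_H2lim tr KT sf qf).
have [a [b [ab Eab ea eb]]] := edge_ends p EE.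
have mE : hull p K (mid p E).
  apply: (hull_mono EK); rewrite Eab mid_edge//.
  have -> : 2^-1 *: (p a + p b) = p a + 2^-1 *: (p b - p a).
    by apply: plane_eq; rewrite /= /GRing.scale /=; field.
  by apply: segment_in_hull => //; rewrite invr_ge0 ler0n invf_le1 ?ler1n.
have TE i : T i = pd i f (mid p E).
  have := cT i; rewrite ea eb seg_avg_affine ?Eab ?mid_edge//; last exact: (f2.2 i).
  by move=> c; rewrite -(cvg_lim _ c)// lim_cst.
rewrite /dnu_at => H; rewrite (_ : \sum_(i < 2) _ = 0) ?mulr0// -[RHS]H.
apply: eq_bigr => i _; rewrite TE; congr (_ * _); apply/esym.
apply: (@ptval_hull K (hull p K) _ (pd i f)) => //.
- by apply: smooth_continuous; exact: smooth_pd.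
- exact: (poly_wderiv tr).
Qed.

(** The approximating test functions are defined across the edge: the edge
    means of their gradients do not depend on the triangle. *)
Lemma V_flux_same v E K K' : V Om v -> E \in edges TT -> K \in Tedge TT E ->
  K' \in Tedge TT E -> flux p nu K E v = flux p nu K' E v.
Proof.
move=> Vv EE; rewrite !inE => /andP[KT EK] /andP[KT' EK'].
have [phi [f [_ _ _ _ H]]] := V_H2lim dom tr Vv.
have [T [cT ->]] := flux_lim nu tr KT EE EK (H K KT).
have [T' [cT' ->]] := flux_lim nu tr KT' EE EK' (H K' KT').
congr (_ * _); apply: eq_bigr => i _; congr (_ * _).
by rewrite -(cvg_lim _ (cT i))// (cvg_lim _ (cT' i)).
Qed.

(** The approximating test functions and their derivatives vanish on the
    boundary. *)
Lemma V_flux_bdry v E K : V Om v -> E \in edges TT -> K \in Tedge TT E ->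
  bdry_edge Om p E -> flux p nu K E v = 0.
Proof.
move=> Vv EE; rewrite inE => /andP[KT EK] bE.
have [phi [f [_ _ _ tphi H]]] := V_H2lim dom tr Vv.
have [T [cT ->]] := flux_lim nu tr KT EE EK (H K KT).
have [a [b [ab Eab ea eb]]] := edge_ends p EE.
have z0 i m : seg_avg (pd i (phi m)) (edge_a p E) (edge_b p E) = 0.
  rewrite ea eb /seg_avg /Rintegral integral0_eq// => t /=; rewrite in_itv /= => t01.
  congr EFin; apply: (testfun_pd_out i (tphi m)) => Ot.
  have [_] : bdry Om (p a + t *: (p b - p a)).
    by apply: bE; rewrite Eab; exact: segment_in_hull.
  by apply; apply: open_nbhs_nbhs; split.
rewrite big1 ?mulr0// => i _.
have := cT i; under eq_fun do rewrite z0.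
by move=> c; rewrite -(cvg_lim _ c)// lim_cst// mulr0.
Qed.

Lemma hess_poly K (v q : L2 R) (c : 'I_2 -> 'I_2 -> R) : K \in TT ->
  (forall i j, \forall x \ae mu, K^t x -> wderiv K^t j (wderiv K^t i q) x = c i j) ->
  hess K^t v q = \sum_(i < 2) \sum_(j < 2)
     c i j * \int[mu]_(x in K^t) wderiv K^t j (wderiv K^t i v) x.
Proof.
move=> KT H; have mK := measurable_interiorK p K; have [r Kr] := hull_in_box tr KT.
have Kr' : K^t `<=` box r by apply: subset_trans Kr; exact: interior_subset.
have sw (a b d : R) : b = d -> a * b = d * a by move=> ->; exact: mulrC.
apply: eq_bigr => i _; apply: eq_bigr => j _.
have iv := L2_integrable (wderiv K^t j (wderiv K^t i v)) mK Kr'.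
transitivity (\int[mu]_(x in K^t) (c i j * wderiv K^t j (wderiv K^t i v) x)); last exact: RintegralZl.
apply: ae_eq_Rintegral => //.
- by apply: measurable_funM; exact: measurable_funTS (L2_measurable _).
- by apply: measurable_funM; [exact: measurable_cst|exact: measurable_funTS (L2_measurable _)].
- have Hij := H i j; apply: (@filterS _ _ (ae_filter_ringOfSetsType mu) _ _ _ Hij) => x E Kx.
  exact: (sw _ _ _ (E Kx)).
Qed.

(** Hessians of Morley functions are piecewise constant, so that [apw v q]
    depends on [v] through its mean Hessians only, and these are determined by
    vertex values and normal fluxes. *)
Lemma apw_same_data v w q : V Om v -> Morley Om p TT nu w -> Morley Om p TT nu q ->
  (forall K z, K \in TT -> z \in K -> ptval (hull p K) w (p z) = ptval (hull p K) v (p z)) ->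
  (forall K E, E \in edges TT -> K \in Tedge TT E -> flux p nu K E w = flux p nu K E v) ->
  apw p TT v q = apw p TT w q.
Proof.
move=> Vv [Pw _ _ _ _] [Pq _ _ _ _] sv sf; apply: eq_bigr => K KT.
have [f f2 qf] := Morley_poly Pq KT; have [c cE] := quadratic_hessian f2.
have Hc i j : \forall x \ae mu, K^t x -> wderiv K^t j (wderiv K^t i q) x = c i j.
  by have := poly_wderiv2 tr i j KT (poly_le_smooth f2) qf; rewrite cE.
have E1 := hess_poly v KT Hc; have E2 := hess_poly w KT Hc.
apply: (etrans E1); apply: (etrans _ (esym E2)).
apply: eq_bigr => i _; apply: eq_bigr => j _; apply: (congr1 (fun y => c i j * y)).
have [phi [g [cg _ vg _ Hg]]] := V_H2lim dom tr Vv.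
have [h h2 wh] := Morley_poly Pw KT; have sh := poly_le_smooth h2.
apply: (same_mean_hessian tr nuP KT (Hg K KT) (poly_H2lim tr KT sh wh)).
- move=> z zK; have zh := vertex_in_hull zK.
  have vgK : \forall x \ae mu, hull p K x -> v x = g x by apply: filterS vg => x E _.
  have e1 := ptval_hull KT (@subset_refl _ _) zh cg vgK.
  have e2 := ptval_hull KT (@subset_refl _ _) zh (smooth_continuous sh) wh.
  by rewrite -e1 -e2 sv.
- by move=> E EE EK; apply/esym; apply: sf => //; rewrite inE KT EK.
Qed.

(** For [v] in H^2_0 the averages that define the interpolation are averages
    of equal numbers, and the boundary values vanish on both sides. *)
Lemma apw_interp IM v q : is_morley_interp Om p TT nu IM -> V Om v ->
  Morley Om p TT nu q -> apw p TT v q = apw p TT (IM v) q.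
Proof.
move=> HIM Vv Mq; have [MI vI fI] := HIM v (V_H2pw dom tr Vv).
have avg (I : finType) (A : {set I}) (F : I -> R) (c : R) k : k \in A ->
    (forall x, x \in A -> F x = c) -> #|A|%:R^-1 * \sum_(x in A) F x = c.
  move=> kA Fc; rewrite (eq_bigr (fun=> c) Fc) sumr_const -[c *+ _]mulr_natl mulKf//.
  by rewrite pnatr_eq0 -lt0n; apply/card_gt0P; exists k.
apply: (apw_same_data Vv MI Mq).
- move=> K z KT zK; have [phi [f [cf f0 vf _ _]]] := V_H2lim dom tr Vv.
  have pv K' : K' \in Tvertex TT z -> ptval (hull p K') v (p z) = f (p z).
    rewrite inE => /andP[KT' zK']; apply: (ptval_hull KT' (@subset_refl _ _) (vertex_in_hull zK') cf).
    by apply: filterS vf => x E _.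
  have KV : K \in Tvertex TT z by rewrite inE KT.
  apply: (etrans _ (esym (pv K KV))).
  have [zi|zb] := pselect (int_vertex Om p z).
    by apply: (etrans (vI z zi K KV)); exact: avg KV pv.
  by have [_ _ b0 _ _] := MI; apply: (etrans (b0 z zb K KV)); apply/esym; exact: f0.
- move=> K E EE KE; have [Eb|Ei] := pselect (bdry_edge Om p E).
    by apply: (etrans (Morley_flux_bdry MI EE KE Eb)); apply/esym; exact: V_flux_bdry Vv EE KE Eb.
  apply: (etrans (fI E EE Ei K KE)); apply: (avg _ _ _ _ K KE) => K' KE'.
  exact: V_flux_same Vv EE KE' KE.
Qed.

Lemma apw_companion LJ J w q : is_companion Om p TT nu LJ J -> Morley Om p TT nu w ->
  Morley Om p TT nu q -> apw p TT (J w) q = apw p TT w q.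
Proof.
move=> [_ HJ] Mw Mq; have [[_ VJ] vJ _ fJ _] := HJ w Mw.
apply: (apw_same_data VJ Mw Mq); last by move=> K E EE KE; apply/esym; exact: fJ.
move=> K z KT zK; have [phi [f [cf f0 vf _ _]]] := V_H2lim dom tr VJ.
have KV : K \in Tvertex TT z by rewrite inE KT.
have vS (S : set pt) : \forall x \ae mu, S x -> J w x = f x by apply: filterS vf => x E _.
have zK' := vertex_in_hull zK.
have e1 := ptval_hull KT (hull_sub_closure tr KT) zK' cf (vS (closure Om)).
have e2 := ptval_hull KT (@subset_refl _ _) zK' cf (vS (hull p K)).
by apply: (etrans (esym (vJ z K KV))); apply: (etrans e1); exact: esym e2.
Qed.

End MorleySpace.

(** * The abstract quasi-optimality argument *)

Lemma quadratic_bound (R : realFieldType) (alpha e x c : R) : 0 < alpha -> 0 <= e -> 0 <= c -> 0 <= x ->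
  alpha * e ^+ 2 <= c * x * e -> e <= alpha^-1 * c * x.
Proof.
move=> a0 e0 c0 x0; have [->|en0] := eqVneq e 0.
  by move=> _; rewrite !mulr_ge0// invr_ge0 ltW.
have ep : 0 < e by rewrite lt_def en0.
rewrite expr2 mulrA ler_pM2r// => H.
by rewrite -mulrA -(ler_pM2l a0) mulVKf ?gt_eqF.
Qed.

Section Abstract.
Context {R : realType} {U : lmodType R}.
Variables (H V Mo Vh : set U) (a : U -> U -> R) (nh : U -> R).
Local Notation N v := (Num.sqrt (a v v)).
Hypothesis H_lin : forall (c : R) x y, H x -> H y -> H (c *: x + y).
Hypothesis a_lin : forall (c : R) x y z, H x -> H y -> a (c *: x + y) z = c * a x z + a y z.
Hypothesis a_sym : forall x y, a x y = a y x.
Hypothesis a_ge0 : forall x, 0 <= a x x.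
Hypothesis V_lin : forall (c : R) x y, V x -> V y -> V (c *: x + y).
Hypothesis Vh_lin : forall (c : R) x y, Vh x -> Vh y -> Vh (c *: x + y).
Hypothesis V_H : V `<=` H.
Hypothesis Mo_H : Mo `<=` H.
Hypothesis Vh_H : Vh `<=` H.
Hypothesis Mo0 : Mo 0.
Hypothesis Nh : norm_on H nh.
Hypothesis N_nh : forall x, H x -> N x <= nh x.
Hypothesis N_VMo : forall x, sumset V Mo x -> N x = nh x.

Lemma subE (x y : U) : x - y = (-1) *: y + x.
Proof. by rewrite scaleN1r addrC. Qed.

Lemma H_sub x y : H x -> H y -> H (x - y).
Proof. by move=> Hx Hy; rewrite subE; exact: H_lin. Qed.

Lemma set0_of_lin (S : set U) : (forall (c : R) x y, S x -> S y -> S (c *: x + y)) ->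
  forall x, S x -> S 0.
Proof. by move=> Sl x Sx; rewrite -(subrr x) subE; exact: Sl. Qed.

Lemma nh_subC x y : H x -> H y -> nh (x - y) = nh (y - x).
Proof.
move=> Hx Hy; case: Nh => _ _ nZ _.
by rewrite -[x - y]opprB -[- (y - x)]scaleN1r nZ ?normrN1 ?mul1r//; exact: H_sub.
Qed.

Lemma nh_triangle x y z : H x -> H y -> H z -> nh (x - z) <= nh (x - y) + nh (y - z).
Proof.
move=> Hx Hy Hz; case: Nh => _ _ _ nD.
have -> : x - z = (x - y) + (y - z) by rewrite addrA subrK.
by apply: nD; exact: H_sub.
Qed.

Lemma a_sub x y z : H x -> H y -> a (x - y) z = a x z - a y z.
Proof. by move=> Hx Hy; rewrite subE a_lin// mulN1r addrC. Qed.

Lemma a_subr x y z : H x -> H y -> a z (x - y) = a z x - a z y.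
Proof. by move=> Hx Hy; rewrite a_sym a_sub// ![a _ z]a_sym. Qed.

Lemma N_subC x y : H x -> H y -> N (x - y) = N (y - x).
Proof.
move=> Hx Hy; rewrite !a_sub// !a_subr//; congr Num.sqrt; ring.
Qed.

Lemma N_VMo_sub x y : V x -> Mo y -> N (x - y) = nh (x - y).
Proof.
move=> Vx My; rewrite N_subC; [|exact: V_H|exact: Mo_H].
rewrite nh_subC; [|exact: V_H|exact: Mo_H].
apply: N_VMo; exists (- x); last by exists y => //; rewrite addrC.
by rewrite -scaleN1r -[_ *: _]addr0; apply: V_lin => //; exact: (set0_of_lin V_lin Vx).
Qed.

Variables (Ah bh ch : U -> U -> R) (IM Ih J : U -> U) (F : U -> R).
Variables (alpha Lh Ldc Mb Lc MM L0 : R) (u uh : U).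
Local Notation S := (sumset Vh Mo).
Hypothesis Ah_bil : bilinear_on S Ah.
Hypothesis bh_bil : bilinear_on S bh.
Hypothesis AhE : forall v w, S v -> S w -> Ah v w = a v w + bh v w + ch v w.
Hypothesis Ih_Vh : forall w, Mo w -> Vh (Ih w).
Hypothesis IM_Mo : forall v, H v -> Mo (IM v).
Hypothesis alpha0 : 0 < alpha.
Hypothesis consts_ge0 : [/\ 0 <= Lh, 0 <= Ldc, 0 <= Mb & 0 <= Lc] /\ (0 <= MM /\ 0 <= L0).
Hypothesis coercive : forall v, Vh v -> alpha * nh v ^+ 2 <= Ah v v.
Hypothesis IM_bound : forall v, Vh v -> N (IM v) <= MM * nh v.
Hypothesis Ih_approx : forall w v, Mo w -> V v -> nh (w - Ih w) <= Lh * N (w - v).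
Hypothesis consist : forall vM wh v w, Mo vM -> Vh wh -> V v -> V w ->
  a vM (wh - IM wh) + bh vM (wh - IM wh) <= Ldc * N (vM - v) * nh (wh - w).
Hypothesis bh_Mo : forall x y, Mo x -> Mo y -> bh x y = 0.
Hypothesis bh_bound : forall vh wh vM wM, Vh vh -> Vh wh -> Mo vM -> Mo wM ->
  bh (vh + vM) (wh + wM) <= Mb * nh (vh + vM) * nh (wh + wM).
Hypothesis ch_bound : forall vh wh v w, Vh vh -> Vh wh -> V v -> V w ->
  ch vh wh <= Lc * nh (v - vh) * nh (w - wh).
Hypothesis Vu : V u.
Hypothesis Vuh : Vh uh.
Hypothesis J_H : forall w, Mo w -> H (J w).
Hypothesis J_bound : forall w, Mo w -> N (w - J w) <= L0 * N w.
Hypothesis F_J : forall w, Mo w -> F (J w) = a u (J w).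
Hypothesis uh_sol : forall v, Vh v -> Ah uh v = F (J (IM v)).
Hypothesis ortho_IM : forall w, Mo w -> a u w = a (IM u) w.
Hypothesis ortho_J : forall w q, Mo w -> Mo q -> a (J w) q = a w q.

(** Both orthogonalities turn the left-hand side into [a (u - IM u) (w - J
    w)], a product of two errors. *)
Lemma consistency_error w : Mo w -> a (IM u) w - F (J w) <= N (u - IM u) * (L0 * N w).
Proof.
move=> Mw; have Hu := V_H Vu; have MI := IM_Mo Hu; have HI := Mo_H MI.
have Hw := Mo_H Mw; have HJ := J_H Mw.
have -> : a (IM u) w - F (J w) = a (u - IM u) (w - J w).
  have E1 := ortho_IM Mw; have E2 := ortho_J Mw MI; rewrite [RHS]a_sub// !a_subr// F_J//.
  by rewrite E1 [a (IM u) (J w)]a_sym E2 [a w _]a_sym subrr subr0.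
have CS := @semi_inner_CS R U H a a_lin a_sym a_ge0 (u - IM u) (w - J w).
apply: le_trans (CS _ _) _; [exact: H_sub|exact: H_sub|].
by apply: ler_wpM2l; [exact: sqrtr_ge0|exact: J_bound].
Qed.

(** Coercivity is applied to the discrete error [Ih (IM u) - uh]. Testing the
    discrete problem with it and inserting [IM u] splits the residual into the
    consistency error, the two errors of [Ih (IM u) - IM u] in [a] and in
    [bh], the term controlled by [consist], and the penalty term [ch]; each of
    them is at most a constant times [N (u - IM u)] times the norm of the
    discrete error. *)
Theorem quasi_optimality : nh (u - uh) <=
  (1 + Lh + alpha^-1 * (L0 * MM + Lh * (1 + Mb) + Ldc + Lc * (1 + Lh))) * N (u - IM u).
Proof.
have [[Lh0 Ldc0 Mb0 Lc0] [MM0 L00]] := consts_ge0.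
have [nh0 _ nZ _] := Nh.
have Hu := V_H Vu; set w := IM u; have Mw : Mo w := IM_Mo Hu; have Hw := Mo_H Mw.
have VI := Ih_Vh Mw; have HI := Vh_H VI.
set e := Ih w - uh; have Ve : Vh e by rewrite /e subE; exact: Vh_lin.
have He := Vh_H Ve; set z := IM e; have Mz : Mo z := IM_Mo He; have Hz := Mo_H Mz.
have V0 : V 0 := set0_of_lin V_lin Vu; have Vh0 : Vh 0 := set0_of_lin Vh_lin Ve.
have SVh x : Vh x -> S x by move=> Vx; exists x => //; exists 0 => //; rewrite addr0.
have SMo x : Mo x -> S x by move=> Mx; exists 0 => //; exists x => //; rewrite add0r.
set X := N (u - w); have X0 : 0 <= X by exact: sqrtr_ge0.
set ne := nh e; have ne0 : 0 <= ne by exact: nh0.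
have XE : nh (u - w) = X by rewrite /X N_VMo_sub.
have XE' : N (w - u) = X by rewrite N_subC.
have wI : nh (w - Ih w) <= Lh * X by rewrite -XE'; exact: Ih_approx.
have uI : nh (u - Ih w) <= (1 + Lh) * X.
  by apply: (le_trans (nh_triangle Hu Hw HI)); rewrite XE mulrDl mul1r lerD2l.
have neN : nh (0 - e) = ne.
  by rewrite nh_subC ?subr0//; exact: V_H.
(* Taking [v = u] and [w = 0] in the approximation hypotheses turns the
   distances to the discrete error into its norm. *)
have T1 : ch (Ih w) e <= Lc * (1 + Lh) * X * ne.
  apply: (le_trans (ch_bound VI Ve Vu V0)); rewrite neN -!mulrA; apply: ler_wpM2l => //.
  by rewrite mulrA; apply: ler_wpM2r.
have T2 : a (Ih w) e - a w e <= Lh * X * ne.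
  rewrite -a_sub//; have CS := @semi_inner_CS R U H a a_lin a_sym a_ge0 (Ih w - w) e.
  apply: le_trans (CS _ _) _ => //; first exact: H_sub.
  apply: ler_pM; rewrite ?sqrtr_ge0//; last exact: N_nh.
  by apply: le_trans (N_nh (H_sub HI Hw)) _; rewrite nh_subC.
have T3 : bh (Ih w) e - bh w e <= Lh * Mb * X * ne.
  have [bl br] := bh_bil.
  (* [bh_bound] is one-sided and its Morley summand is [w], not [- w]: hence
     the change of sign in both arguments. *)
  have VN x : Vh x -> Vh ((-1) *: x) by move=> Vx; rewrite -[_ *: _]addr0; exact: Vh_lin.
  have b0 x : S x -> bh x 0 = 0.
    move=> Sx; have := br 1 0 0 x (SVh _ Vh0) (SVh _ Vh0) Sx.
    by rewrite scale1r addr0 mul1r => /eqP; rewrite -subr_eq0 opprD addrA subrr sub0r oppr_eq0 => /eqP.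
  have -> : bh (Ih w) e - bh w e = bh ((-1) *: Ih w + w) ((-1) *: e + 0).
    have Sx : S ((-1) *: Ih w + w) by exists ((-1) *: Ih w); [exact: VN|exists w].
    rewrite br//; [|exact: SVh|exact: SVh]; rewrite b0// addr0 bl//; [|exact: SVh|exact: SMo|exact: SVh].
    ring.
  apply: (le_trans (bh_bound (VN _ VI) (VN _ Ve) Mw Mo0)).
  rewrite addr0 -subE nZ// normrN1 mul1r -/ne; apply: ler_wpM2r => //.
  by rewrite [Lh * Mb]mulrC -mulrA; apply: ler_wpM2l.
have T4 : a w e - a w z + bh w e <= Ldc * X * ne.
  have := consist Mw Ve Vu V0; rewrite -/z XE' subr0 -/ne a_subr//.
  have [bl br] := bh_bil; rewrite subE br//; [|exact: SMo|exact: SVh|exact: SMo].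
  by rewrite bh_Mo// mulr0 add0r.
have T5 : a w z - F (J z) <= L0 * MM * X * ne.
  apply: (le_trans (consistency_error Mz)); rewrite -/w -/X.
  have -> : L0 * MM * X * ne = X * (L0 * (MM * ne)) by ring.
  by apply: ler_wpM2l => //; apply: ler_wpM2l => //; exact: IM_bound.
have AE : Ah e e = a (Ih w) e + bh (Ih w) e + ch (Ih w) e - F (J z).
  have [Al _] := Ah_bil; rewrite {1}/e subE Al//; [|exact: SVh..].
  rewrite uh_sol// AhE//; [|exact: SVh..]. by rewrite -/z mulN1r addrC.
have key : ne <= alpha^-1 * (L0 * MM + Lh * (1 + Mb) + Ldc + Lc * (1 + Lh)) * X.
  apply: quadratic_bound => //.
    by rewrite !addr_ge0// ?mulr_ge0 ?addr_ge0.
  apply: (le_trans (coercive Ve)); rewrite AE.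
  have -> : a (Ih w) e + bh (Ih w) e + ch (Ih w) e - F (J z) =
    (a w z - F (J z)) + ((a (Ih w) e - a w e) + (bh (Ih w) e - bh w e)) +
    (a w e - a w z + bh w e) + ch (Ih w) e by ring.
  have -> : (L0 * MM + Lh * (1 + Mb) + Ldc + Lc * (1 + Lh)) * X * ne =
    L0 * MM * X * ne + (Lh * X * ne + Lh * Mb * X * ne) + Ldc * X * ne + Lc * (1 + Lh) * X * ne by ring.
  by apply: lerD => //; apply: lerD => //; apply: lerD => //; exact: lerD.
apply: (le_trans (nh_triangle Hu HI (Vh_H Vuh))); rewrite -/e -/ne mulrDl.
exact: lerD.
Qed.

Variables (LJ LM : R).
Hypothesis LJ0 : 0 <= LJ.
Hypothesis J_approx : forall w v, Mo w -> V v -> N (w - J w) <= LJ * N (w - v).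
Hypothesis IM_approx : forall v w, Vh v -> V w -> nh (v - IM v) <= LM * nh (v - w).

Theorem companion_error : N (u - J (IM uh)) <= (1 + LM) * (1 + LJ) * nh (u - uh).
Proof.
have Huh := Vh_H Vuh; have Hu := V_H Vu; set w := IM uh; have Mw : Mo w := IM_Mo Huh.
have Hw := Mo_H Mw; have HJ := J_H Mw.
have -> : u - J w = (u - w) + (w - J w) by rewrite addrA subrK.
have tri := @semi_inner_triangle R U H a a_lin a_sym a_ge0 (u - w) (w - J w).
apply: (le_trans (tri (H_sub Hu Hw) (H_sub Hw HJ))).
have B1 : N (w - J w) <= LJ * N (u - w) by rewrite [N (u - w)]N_subC//; exact: J_approx.
have B2 : N (u - w) <= (1 + LM) * nh (u - uh).
  apply: (le_trans (N_nh (H_sub Hu Hw))); apply: (le_trans (nh_triangle Hu Huh Hw)).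
  by rewrite mulrDl mul1r lerD2l [nh (u - uh)]nh_subC//; exact: IM_approx.
apply: (@le_trans _ _ ((1 + LJ) * N (u - w))); first by rewrite mulrDl mul1r lerD2l.
rewrite [(1 + LM) * _]mulrC -mulrA; apply: ler_wpM2l => //.
by rewrite addr_ge0.
Qed.

End Abstract.

(** * The constants of the companion operator *)

Section Lambda0.
Context {R : realType} (Om : set (plane R)) {n : nat} (p : 'I_n -> plane R)
  (TT : {set {set 'I_n}}) (nu : {set 'I_n} -> plane R).
Variables (J : L2 R -> L2 R) (LJ : R).
Hypothesis LJ0 : 0 <= LJ.
Hypothesis HJ : is_companion Om p TT nu LJ J.

Hypothesis dom : polygonal_lipschitz_domain Om.
Hypothesis tr : triangulation Om p TT.

Lemma npw0 : V Om 0 -> npw p TT 0 = 0.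
Proof.
move=> /(V_H2pw dom tr) H0; have := apw_lin (- 1) 0 H0 H0.
by rewrite scaler0 addr0 mulN1r addNr /npw => ->; rewrite sqrtr0.
Qed.

Lemma companion_approx w v : Morley Om p TT nu w -> V Om v ->
  npw p TT (w - J w) <= LJ * npw p TT (w - v).
Proof.
move=> Mw Vv; have [_ /(_ w Mw)[_ _ _ _ [B _]]] := HJ.
apply: (le_trans B); apply: ler_wpM2l => //; apply: ge_inf; last by exists v.
by exists 0 => _ [x _ <-]; exact: npw_ge0.
Qed.

(** A degenerate case is hidden in the quotients: when [npw w] vanishes the
    quotient is zero by convention, and the bound follows from
    [companion_approx] with [v = 0]. *)
Lemma Lambda0_bound w : V Om 0 -> Morley Om p TT nu w ->
  npw p TT (w - J w) <= Lambda0 Om p TT nu J * npw p TT w.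
Proof.
move=> V0 Mw; have B := companion_approx Mw V0; rewrite subr0 in B.
have [N0|N0] := eqVneq (npw p TT w) 0; first by move: B; rewrite N0 !mulr0.
have Np : 0 < npw p TT w by rewrite lt_def N0; exact: npw_ge0.
rewrite -(ler_pdivrMr _ _ Np); apply: ub_le_sup; last first.
  exists w => //; split=> //; apply: contra_neq N0 => ->; exact: npw0.
exists LJ => _ [x [Mx x0] <-]; have Bx := companion_approx Mx V0; rewrite subr0 in Bx.
have [Nx|Nx] := eqVneq (npw p TT x) 0; first by rewrite Nx invr0 mulr0.
have Np' : 0 < npw p TT x by rewrite lt_def Nx; exact: npw_ge0.
by rewrite (ler_pdivrMr _ _ Np').
Qed.

Lemma Lambda0_ge0 : 0 <= Lambda0 Om p TT nu J.
Proof.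
rewrite /Lambda0; set S := [set _ | _ in _].
have [[[r Sr] ubS]|/sup_out ->//] := pselect (has_sup S).
apply: le_trans (ub_le_sup ubS Sr); case: Sr => x _ <-.
by apply: divr_ge0; exact: npw_ge0.
Qed.

End Lambda0.

Theorem theorem5p1 (R : realType) (Om : set (plane R))
  (n : nat) (p : 'I_n -> plane R) (TT : {set {set 'I_n}}) (kappa : R)
  (nu : {set 'I_n} -> plane R)
  (IM J : L2 R -> L2 R) (LJ : R)
  (Vh : set (L2 R)) (normh : L2 R -> R)
  (Ah bh ch : L2 R -> L2 R -> R) (Ih : L2 R -> L2 R)
  (alpha M Lh Ldc Mb Lc LM LM' MM : R)
  (F : L2 R -> R) (u uh : L2 R) :
  polygonal_lipschitz_domain Om ->
  triangulation Om p TT ->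
  shape_regular p TT kappa ->
  unit_normals p TT nu ->
  is_morley_interp Om p TT nu IM ->
  0 <= LJ ->
  is_companion Om p TT nu LJ J ->
  findim_subspace Vh ->
  Vh `<=` H2pw Om p TT ->
  norm_on (H2pw Om p TT) normh ->
  bilinear_on (sumset Vh (Morley Om p TT nu)) Ah ->
  bilinear_on (sumset Vh (Morley Om p TT nu)) bh ->
  bilinear_on (sumset Vh (Morley Om p TT nu)) ch ->
  (forall v w, sumset Vh (Morley Om p TT nu) v ->
     sumset Vh (Morley Om p TT nu) w ->
     Ah v w = apw p TT v w + bh v w + ch v w) ->
  linear_on (Morley Om p TT nu) Ih ->
  (forall vM, Morley Om p TT nu vM -> Vh (Ih vM)) ->
  [/\ 0 < alpha, 0 < M & 0 < Lh] ->
  [/\ 0 < Ldc, 0 < Mb & 0 < Lc] ->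
  [/\ 0 <= LM, 0 <= LM' & 0 <= MM] ->
  (forall vh, Vh vh -> alpha * normh vh ^+ 2 <= Ah vh vh) ->
  (forall vh wh, Vh vh -> Vh wh -> Ah vh wh <= M * normh vh * normh wh) ->
  (forall v, H2pw Om p TT v -> npw p TT v <= normh v) ->
  (forall v, sumset (V Om) (Morley Om p TT nu) v -> npw p TT v = normh v) ->
  (forall vh v, Vh vh -> V Om v ->
     normh (vh - IM vh) <= LM * normh (vh - v)) ->
  (forall vh, Vh vh -> normh (vh - IM vh) <= LM' * normh vh) ->
  (forall vh, Vh vh -> npw p TT (IM vh) <= MM * normh vh) ->
  (forall vM v, Morley Om p TT nu vM -> V Om v ->
     normh (vM - Ih vM) <= Lh * npw p TT (vM - v)) ->
  (forall vM wh v w, Morley Om p TT nu vM -> Vh wh -> V Om v -> V Om w ->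
     apw p TT vM (wh - IM wh) + bh vM (wh - IM wh)
       <= Ldc * npw p TT (vM - v) * normh (wh - w)) ->
  (forall vM wM, Morley Om p TT nu vM -> Morley Om p TT nu wM ->
     bh vM wM = 0) ->
  (forall vh wh vM wM, Vh vh -> Vh wh ->
     Morley Om p TT nu vM -> Morley Om p TT nu wM ->
     bh (vh + vM) (wh + wM) <= Mb * normh (vh + vM) * normh (wh + wM)) ->
  (forall vh wh v w, Vh vh -> Vh wh -> V Om v -> V Om w ->
     ch vh wh <= Lc * normh (v - vh) * normh (w - wh)) ->
  dualV Om F ->
  V Om u ->
  (forall v, V Om v -> aform Om u v = F v) ->
  Vh uh ->
  (forall vh, Vh vh -> Ah uh vh = F (J (IM vh))) ->
  let L0 := Lambda0 Om p TT nu J in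
  let Cqo := 1 + Lh
    + alpha^-1 * (L0 * MM + Lh * (1 + Mb) + Ldc + Lc * (1 + Lh)) in
  normh (u - uh) <= Cqo * npw p TT (u - IM u) /\
  nV Om (u - J (IM uh)) <= (1 + LM) * (1 + LJ) * normh (u - uh).

Proof.
move=> dom tr _ nuP HIM LJ0 HJ [d [ev VhE]] VhH Nh Ahb bhb _ AhE _ IhV [al0 _ Lh0] [Ldc0 Mb0 Lc0]
  [LM0 _ MM0] coer _ Nnh NVM IMapp _ IMb Ihapp cons bhM bhbd chbd _ Vu usol Vuh uhsol L0 Cqo.
have Vhlin (c : R) x y : Vh x -> Vh y -> Vh (c *: x + y).
  rewrite VhE => -[cx ->] [cy ->]; exists (fun i => c * cx i + cy i).
  by rewrite scaler_sumr -big_split; apply: eq_bigr => i _; rewrite scalerDl scalerA.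
have V0 : V Om 0 := set0_of_lin (V_lin dom) Vu.
have JV w : Morley Om p TT nu w -> V Om (J w).
  by move=> Mw; have [_ /(_ w Mw)[[_ VJ] _ _ _ _]] := HJ.
have Vpw := V_H2pw dom tr; have Mpw := Morley_H2pw tr (nu := nu).
have IMM v : H2pw Om p TT v -> Morley Om p TT nu (IM v) by move=> /HIM[].
have Hlin := H2pw_lin (Om := Om) (p := p) (TT := TT).
have alin := apw_lin (Om := Om) (p := p) (TT := TT).
have a0 := apw_ge0 p TT; have asym := apw_sym p TT.
split.
  apply: (quasi_optimality (J := J) (F := F) (L0 := L0) Hlin alin asym a0 (V_lin dom) Vhlin Vpw Mpw VhH (Morley0 nu tr) Nh Nnh NVM
    Ahb bhb AhE IhV IMM al0 _ coer IMb Ihapp cons bhM bhbd chbd Vu Vuh).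
  - split; first by split; exact: ltW.
    by split=> //; exact: Lambda0_ge0.
  - by move=> w Mw; apply: Vpw; exact: JV.
  - by move=> w Mw; exact: (Lambda0_bound LJ0 HJ dom tr).
  - move=> w Mw; rewrite -(usol _ (JV w Mw)).
    exact: (aform_apw dom tr Vu (JV w Mw)).
  - exact: uhsol.
  - by move=> w Mw; exact: (apw_interp dom tr nuP HIM).
  - by move=> w q Mw Mq; exact: (apw_companion dom tr nuP HJ).
have Muh : Morley Om p TT nu (IM uh) := IMM _ (VhH _ Vuh).
have VuJ : V Om (u - J (IM uh)) by rewrite (subE u (J (IM uh))); exact: (V_lin dom (- 1) (JV _ Muh) Vu).
rewrite (nV_npw dom tr VuJ).
apply: (companion_error (J := J) Hlin alin asym a0 Vpw Mpw VhH Nh Nnh IMM Vu Vuh _ LJ0 _ IMapp).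
- by move=> w Mw; apply: Vpw; exact: JV.
- by move=> w v Mw Vv; exact: (companion_approx LJ0 HJ).
Qed.
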